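(* Fix $\rho\in(0,1)$ and let $(\xi,\gamma)\sim\nu^\rho$. Then for every real $h\ge0$, $$\mathbb P[\xi(\mathbf 0)>h]=\left(1+\frac{\rho(1-\rho)h}{(1-\rho)^2+\rho^2}\right)\bigl(1+\rho(1-\rho)h\bigr)e^{-h}.$$
   Context: $\mathbf 0=(0,0)\in\mathbb Z^2$. The probability measure $\nu^\rho$ on $\mathbb R^{\mathbb Z^2}\times\{0,1\}^{\mathbb Z^2}$ (subsets of $\mathbb Z^2$ being identified with their indicators) is defined as follows. (i) For $\theta\in(0,1)$ let $Y_1(x),Y_2(x)$, $x\ge1$, be independent Bernoulli($\theta$) variables, $W(x)=\sum_{y=1}^x(Y_2(y)-Y_1(y))$ for $x\ge 0$, $M(x)=\max_{0\le y\le x}W(y)$, $\mathcal E=\{x\ge1:M(x)>M(x-1)\}$. Let $\Psi^\theta_+$ be the law of $(\mathbf 1[Y_1(x)=1\text{ or }x\in\mathcal E])_{x\ge1}$. Let $\Psi^\rho$ be the law of $\zeta^*\in\{0,1,*\}^{\mathbb Z}$ with $\zeta^*(0)=*$, $(\zeta^*(x))_{x\ge1}\sim\Psi^\rho_+$, and, independently, $(1-\zeta^*(-x))_{x\ge1}\sim\Psi^{1-\rho}_+$. (ii) TASEP with a single second-class particle is the Markov process on configurations in $\{0,1,*\}^{\mathbb Z}$ ($1$ = particle, $0$ = hole, $*$ = second-class particle, exactly one $*$) in which, independently for each $x$ and at rate $1$, the values at $x,x+1$ are swapped if they equal $(1,0)$, $(1,* )$ or $( *,0)$. Recentring so that $*$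 is always at site $0$ gives ''TASEP as seen from an isolated second-class particle''. It is known that $\Psi^\rho$ is stationary for it; let $(\zeta^*_t)_{t\in\mathbb R}$ be the stationary process with $\zeta^*_t\sim\Psi^\rho$ for each $t$. (iii) Replace $*$ by a hole-particle pair: $\zeta_t(x)=\zeta^*_t(x)$ for $x<0$, $\zeta_t(0)=0$, $\zeta_t(1)=1$, $\zeta_t(x)=\zeta^*_t(x-1)$ for $x>1$. This is ordinary TASEP (each particle swaps at rate 1 with a hole immediately to its right) as seen from a tracked adjacent pair (hole, particle) kept at sites $(0,1)$: when the pair's particle swaps with the hole on its right the pair moves one step right, and when the pair's hole swaps with the particle on its left the pair moves one step left. Let $\tilde{\boldsymbol\Psi}$ be the law of $(\zeta_t)_{t\in\mathbb R}$. (iv) Let $\boldsymbol\Psi^{(1)}$ be the law of the process $(\zeta_t)_{t\in\mathbb R}$ such that $(\zeta_t)_{t<0}$ has the law of the negative-time part under $\tilde{\boldsymbol\Psi}$ conditioned on $\zeta_{0-}(2)=0$; $\zeta_0(-1)=\zeta_0(0)=0$, $\zeta_0(1)=1$, $\zeta_0(x)=\zeta_{0-}(x+1)$ for $x\notin\{-1,0,1\}$ (a jump of the pair to the right at time $0$); and $(\zeta_t)_{t\ge0}$ is TASEP as seen from a hole-particle pair started from $\zeta_0$ (conditionally independent of the past given $\zeta_0$). Let $\boldsymbol\Psi^{(2)}$ be defined likewise with conditioning on $\zeta_{0-}(-1)=1$ and $\zeta_0(0)=0$, $\zeta_0(1)=\zeta_0(2)=1$, $\zeta_0(x)=\zeta_{0-}(x-1)$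 for $x\notin\{0,1,2\}$ (a jump to the left at time $0$). Set $\boldsymbol\Psi=\frac{(1-\rho)^2\boldsymbol\Psi^{(1)}+\rho^2\boldsymbol\Psi^{(2)}}{(1-\rho)^2+\rho^2}$. (v) Under $\boldsymbol\Psi$, label holes by $\mathbb Z$ increasingly from left to right and particles by $\mathbb Z$ increasingly from right to left, so that in $\zeta_0$ the hole at site $0$ and the particle at site $1$ both have label $0$; labels are carried along by the (uncentred) TASEP motion for all times $t\in\mathbb R$. Let $L(a,b)\in\mathbb R$ be the time at which the particle labeled $b$ swaps with the hole labeled $a$ (so $L(\mathbf 0)=0$). Put $\xi(a,b)=\min\{L(a+1,b),L(a,b+1)\}-L(a,b)$, and let $\gamma\subset\mathbb Z^2$ be the set of $(a,b)$ such that at some time the tracked pair consists of the hole labeled $a$ (at site $0$) and the particle labeled $b$ (at site $1$). Then $\nu^\rho$ is the law of $(\xi,\gamma)$ under $\boldsymbol\Psi$. *)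

(* Defs.v *)
From HB Require Import structures.
From mathcomp Require Import all_boot all_order all_algebra.
From mathcomp Require Import all_classical all_reals all_analysis.

Set Implicit Arguments.
Unset Strict Implicit.
Unset Printing Implicit Defensive.

Import Order.TTheory GRing.Theory Num.Theory.
Import numFieldNormedType.Exports.

Local Open Scope classical_set_scope.
Local Open Scope ring_scope.

(** Laws of families of discrete or real random variables are compared through
    their finite-dimensional distributions: [A i] ranges over a family of events
    whose finite intersections generate the sigma-algebra at hand. *)

Definition cylinder (I T : Type) (A : I -> set T) (l : seq I) : set T :=
  \big[setI/setT]_(i <- l) A i.

Definition conditional (R : realType) (d : measure_display)
    (T : measurableType d) (P : probability T R) (A E : set T) : \bar R :=
  (fine (P (A `&` E)) / fine (P E))%:E.

Definition left_val (R : realType) (V : Type) (f : R -> V) (t : R) (v : V) :=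
  \forall u \near t^'-, f u = v.

Definition cadlag (R : realType) (V : Type) (f : R -> V) : Prop :=
  forall t, (\forall u \near t^'+, f u = f t) /\ exists v, left_val f t v.

Section initial_laws.
Variable R : realType.

Definition iid_bernoulli_pair (theta : R) (d : measure_display)
    (T : measurableType d) (P : probability T R) (Y1 Y2 : nat -> T -> bool) :=
  (forall x b, measurable [set w | Y1 x w = b]
            /\ measurable [set w | Y2 x w = b]) /\
  forall (n : nat) (b1 b2 : nat -> bool),
    P (\big[setI/setT]_(1 <= x < n.+1)
         ([set w | Y1 x w = b1 x] `&` [set w | Y2 x w = b2 x]))
    = (\prod_(1 <= x < n.+1)
         (bernoulli_pmf theta (b1 x) * bernoulli_pmf theta (b2 x)))%:E.

Definition walk (y1 y2 : nat -> bool) (x : nat) : int :=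
  \sum_(1 <= y < x.+1) ((y2 y : nat)%:Z - (y1 y : nat)%:Z).

(* The unit 0 of the maximum is harmless since [walk y1 y2 0 = 0]. *)
Definition walk_max (y1 y2 : nat -> bool) (x : nat) : int :=
  \big[Num.max/0]_(0 <= y < x.+1) walk y1 y2 y.

Definition is_record (y1 y2 : nat -> bool) (x : nat) : bool :=
  (1 <= x)%N && (walk_max y1 y2 x.-1 < walk_max y1 y2 x).

(* [(a x)_(x >= 1)] has law [Psi^theta_+]; [a 0] is irrelevant. *)
Definition law_Psi_plus (theta : R) (d : measure_display)
    (T : measurableType d) (P : probability T R) (a : nat -> T -> bool) :=
  exists (d' : measure_display) (T' : measurableType d')
         (P' : probability T' R) (Y1 Y2 : nat -> T' -> bool),
    iid_bernoulli_pair theta P' Y1 Y2 /\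
    forall l : seq (nat * bool), all (fun i => (1 <= i.1)%N) l ->
      P (cylinder (fun i => [set w | a i.1 w = i.2]) l)
      = P' (cylinder (fun i => [set w |
              Y1 i.1 w || is_record (Y1^~ w) (Y2^~ w) i.1 = i.2]) l).

(* [None] is the second-class particle, [Some true] a particle,
   [Some false] a hole. *)
Definition law_Psi_rho (rho : R) (d : measure_display)
    (T : measurableType d) (P : probability T R)
    (c : T -> int -> option bool) :=
  let right (x : nat) w := c w x%:Z == Some true in
  let left (x : nat) w := c w (- x%:Z) == Some false in
  [/\ forall x v, measurable [set w | c w x = v],
      forall w x, c w x = None <-> x = 0,
      law_Psi_plus rho P right,
      law_Psi_plus (1 - rho) P left &
      forall l1 l2 : seq (nat * bool),
        all (fun i => (1 <= i.1)%N) l1 -> all (fun i => (1 <= i.1)%N) l2 ->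
        let A := cylinder (fun i => [set w | right i.1 w = i.2]) l1 in
        let B := cylinder (fun i => [set w | left i.1 w = i.2]) l2 in
        P (A `&` B) = (P A * P B)%E].

End initial_laws.

(** A process is a pair [(z, X)]: the configuration [z] seen from the tracked
    object (second-class particle, or hole-particle pair) and the displacement
    [X] of that object on the fixed lattice.  Both states are discrete: [left_val]
    and [cadlag] are limits for the discrete topology, site by site. *)

Section dynamics.
Variable R : realType.

(* [ok u v]: the values [(u, v)] at two neighbouring sites may be swapped. *)
Definition ok_star (u v : option bool) : bool :=
  match u, v with
  | Some true, Some false | Some true, None | None, Some false => true
  | _, _ => false
  end.

Definition ok_pair (u v : bool) : bool := u && ~~ v.

Definition swap_sites (S : Type) (c : int -> S) (x y : int) : S :=
  c (if y == x then x + 1 else if y == x + 1 then x else y).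

(* A swap across [(r, r + 1)] moves the tracked object one step right and a swap
   across [(-1, 0)] moves it one step left: [r = 0] for the second-class
   particle at site 0, and [r = 1] for the hole-particle pair at sites (0, 1). *)
Definition frame_shift (S : Type) (ok : S -> S -> bool) (r : int)
    (c : int -> S) (x : int) : int :=
  if ok (c x) (c (x + 1)) then
    (if x == r then 1 else if x == -1 then -1 else 0)
  else 0.

Definition update (S : Type) (ok : S -> S -> bool) (r : int)
    (c : int -> S) (x y : int) : S :=
  if ok (c x) (c (x + 1)) then swap_sites c x (y + frame_shift ok r c x) else c y.

Definition rings (n : R -> int) (t : R) : Prop := ~ left_val n t (n t).

(* [n x] counts the rings of the clock of bond [(x, x + 1)] of the moving frame.
   Attaching the rate-1 clocks to the bonds of the moving rather than of the
   fixed frame does not change the jump rates of [(z, X)].  Almost surely no two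
   clocks ring simultaneously. *)
Definition motion (S : Type) (ok : S -> S -> bool) (r : int) (t0 : \bar R)
    (z : R -> int -> S) (X : R -> int) (n : int -> R -> int) : Prop :=
  forall (t : R) (c : int -> S) (k : int), (t0 < t%:E)%E ->
    (forall x, left_val (z^~ x) t (c x)) -> left_val X t k ->
    (forall x, rings (n x) t ->
       z t =1 update ok r c x /\ X t = k + frame_shift ok r c x) /\
    ((forall x, ~ rings (n x) t) -> z t =1 c /\ X t = k).

Section on_a_space.
Context {d : measure_display} {T : measurableType d}.

Definition regular_process (S : Type) (z : T -> R -> int -> S)
    (X : T -> R -> int) : Prop :=
  [/\ forall t x v, measurable [set w | z w t x = v],
      forall t k, measurable [set w | X w t = k] &
      forall w, (forall x, cadlag (fun t => z w t x)) /\ cadlag (X w)].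

(* Only increments of [X] and [N] enter: with [X w 0 = 0], the value [X w s] at
   a time [s < 0] would depend on what happens after [s]. *)
Definition history (S : Type) (t0 : \bar R) (z : T -> R -> int -> S)
    (X : T -> R -> int) (N : T -> int -> R -> int) (s : R) : set (set T) :=
  <<s [set A |
    [\/ exists u x v, u <= s /\ A = [set w | z w u x = v],
        exists u u' k, [/\ u <= s, u' <= s & A = [set w | X w u - X w u' = k]] |
        exists u u' x k, [/\ (t0 <= u%:E)%E /\ u <= s, (t0 <= u'%:E)%E /\ u' <= s
                           & A = [set w | N w x u - N w x u' = k]]]] >>.

(* Independent rate-1 Poisson clocks on the times [>= t0], whose rings after any
   time [s] are independent of the history up to [s]. *)
Definition poisson_clocks (S : Type) (t0 : \bar R) (P : probability T R)
    (z : T -> R -> int -> S) (X : T -> R -> int)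
    (N : T -> int -> R -> int) : Prop :=
  [/\ forall x t k, measurable [set w | N w x t = k],
      forall w x, {homo N w x : u v / u <= v} /\ cadlag (N w x) &
      forall (s t : R) (A : set T) (xs : seq int) (k : int -> nat),
        (t0 <= s%:E)%E -> s < t -> history t0 z X N s A -> uniq xs ->
        P (A `&` cylinder (fun x => [set w | N w x t - N w x s = (k x)%:Z]) xs)
        = (P A * (\prod_(x <- xs) poisson_pmf (t - s) (k x))%:E)%E].

Definition tasep_from (S : Type) (ok : S -> S -> bool) (r : int) (t0 : \bar R)
    (P : probability T R) (z : T -> R -> int -> S) (X : T -> R -> int) : Prop :=
  regular_process z X /\
  exists N : T -> int -> R -> int, poisson_clocks t0 P z X N /\
    {ae P, forall w, motion ok r t0 (z w) (X w) (N w)}.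

(* The stationary process [(zeta^*_t)_(t in RR)]. *)
Definition stationary_star (rho : R) (P : probability T R)
    (z : T -> R -> int -> option bool) (X : T -> R -> int) : Prop :=
  [/\ tasep_from ok_star 0 -oo%E P z X,
      forall t, law_Psi_rho rho P (fun w => z w t) &
      forall w, X w 0 = 0].

End on_a_space.

Definition expand (c : int -> option bool) (x : int) : bool :=
  if x < 0 then c x == Some true
  else if x == 0 then false
  else if x == 1 then true
  else c (x - 1) == Some true.

Definition pair_time (i : (R * int * bool) + (R * int)) : R :=
  match i with inl (t, _, _) => t | inr (t, _) => t end.

Definition pair_event (T : Type) (z : T -> R -> int -> bool) (X : T -> R -> int)
    (i : (R * int * bool) + (R * int)) : set T :=
  match i with
  | inl (t, x, v) => [set w | z w t x = v]
  | inr (t, k) => [set w | X w t = k]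
  end.

Definition jump_right (c : int -> bool) (x : int) : bool :=
  if (x == -1) || (x == 0) then false else if x == 1 then true else c (x + 1).

Definition jump_left (c : int -> bool) (x : int) : bool :=
  if x == 0 then false else if (x == 1) || (x == 2) then true else c (x - 1).

(* Past of the stationary pair process conditioned on [zeta_{0-}(site) = v], jump
   at time 0 given by [jump] and the displacement [delta], TASEP afterwards. *)
Definition law_Psi_jump (site : int) (v : bool)
    (jump : (int -> bool) -> int -> bool) (delta : int) (rho : R)
    (d : measure_display) (T : measurableType d) (P : probability T R)
    (z : T -> R -> int -> bool) (X : T -> R -> int) : Prop :=
  (exists (d' : measure_display) (T' : measurableType d')
          (P' : probability T' R)
          (zs : T' -> R -> int -> option bool) (Xs : T' -> R -> int),
     stationary_star rho P' zs Xs /\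
     let z' w t := expand (zs w t) in
     let E := [set w | left_val (fun t => z' w t site) 0 v] in
     forall l, all (fun i => pair_time i < 0) l ->
       P (cylinder (pair_event z X) l)
       = conditional P' (cylinder (pair_event z' Xs) l) E) /\
  {ae P, forall w, forall c k,
     (forall x, left_val (fun t => z w t x) 0 (c x)) -> left_val (X w) 0 k ->
     z w 0 =1 jump c /\ X w 0 = k + delta} /\
  tasep_from ok_pair 1 0%:E P z X.

Definition law_Psi1 := law_Psi_jump 2 false jump_right 1.
Definition law_Psi2 := law_Psi_jump (-1) true jump_left (-1).

Definition law_Psi (rho : R) (d : measure_display) (T : measurableType d)
    (P : probability T R) (z : T -> R -> int -> bool) (X : T -> R -> int) :=
  regular_process z X /\
  exists (d1 d2 : measure_display)
         (T1 : measurableType d1) (T2 : measurableType d2)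
         (P1 : probability T1 R) (P2 : probability T2 R)
         (z1 : T1 -> R -> int -> bool) (X1 : T1 -> R -> int)
         (z2 : T2 -> R -> int -> bool) (X2 : T2 -> R -> int),
    [/\ law_Psi1 rho P1 z1 X1, law_Psi2 rho P2 z2 X2 &
     forall l, P (cylinder (pair_event z X) l)
       = (((1 - rho) ^+ 2 / ((1 - rho) ^+ 2 + rho ^+ 2))%:E
            * P1 (cylinder (pair_event z1 X1) l)
          + (rho ^+ 2 / ((1 - rho) ^+ 2 + rho ^+ 2))%:E
            * P2 (cylinder (pair_event z2 X2) l))%E].

End dynamics.

Section environment.
Variable R : realType.

Definition uncentred (z : R -> int -> bool) (X : R -> int) (t : R) (y : int) :=
  z t (y - X t).

(* The particle at [y] swaps with the hole at [y + 1] at time [t]. *)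
Definition swap_at (eta : R -> int -> bool) (t : R) (y : int) : Prop :=
  [/\ left_val (eta^~ y) t true, left_val (eta^~ (y + 1)) t false,
      eta t y = false & eta t (y + 1) = true].

(* [hole a t] and [part b t] are the uncentred positions at time [t] of the hole
   labelled [a] and of the particle labelled [b]. *)
Definition labelling (z : R -> int -> bool) (X : R -> int)
    (hole part : int -> R -> int) : Prop :=
  let eta := uncentred z X in
  [/\ [/\ hole 0 0 = X 0, {homo hole^~ 0 : a b / a < b} &
          forall y, eta 0 y = false <-> exists a, hole a 0 = y],
      [/\ part 0 0 = X 0 + 1, {homo part^~ 0 : a b / a < b >-> b < a} &
          forall y, eta 0 y = true <-> exists b, part b 0 = y],
      forall a, cadlag (hole a) /\ forall t k, left_val (hole a) t k ->
        (swap_at eta t (k - 1) -> hole a t = k - 1) /\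
        (~ swap_at eta t (k - 1) -> hole a t = k) &
      forall b, cadlag (part b) /\ forall t k, left_val (part b) t k ->
        (swap_at eta t k -> part b t = k + 1) /\
        (~ swap_at eta t k -> part b t = k)].

Definition swap_times (z : R -> int -> bool) (X : R -> int)
    (hole part : int -> R -> int) (L : int -> int -> R) : Prop :=
  forall a b, exists y : int,
    [/\ swap_at (uncentred z X) (L a b) y,
        left_val (part b) (L a b) y & left_val (hole a) (L a b) (y + 1)].

Definition environment_of (z : R -> int -> bool) (X : R -> int)
    (xi : int * int -> R) (gamma : set (int * int)) : Prop :=
  exists (hole part : int -> R -> int) (L : int -> int -> R),
    [/\ labelling z X hole part, swap_times z X hole part L,
        forall a b, xi (a, b) = Num.min (L (a + 1) b) (L a (b + 1)) - L a b &
        gamma = [set v | exists t, hole v.1 t = X t /\ part v.2 t = X t + 1]].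

Definition env_event (T : Type) (xi : int * int -> T -> R)
    (gamma : T -> set (int * int))
    (i : (int * int * R) + (int * int)) : set T :=
  match i with
  | inl (v, c) => [set w | xi v w <= c]
  | inr v => [set w | gamma w v]
  end.

Definition measurable_env (d : measure_display) (T : measurableType d)
    (xi : int * int -> T -> R) (gamma : T -> set (int * int)) : Prop :=
  (forall v, measurable_fun setT (xi v)) /\
  (forall v, measurable [set w | gamma w v]).

Definition law_nu (rho : R) (d : measure_display) (T : measurableType d)
    (P : probability T R) (xi : int * int -> T -> R)
    (gamma : T -> set (int * int)) : Prop :=
  measurable_env xi gamma /\
  exists (d' : measure_display) (T' : measurableType d')
         (P' : probability T' R)
         (z : T' -> R -> int -> bool) (X : T' -> R -> int)
         (xi' : int * int -> T' -> R) (gamma' : T' -> set (int * int)),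
    [/\ law_Psi rho P' z X, measurable_env xi' gamma',
        {ae P', forall w, environment_of (z w) (X w) (xi'^~ w) (gamma' w)} &
        forall l, P (cylinder (env_event xi gamma) l)
                  = P' (cylinder (env_event xi' gamma') l)].

End environment.

(* Main.v *)
Require Import Defs.
From mathcomp Require Import all_boot all_order all_algebra.
From mathcomp Require Import all_classical all_reals all_analysis.
From mathcomp Require Import zify ring lra.
Import Order.TTheory GRing.Theory Num.Theory.
Import numFieldNormedType.Exports.
Local Open Scope classical_set_scope.
Local Open Scope ring_scope.

Set Implicit Arguments.
Unset Strict Implicit.
Unset Printing Implicit Defensive.

(** Since [L(0,0) = 0], [xi(0,0) > h] means that the tracked pair does not move
    during [[0, h]].  Until it moves, the first hole on its right travels left at
    rate 1 through the [K] particles separating it from the pair, so that the pair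
    fails to jump right before [h] iff a Poisson([h]) variable is at most [K]; the
    same holds on the left with the number [K'] of holes, and the two Poisson
    variables are independent of each other and of the configuration at time 0.
    To avoid stopping times, on each interval of a mesh only the bond that is
    active at its beginning is observed: the total count is then exactly Poisson,
    and it is the true count unless some mesh interval contains two rings.
    The laws of [K] and [K'] follow from [P(K >= j) = theta^j (1 + j (1 - theta))]
    under [Psi^theta_+]: a run of [j] occupied sites consists of steps [Y2 = 1]
    possibly followed by one step [(Y1, Y2) = (1, 0)] and then by steps [Y1 = 1].
    Only finite-dimensional laws are available for the process under [Psi], so
    path properties are transferred through the sigma-algebra generated by the
    coordinates; that particles and holes only move by swaps is detected on
    rational times. *)

(** * Discretely cadlag paths *)

(** The clocks are known to be independent of the history only after deterministic times, so the
    bond in front of a queue cannot be followed ring by ring; a mesh of width [h / n.+1] costs only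
    a probability of order [1 / n]. The factors of the answer come from the two jump laws. A hole at
    site 2 just before a right jump means [Y1 = Y2 = 0] at the first step, of probability
    [(1 - rho)^2], after which the walk is again at its maximum: K has the law of a fresh run. The
    old hole of the pair is left behind at site -1, so K' is a fresh run plus one. As P(Poisson(h)
    <= K) is the sum of P(K >= j) against the Poisson weights, the two sides give
    [1 + rho (1 - rho) h] and [1 + rho h], and the exponentials multiply to exp(-h). The left jump
    gives [1 + (1 - rho) h] instead of [1 + rho h], and mixing yields the first factor because [(1 -
    rho)^2 rho + rho^2 (1 - rho) = rho (1 - rho)]. Labels are fixed after the jump, so L(0,0) = 0 is
    a statement about the past: it rests on site X(0) + 1 being vacant just before time 0. *)

Section cadlag_paths.
Variable R : realType.

Lemma near_leftP (t : R) (Q : R -> Prop) :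
  (\forall u \near t^'-, Q u) <->
  exists2 a, a < t & forall u, a < u -> u < t -> Q u.
Proof.
split.
  move=> /nbhs_left0P [e /= e0 he]; exists (t - e); first by rewrite ltrBlDr ltrDl.
  move=> u h1 h2; have -> : u = t - (t - u) by rewrite subKr.
  apply: he; rewrite ?subr_gt0 //= sub0r normrN gtr0_norm ?subr_gt0 //.
  by rewrite ltrBlDr -ltrBlDl.
move=> [a h1 h2]; near=> u; apply: h2; near: u; first exact: nbhs_left_gt.
exact: nbhs_left_lt.
Unshelve. all: by end_near. Qed.

Lemma near_rightP (t : R) (Q : R -> Prop) :
  (\forall u \near t^'+, Q u) <->
  exists2 b, t < b & forall u, t < u -> u < b -> Q u.
Proof.
split.
  move=> /nbhs_right0P [e /= e0 he]; exists (t + e); first by rewrite ltrDl.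
  move=> u h1 h2; have -> : u = t + (u - t) by rewrite addrC subrK.
  apply: he; rewrite ?subr_gt0 //= sub0r normrN gtr0_norm ?subr_gt0 //.
  by rewrite ltrBlDl.
move=> [a h1 h2]; near=> u; apply: h2; near: u; first exact: nbhs_right_gt.
exact: nbhs_right_lt.
Unshelve. all: by end_near. Qed.

Lemma left_exists (t a : R) (Q : R -> Prop) :
  (\forall u \near t^'-, Q u) -> a < t -> exists u, [/\ a < u, u < t & Q u].
Proof.
move=> /near_leftP [b bt hb] at_.
have hm : Num.max a b < t by rewrite gt_max at_ bt.
exists ((Num.max a b + t) / 2).
have h1 : Num.max a b < (Num.max a b + t) / 2 by rewrite midf_lt.
have h2 : (Num.max a b + t) / 2 < t by rewrite midf_lt.
split=> //; first by apply: le_lt_trans h1; rewrite le_max lexx.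
by apply: hb => //; apply: le_lt_trans h1; rewrite le_max lexx orbT.
Qed.

Lemma left_val_inj (V : Type) (f : R -> V) t u v :
  left_val f t u -> left_val f t v -> u = v.
Proof.
move=> hu hv; have : \forall s \near t^'-, f s = u /\ f s = v.
  by apply: filterS2 hu hv.
move=> /(@left_exists t (t - 1)); rewrite ltrBlDr ltrDl ltr01 => /(_ isT).
by move=> [s [_ _ [<- <-]]].
Qed.

Lemma left_val_eq (V : Type) (f : R -> V) a t v :
  a < t -> (forall u, a <= u -> u < t -> f u = v) -> left_val f t v.
Proof. by move=> h1 h2; apply/near_leftP; exists a => // u /ltW; exact: h2. Qed.

Lemma left_val_comp2 (U V W : Type) (g : U -> V -> W) (f : R -> U) (f' : R -> V)
    t u v : left_val f t u -> left_val f' t v ->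
  left_val (fun s => g (f s) (f' s)) t (g u v).
Proof. by apply: filterS2 => s -> ->. Qed.

(* Real induction: the right limits carry [Q] past each time, the left limits
   carry it to each supremum. *)
Lemma real_induction (Q : R -> Prop) (a b : R) :
  Q a ->
  (forall t, a <= t -> t < b -> Q t -> \forall u \near t^'+, Q u) ->
  (forall t, a < t -> t <= b -> (forall u, a <= u -> u < t -> Q u) -> Q t) ->
  forall t, a <= t -> t <= b -> Q t.
Proof.
move=> Qa hr hl.
suff H t : a <= t -> t <= b -> forall u, a <= u -> u <= t -> Q u.
  by move=> t h1 h2; apply: (H t).
pose S := [set s | a <= s /\ s <= b /\ forall u, a <= u -> u <= s -> Q u].
move=> at_ tb; have ab := le_trans at_ tb.
have Sa : S a.
  split=> //; split=> // u h1 h2.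
  by have -> : u = a by apply/eqP; rewrite eq_le h1 h2.
have hS : has_sup S by split; [exists a | exists b => s [_ []]].
set m := sup S.
have am : a <= m by apply: ub_le_sup => //; case: hS.
have mb : m <= b by apply: ge_sup; [exists a|move=> s [_ []]].
have hlt u : a <= u -> u < m -> Q u.
  move=> au um; have [s [_ [_ hs]] us] := @sup_gt _ S u (ex_intro _ _ Sa) um.
  by apply: hs => //; exact: ltW.
have Qm : Q m.
  move: am; rewrite le_eqVlt => /predU1P [<-//|am].
  by apply: hl.
have hle u : a <= u -> u <= m -> Q u.
  by move=> au; rewrite le_eqVlt => /predU1P [->//|]; exact: hlt.
suff mb' : b <= m by move=> u au ut; apply: hle => //; apply: le_trans mb'; apply: le_trans tb.
rewrite leNgt; apply/negP => mltb.
have [c mc hc] := (near_rightP _ _).1 (hr m am mltb Qm).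
pose s := Num.min b ((m + c) / 2).
have ms : m < s by rewrite lt_min mltb midf_lt.
have sc : s < c by rewrite gt_min midf_lt ?orbT.
have : S s.
  split; first exact: le_trans (ltW ms).
  split; first by rewrite ge_min lexx.
  move=> u au us; case: (leP u m) => [|mu]; first exact: hle.
  by apply: hc => //; exact: le_lt_trans sc.
by move=> /(ub_le_sup hS.2) /(lt_le_trans ms); rewrite ltxx.
Qed.

(** Limits are discrete, so a path can leave its value only at a time whose left limit is still that
    value; ruling out such times is enough. *)
Lemma cadlag_const (V : Type) (f : R -> V) (a b : R) :
  cadlag f ->
  (forall t, a < t -> t <= b -> left_val f t (f a) -> f t = f a) ->
  forall t, a <= t -> t <= b -> f t = f a.
Proof.
move=> cf hl; apply: real_induction => //.
  move=> t at_ tb ft; have [h _] := cf t.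
  by apply: filterS h => u ->.
move=> t at_ tb h; apply: hl => //; exact: left_val_eq h.
Qed.

Lemma cadlag_nondecreasing (f : R -> int) :
  cadlag f -> (forall t k, left_val f t k -> k <= f t) ->
  forall a b, a <= b -> f a <= f b.
Proof.
move=> cf hl a b ab.
apply: (@real_induction (fun t => f a <= f t) a b) => //.
  move=> t at_ tb ft; have [h _] := cf t.
  by apply: filterS h => u ->.
move=> t at_ tb h; have [_ [v hv]] := cf t.
have [s [h1 h2 h3]] := left_exists hv at_.
apply: le_trans (hl t v hv); rewrite -h3; apply: h => //; exact: ltW.
Qed.

Lemma cadlag_nonincreasing (f : R -> int) :
  cadlag f -> (forall t k, left_val f t k -> f t <= k) ->
  forall a b, a <= b -> f b <= f a.
Proof.
move=> cf hl a b ab; rewrite -lerN2.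
apply: (@cadlag_nondecreasing (fun t => - f t)) => //.
  move=> t; have [h [v hv]] := cf t; split.
    by apply: filterS h => u ->.
  by exists (- v); apply: filterS hv => u ->.
move=> t k hk; rewrite lerNr; apply: hl.
by apply: filterS hk => u <-; rewrite opprK.
Qed.

End cadlag_paths.

(** * Exclusion paths: the front hole and the front particle *)

Section exclusion.
Variable R : realType.

(** Particles only move by jumps to the right: one leaves [y] exactly when one arrives at [y + 1].
    No clock occurs, only two neighbouring coordinates, which is what can be carried from one
    process to another through laws. *)
Definition exchange_rule (e : R -> int -> bool) (t : R) : Prop :=
  forall y b1 b2, left_val (e^~ y) t b1 -> left_val (e^~ (y + 1)) t b2 ->
  (b1 && ~~ e t y) = (~~ b2 && e t (y + 1)).

Lemma near_int_range (F : set_system R) (FF : Filter F) (Q : int -> R -> Prop)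
    (a b : int) :
  (forall x, \forall u \near F, Q x u) ->
  \forall u \near F, forall x, a <= x -> x < b -> Q x u.
Proof.
move=> h.
have : \forall u \near F, forall i : 'I_`|b - a|%N, Q (a + (i : nat)%:Z) u.
  by apply: filter_forall => i; exact: h.
apply: filterS => u hu x ax xb.
have hi : (`|x - a| < `|b - a|)%N by lia.
have := hu (Ordinal hi) => /=; suff -> : a + `|x - a|%N%:Z = x by []; lia.
Qed.

(** Identifies the label of the hole met by the particle of the pair. Between [a] and [H] there are
    only particles, and the exchange rule lets none of them move except the last, which swaps with
    [H]. Since site [a] stays occupied until [tau], the hole that reaches [a + 1] can only be
    [H]. *)
Lemma first_hole_swap (e : R -> int -> bool) (H : R -> int) (a : int)
    (s tau : R) :
  (forall y, cadlag (e^~ y)) -> cadlag H -> s < tau ->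
  (forall t, s < t -> t <= tau -> exchange_rule e t) ->
  (forall t k, s < t -> t <= tau -> left_val H t k ->
     (swap_at e t (k - 1) -> H t = k - 1) /\ (~ swap_at e t (k - 1) -> H t = k)) ->
  a < H s -> e s (H s) = false -> (forall x, a <= x -> x < H s -> e s x = true) ->
  (forall t, s <= t -> t < tau -> e t a = true) ->
  swap_at e tau a -> H tau = a.
Proof.
move=> ce cH stau he hH aH0 eH0 ex0 hea hsw.
pose Q t := [/\ a < H t, e t (H t) = false &
                forall x, a <= x -> x < H t -> e t x = true].
have left_pattern t p : s < t -> (forall u, s <= u -> u < t -> Q u) ->
    left_val H t p -> [/\ a < p, left_val (e^~ p) t false &
      forall x, a <= x -> x < p -> left_val (e^~ x) t true].
  move=> st hQ hp.
  have hn : \forall u \near t^'-, H u = p /\ Q u.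
    near=> u; split; first by near: u.
    apply: hQ.
      by near: u; exact: nbhs_left_ge.
    by near: u; exact: nbhs_left_lt.
  split.
  - by have [u [_ _ [<- []]]] := left_exists hn st.
  - by apply: filterS hn => u [<- []].
  - by move=> x h1 h2; apply: filterS hn => u [hu [_ _]]; rewrite hu; apply.
have hQ t : s <= t -> t <= tau -> t < tau -> Q t.
  apply: (@real_induction _ (fun t => t < tau -> Q t)) => //.
    move=> t' st tt /(_ tt) [Q1 Q2 Q3].
    have [hH1 _] := cH t'.
    have [he1 _] := ce (H t') t'.
    have he2 : \forall u \near t'^'+, forall x, a <= x -> x < H t' ->
        e u x = e t' x.
      by apply: near_int_range => x; have [] := ce x t'.
    near=> u => _.
    have Hu : H u = H t' by near: u.
    have eu : e u (H t') = e t' (H t') by near: u.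
    split; rewrite Hu //; first by rewrite eu.
    move=> x h1 h2; rewrite -(Q3 x h1 h2); move: x h1 h2; near: u.
    exact: he2.
  move=> t' st tt hQ' tt'.
  have {}hQ' u : s <= u -> u < t' -> Q u.
    by move=> h1 h2; apply: hQ' => //; exact: lt_trans tt'.
  have [_ [p hp]] := cH t'.
  have [ap lp lx] := left_pattern t' p st hQ' hp.
  (* Inside the block the right neighbour is occupied, so no particle can leave. *)
  have hxx x : a <= x -> x < p - 1 -> e t' x = true.
    move=> h1 h2; have := he t' st tt x true true.
    rewrite /= => /(_ (lx x h1 _) (lx (x + 1) _ _)).
    by move=> /(_ ltac:(lia) ltac:(lia) ltac:(lia)) /negbFE.
  have lp1 : left_val (e^~ (p - 1)) t' true by apply: lx; lia.
  have := he t' st tt (p - 1) true false lp1; rewrite subrK => /(_ lp) /=.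
  have [hs hns] := hH t' p st tt hp.
  case ep : (e t' p) => /= ep1.
    have sw : swap_at e t' (p - 1) by split; rewrite ?subrK //; apply/negbTE.
    have Hp := hs sw.
    split; rewrite Hp //; last by apply/negbTE.
    (* [H] cannot have reached [a] before [tau], where [a] is still occupied. *)
    have : a != p - 1.
      by apply: contraTneq ep1 => <-; rewrite hea ?negbK //; exact: ltW.
    by move=> /eqP; lia.
  have Hp : H t' = p by apply: hns => -[_ _ h1 _]; rewrite h1 in ep1.
  split; rewrite Hp // => x h1 h2; case: (ltP x (p - 1)) => h3; first exact: hxx.
  have -> : x = p - 1 by lia.
  exact: negbFE.
have {}hQ u : s <= u -> u < tau -> Q u by move=> h1 h2; apply: hQ => //; exact: ltW.
have [_ [p hp]] := cH tau.
have [ap lp lx] := left_pattern tau p stau hQ hp.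
have pa : p = a + 1.
  apply/eqP; rewrite eq_le; apply/andP; split; last by lia.
  rewrite leNgt; apply/negP => hh.
  have [_ h2 _ _] := hsw.
  by have := left_val_inj h2 (lx (a + 1) ltac:(lia) hh).
have [hs _] := hH tau p stau (lexx _) hp.
by move: hs; rewrite pa addrK; apply.
Unshelve. all: by end_near. Qed.

Lemma left_val_negb (f : R -> bool) t b :
  left_val (fun u => ~~ f u) t b = left_val f t (~~ b).
Proof. by apply/propext; split; apply: filterS => u; [move=> <-; rewrite negbK|move=> ->; rewrite negbK]. Qed.

Lemma cadlag_comp (V W : Type) (g : V -> W) (f : R -> V) :
  cadlag f -> cadlag (fun u => g (f u)).
Proof.
move=> cf t; have [h [v hv]] := cf t; split; first by apply: filterS h => u ->.
by exists (g v); apply: filterS hv => u ->.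
Qed.

(* Reflection of the line together with particle-hole exchange. *)
Lemma first_particle_swap (e : R -> int -> bool) (H : R -> int) (a : int)
    (s tau : R) :
  (forall y, cadlag (e^~ y)) -> cadlag H -> s < tau ->
  (forall t, s < t -> t <= tau -> exchange_rule e t) ->
  (forall t k, s < t -> t <= tau -> left_val H t k ->
     (swap_at e t k -> H t = k + 1) /\ (~ swap_at e t k -> H t = k)) ->
  H s < a -> e s (H s) = true -> (forall x, H s < x -> x <= a -> e s x = false) ->
  (forall t, s <= t -> t < tau -> e t a = false) ->
  swap_at e tau (a - 1) -> H tau = a.
Proof.
move=> ce cH st he hH Ha eH ex ea sw.
pose e' t y := ~~ e t (- y); pose H' t := - H t.
have sw_refl t y : swap_at e' t y = swap_at e t (- y - 1).
  apply/propext; rewrite /swap_at /e' !left_val_negb opprD /= subrK; split=> -[h1 h2 h3 h4];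
  split=> //; move: h3 h4.
  - by move=> _ /negbTE.
  - by move=> /negbFE.
  - by move=> _ ->.
  - by move=> ->.
suff : H' tau = - a by rewrite /H' => /oppr_inj.
apply: (@first_hole_swap e' H' (- a) s tau) => //.
- by move=> y; apply: (@cadlag_comp _ _ negb); exact: ce.
- exact: cadlag_comp.
- move=> t h1 h2 y b1 b2; rewrite /e' !left_val_negb opprD => h3 h4.
  have := he t h1 h2 (- y - 1) (~~ b2) (~~ b1).
  rewrite subrK => /(_ h4 h3).
  by move=> ->; rewrite !negbK.
- move=> t k h1 h2 h3.
  have h3' : left_val H t (- k) by apply: filterS h3 => u <-; rewrite opprK.
  have [h4 h5] := hH t (- k) h1 h2 h3'; rewrite /H' !sw_refl opprB addrC addKr.
  by split; [move=> /h4 ->; rewrite opprD opprK|move=> /h5 ->; rewrite opprK].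
- by rewrite ltrN2.
- by rewrite /e' /H' opprK eH.
- move=> x h1 h2; rewrite /e' ex //; first by rewrite /H' in h2; lia.
  by lia.
- by move=> t h1 h2; rewrite /e' opprK ea.
- by rewrite sw_refl opprK.
Qed.

End exclusion.

(** * The environment around the origin *)

Section env.
Variable R : realType.

Lemma uncentred_left_val (z : R -> int -> bool) (X : R -> int) t k y v :
  left_val X t k -> left_val (z^~ (y - k)) t v ->
  left_val ((uncentred z X)^~ y) t v.
Proof. by apply: filterS2 => u; rewrite /uncentred => -> ->. Qed.

Lemma uncentred_cadlag (z : R -> int -> bool) (X : R -> int) y :
  (forall x, cadlag (z^~ x)) -> cadlag X -> cadlag ((uncentred z X)^~ y).
Proof.
move=> cz cX t; have [hX [k lk]] := cX t; split.
  have [hz _] := cz (y - X t) t; apply: filterS2 hX hz => u.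
  by rewrite /uncentred => -> ->.
have [_ [v lv]] := cz (y - k) t; exists v; exact: uncentred_left_val lk lv.
Qed.

Lemma incr_int (f : int -> int) : {homo f : a b / a < b} ->
  forall a b, f a < f b -> a < b.
Proof.
move=> hf a b h; rewrite ltNge; apply/negP; rewrite le_eqVlt => /predU1P [ba|/hf].
  by move: h; rewrite ba ltxx.
by move=> /(lt_trans h); rewrite ltxx.
Qed.

(** Until the pair moves, its hole and its particle keep label 0. Its first move to the right is the
    swap of particle 0 with hole 1, its first move to the left the swap of hole 0 with particle 1,
    so the first displacement happens at min(L(1,0), L(0,1)). Holes only go left and particles only
    go right, which excludes every other order of events. *)
Lemma environment_xi_le (z : R -> int -> bool) (X : R -> int)
    (xi : int * int -> R) (gamma : set (int * int)) (h : R) :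
  environment_of z X xi gamma ->
  (forall x, cadlag (z^~ x)) -> cadlag X ->
  (forall t, 0 <= t -> z t 0 = false /\ z t 1 = true) ->
  left_val (fun u => uncentred z X u (X 0 + 1)) 0 false ->
  (forall t, t < 0 -> exchange_rule (uncentred z X) t) ->
  (forall t, 0 < t -> exchange_rule (uncentred z X) t) ->
  (forall t k, 0 < t -> left_val X t k -> `|X t - k| <= 1) ->
  xi (0, 0) <= h <-> exists u, [/\ 0 <= u, u <= h & X u <> X 0].
Proof.
move=> [hole [part [L [[[h0 hinc hch] [p0 pdec pch] holeE partE] hL hxi _]]]].
move=> cz cX hz left0 exneg expos hX1.
set eta := uncentred z X in hch pch holeE partE hL left0 exneg expos.
have ce y : cadlag (eta^~ y) by exact: uncentred_cadlag.
have chole a : cadlag (hole a) by have [] := holeE a.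
have cpart b : cadlag (part b) by have [] := partE b.
have hole_left a t k : left_val (hole a) t k -> hole a t = k - 1 \/ hole a t = k.
  move=> hk; have [_ /(_ t k hk) [h1 h2]] := holeE a.
  by have [/h1|/h2] := pselect (swap_at eta t (k - 1)); [left|right].
have part_left b t k : left_val (part b) t k -> part b t = k + 1 \/ part b t = k.
  move=> hk; have [_ /(_ t k hk) [h1 h2]] := partE b.
  by have [/h1|/h2] := pselect (swap_at eta t k); [left|right].
have hole_mono a s t : s <= t -> hole a t <= hole a s.
  move=> st; apply: cadlag_nonincreasing => // u k /hole_left; lia.
have part_mono b s t : s <= t -> part b s <= part b t.
  move=> st; apply: cadlag_nondecreasing => // u k /part_left; lia.
have hole_left_le a s t k : s < t -> left_val (hole a) t k -> k <= hole a s.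
  move=> st hk; have [u [h1 h2 <-]] := left_exists hk st; apply: hole_mono.
  exact: ltW.
have part_left_le b s t k : s < t -> left_val (part b) t k -> part b s <= k.
  move=> st hk; have [u [h1 h2 <-]] := left_exists hk st; apply: part_mono.
  exact: ltW.
have swapE a b : exists y, [/\ swap_at eta (L a b) y,
    left_val (part b) (L a b) y, left_val (hole a) (L a b) (y + 1),
    part b (L a b) = y + 1 & hole a (L a b) = y].
  have [y [hs hp hh]] := hL a b; exists y; split=> //.
    by have [_ /(_ _ _ hp) [/(_ hs)]] := partE b.
  by have [_ /(_ _ _ hh) []] := holeE a; rewrite addrK => /(_ hs).
have z0 t : 0 <= t -> eta t (X t) = false by move=> /hz []; rewrite /eta /uncentred subrr.
have z1 t : 0 <= t -> eta t (X t + 1) = true.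
  by move=> /hz []; rewrite /eta /uncentred addrAC subrr add0r.
have hole1 : X 0 + 1 < hole 1 0.
  have h1 : hole 0 0 < hole 1 0 by exact: hinc.
  have h2 : hole 1 0 <> X 0 + 1.
    move=> h2; have : eta 0 (hole 1 0) = false by apply/hch; exists 1.
    by rewrite h2 z1.
  lia.
have part1 : part 1 0 < X 0.
  have h1 : part 1 0 < part 0 0 by exact: pdec.
  have h2 : part 1 0 <> X 0.
    move=> h2; have : eta 0 (part 1 0) = true by apply/pch; exists 1.
    by rewrite h2 z0.
  lia.
(* A positive [L 0 0] is impossible because particle 0 is already to the right of hole 0 at time 0.
   A negative one would put that particle at [X 0 + 1] from then until time 0, while [left0] makes
   this site vacant just before 0. *)
have L00 : L 0 0 = 0.
  have [y [hs hp hh hp' hh']] := swapE 0 0.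
  case: (ltgtP (L 0 0) 0) => // hlt.
    have := part_mono 0 _ _ (ltW hlt); have := hole_mono 0 _ _ (ltW hlt) => hy1 hy2.
    have {}hy : y = X 0 by lia.
    have : forall t, L 0 0 <= t -> t <= 0 -> t < 0 -> eta t (X 0 + 1) = true.
      apply: real_induction.
      - by move=> _; have [_ _ _] := hs; rewrite hy.
      - move=> t h1 h2 /(_ h2) ht.
        have [he _] := ce (X 0 + 1) t; apply: filterS he => u -> _; exact: ht.
      - move=> t h1 h2 hQ t0.
        have lt : left_val (eta^~ (X 0 + 1)) t true.
          by apply: left_val_eq h1 _ => u u1 u2; apply: hQ => //; exact: lt_trans t0.
        apply/negP => /negP /negbTE ht.
        have [_ [b2 lb2]] := ce (X 0 + 1 + 1) t.
        have := exneg t t0 _ _ _ lt lb2; rewrite ht /= => /esym /andP [/negbTE b2f e2].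
        have sw : swap_at eta t (X 0 + 1) by split=> //; rewrite -?b2f.
        have lp : left_val (part 0) t (X 0 + 1).
          apply: left_val_eq h1 _ => u u1 u2.
          have := part_mono 0 _ _ u1.
          have := part_mono 0 _ _ (ltW (lt_trans u2 t0)); lia.
        have [_ /(_ _ _ lp) [/(_ sw) hpt _]] := partE 0.
        by have := part_mono 0 _ _ (ltW t0); lia.
    move=> he; have lt : left_val (eta^~ (X 0 + 1)) 0 true.
      by apply: left_val_eq hlt _ => u u1 u2; apply: he => //; exact: ltW.
    by have := left_val_inj left0 lt.
  by have := part_left_le 0 _ _ _ hlt hp; have := hole_left_le 0 _ _ _ hlt hh; move=> ? ?; exfalso; lia.
(* At time 0 particle 0 is still to the left of hole 1, and particle 1 to the left of hole 0, so
   both swaps lie ahead. *)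
have L10 : 0 < L 1 0.
  have [y [hs hp hh hp' hh']] := swapE 1 0; rewrite ltNge; apply/negP => hle.
  by have := part_mono 0 (L 1 0) 0 hle; have := hole_mono 1 (L 1 0) 0 hle; lia.
have L01 : 0 < L 0 1.
  have [y [hs hp hh hp' hh']] := swapE 0 1; rewrite ltNge; apply/negP => hle.
  by have := part_mono 1 (L 0 1) 0 hle; have := hole_mono 0 (L 0 1) 0 hle; lia.
(* As long as the pair has not moved, its hole and its particle keep the label 0. *)
have still s : (forall t, 0 <= t -> t <= s -> X t = X 0) ->
    (forall t, 0 <= t -> t <= s -> part 0 t = X 0 + 1) /\
    (forall t, 0 <= t -> t <= s -> hole 0 t = X 0).
  move=> hs; split.
    rewrite -p0; apply: cadlag_const => // t t0 ts lt.
    have [_ /(_ _ _ lt) [_ ->//]] := partE 0.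
    by rewrite p0 => -[_ _ h1 _]; move: (z1 t (ltW t0)); rewrite hs ?(ltW t0) // h1.
  rewrite -h0; apply: cadlag_const => // t t0 ts lt.
  have [_ /(_ _ _ lt) [_ ->//]] := holeE 0.
  rewrite h0 => -[_ _ _].
  by rewrite subrK -(hs t (ltW t0) ts) z0 // ltW.
rewrite hxi L00 subr0 ge_min !add0r; split; last first.
  move=> [u [u0 uh hu]].
  (* First time at which the pair has moved; right continuity makes it attained. *)
  have [tau [tau0 tauh hcst htau]] : exists tau, [/\ 0 < tau, tau <= h,
      forall t, 0 <= t -> t < tau -> X t = X 0 & X tau <> X 0].
    apply: contrapT => hno; apply: hu.
    apply: (@real_induction _ (fun t => X t = X 0) 0 h) => //.
      by move=> t t0 th <-; have [] := cX t.
    by move=> t t0 th ht; apply: contrapT => hne; apply: hno; exists t.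
  have lX : left_val X tau (X 0) by exact: left_val_eq tau0 hcst.
  have le0 : left_val (eta^~ (X 0)) tau false.
    by apply: left_val_eq tau0 _ => t t0 tt; rewrite -(hcst t) // z0.
  have le1 : left_val (eta^~ (X 0 + 1)) tau true.
    by apply: left_val_eq tau0 _ => t t0 tt; rewrite -(hcst t) // z1.
  have cst0 : left_val (part 0) tau (X 0 + 1) /\ left_val (hole 0) tau (X 0).
    split; apply: left_val_eq tau0 _ => t t0 tt;
      have [] := still t => [s s0 st|h1 h2]; rewrite ?h1 ?h2 //.
      by apply: hcst => //; apply: le_lt_trans tt.
    by apply: hcst => //; apply: le_lt_trans tt.
  have [cp ch] := cst0.
  have : X tau = X 0 + 1 \/ X tau = X 0 - 1.
    have := hX1 tau _ tau0 lX; lia.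
  case=> hXt; apply/orP.
    left; apply: le_trans tauh.
    have e1 : eta tau (X 0 + 1) = false by rewrite -hXt z0 ?ltW.
    have [_ [b2 lb2]] := ce (X 0 + 1 + 1) tau.
    have := expos tau tau0 _ _ _ le1 lb2; rewrite e1 /= => /esym /andP [/negbTE b2f e2].
    have sw : swap_at eta tau (X 0 + 1) by split=> //; rewrite -?b2f.
    have [_ /(_ _ _ cp) [/(_ sw) hpt _]] := partE 0.
    (* No label lies strictly between 0 and 1, so at time 0 all sites from [X 0 + 1] up to hole 1
       are occupied, and the hole met is hole 1. *)
    have hht : hole 1 tau = X 0 + 1.
      apply: (@first_hole_swap _ eta (hole 1) (X 0 + 1) 0 tau) => //.
      - by move=> t t0 _; exact: expos.
      - by move=> t k _ _; have [_] := holeE 1; apply.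
      - by apply/hch; exists 1.
      - move=> x x1 x2; apply: contrapT => /negP /negbTE /hch [a ha].
        have := @incr_int (hole^~ 0) hinc 0 a; rewrite h0 ha.
        have := @incr_int (hole^~ 0) hinc a 1; rewrite ha => /(_ x2).
        move=> a1 /(_ ltac:(lia)); lia.
      - by move=> t t0 tt; rewrite -(hcst t) // z1.
    (* A later [L 1 0] would need particle 0 to be to the left of hole 1 again, against
       monotonicity. *)
    rewrite leNgt; apply/negP => hlt.
    have [y [_ hp hh _ _]] := swapE 1 0.
    have := part_left_le 0 _ _ _ hlt hp; have := hole_left_le 1 _ _ _ hlt hh; lia.
  right; apply: le_trans tauh.
  have e1 : eta tau (X 0) = true.
    have -> : X 0 = X tau + 1 by lia.
    by rewrite z1 // ltW.
  have [_ [b1 lb1]] := ce (X 0 - 1) tau.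
  have := expos tau tau0 (X 0 - 1) _ _ lb1; rewrite subrK => /(_ _ le0).
  rewrite e1 /= => /andP [b1t /negbTE e2].
  have sw : swap_at eta tau (X 0 - 1). by split; rewrite ?subrK //; move: lb1; rewrite b1t.
  have [_ /(_ _ _ ch) [/(_ sw) hpt _]] := holeE 0.
  have hht : part 1 tau = X 0.
    apply: (@first_particle_swap _ eta (part 1) (X 0) 0 tau) => //.
    - by move=> t t0 _; exact: expos.
    - by move=> t k _ _; have [_] := partE 1; apply.
    - by apply/pch; exists 1.
    - move=> x x1 x2; case ex: (eta 0 x) => //; move/pch: ex => [a ha]; exfalso.
      have incN : {homo (fun b => - part b 0) : a b / a < b}.
        by move=> b b' bb; rewrite ltrN2; exact: pdec.
      have := @incr_int _ incN 0 a; rewrite p0 ha.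
      have := @incr_int _ incN a 1; rewrite ha ltrN2 => /(_ x1).
      move=> a1 /(_ ltac:(lia)); lia.
    - by move=> t t0 tt; rewrite -(hcst t) // z0.
  rewrite leNgt; apply/negP => hlt.
  have [y [_ hp hh _ _]] := swapE 0 1.
  have := part_left_le 1 _ _ _ hlt hp; have := hole_left_le 0 _ _ _ hlt hh; lia.
move=> hor; apply: contrapT => hno.
have {}hno t : 0 <= t -> t <= h -> X t = X 0.
  by move=> t0 th; apply: contrapT => hne; apply: hno; exists t.
have [hp hh] := still h hno.
case/orP: hor => Lh.
  have [y [_ lp _ hp' _]] := swapE 1 0.
  have : y = X 0 + 1.
    apply: left_val_inj lp _; apply: left_val_eq L10 _ => t t0 tt.
    by apply: hp => //; apply: le_trans (ltW tt) Lh.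
  by rewrite hp ?(ltW L10) // in hp'; lia.
have [y [_ _ lh _ hh']] := swapE 0 1.
have : y + 1 = X 0.
  apply: left_val_inj lh _; apply: left_val_eq L01 _ => t t0 tt.
  by apply: hh => //; apply: le_trans (ltW tt) Lh.
by rewrite hh ?(ltW L01) // in hh'; lia.
Qed.

End env.

(** * Pathwise dynamics *)

Section dyn.
Variable R : realType.

Lemma motion_cases (S : Type) (ok : S -> S -> bool) (r : int) (t0 : \bar R)
    (z : R -> int -> S) (X : R -> int) (n : int -> R -> int) (t : R) :
  motion ok r t0 z X n -> (t0 < t%:E)%E ->
  (forall x, cadlag (z^~ x)) -> cadlag X ->
  exists c k, [/\ forall x, left_val (z^~ x) t (c x), left_val X t k &
    (z t =1 c /\ X t = k) \/
    exists x, z t =1 update ok r c x /\ X t = k + frame_shift ok r c x].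
Proof.
move=> hm ht cz cX; have [_ [k lk]] := cX t.
have /choice [c hc] : forall x, exists v, left_val (z^~ x) t v.
  by move=> x; have [] := cz x t.
exists c, k; split=> //; have [h1 h2] := hm t c k ht hc lk.
have [[x hx]|hno] := pselect (exists x, rings (n x) t).
  by right; exists x; exact: h1.
by left; apply: h2 => x hx; apply: hno; exists x.
Qed.

Lemma frame_shift_le1 (S : Type) (ok : S -> S -> bool) (r : int) c x :
  `|frame_shift ok r c x| <= 1.
Proof. by rewrite /frame_shift; repeat case: ifP. Qed.

Lemma motion_displacement (S : Type) (ok : S -> S -> bool) (r : int)
    (t0 : \bar R) (z : R -> int -> S) (X : R -> int) (n : int -> R -> int) t k :
  motion ok r t0 z X n -> (t0 < t%:E)%E ->
  (forall x, cadlag (z^~ x)) -> cadlag X -> left_val X t k -> `|X t - k| <= 1.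
Proof.
move=> hm ht cz cX lk; have [c [k' [_ lk' h]]] := motion_cases hm ht cz cX.
rewrite (left_val_inj lk lk'); case: h => [[_ ->]|[x [_ ->]]].
  by rewrite subrr normr0.
by rewrite addrC addKr frame_shift_le1.
Qed.

Lemma swap_exchange (e0 e1 : int -> bool) p :
  e0 p -> ~~ e0 (p + 1) -> e1 =1 swap_sites e0 p ->
  forall y, (e0 y && ~~ e1 y) = (~~ e0 (y + 1) && e1 (y + 1)).
Proof.
move=> h1 h2 he y; rewrite !he /swap_sites.
case: (altP (y =P p)) => [->|yp].
  by rewrite ifF ?eqxx ?h1 ?h2 //; apply/negbTE/eqP; lia.
case: (altP (y =P p + 1)) => [->|yp1].
  rewrite ifF ?ifF ?(negbTE h2) /= ?andNb //; apply/negbTE/eqP; lia.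
case: (altP (y + 1 =P p)) => [->|yp2].
  by rewrite h1 andbN.
by rewrite ifF ?andbN ?andNb //; apply/negbTE/eqP; lia.
Qed.

Lemma exchange_ruleP (e : R -> int -> bool) t (e0 : int -> bool) :
  (forall y, left_val (e^~ y) t (e0 y)) ->
  (forall y, (e0 y && ~~ e t y) = (~~ e0 (y + 1) && e t (y + 1))) ->
  exchange_rule e t.
Proof.
move=> hl he y b1 b2 h1 h2.
by rewrite (left_val_inj h1 (hl y)) (left_val_inj h2 (hl (y + 1))).
Qed.

(** The frame shift inside [update] cancels against the change of [X]: on the fixed lattice every
    jump is a plain swap across the bond [x + k]. *)
Lemma pair_exchange_rule (t0 : \bar R) (z : R -> int -> bool) (X : R -> int)
    (n : int -> R -> int) (t : R) :
  motion ok_pair 1 t0 z X n -> (t0 < t%:E)%E ->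
  (forall x, cadlag (z^~ x)) -> cadlag X -> exchange_rule (uncentred z X) t.
Proof.
move=> hm ht cz cX; have [c [k [hc hk h]]] := motion_cases hm ht cz cX.
apply: (@exchange_ruleP _ _ (fun y => c (y - k))).
  by move=> y; exact: uncentred_left_val hk (hc _).
have triv : (forall y, uncentred z X t y = c (y - k)) -> forall y,
    (c (y - k) && ~~ uncentred z X t y) =
    (~~ c (y + 1 - k) && uncentred z X t (y + 1)).
  by move=> he y; rewrite !he andbN andNb.
case: h => [[hz hX]|[x [hz hX]]].
  by apply: triv => y; rewrite /uncentred hz hX.
case okx : (ok_pair (c x) (c (x + 1))); last first.
  by apply: triv => y; rewrite /uncentred hz hX /update /frame_shift okx addr0.
apply: (@swap_exchange (fun y => c (y - k)) _ (x + k)).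
- by rewrite addrK; case/andP: okx.
- have -> : x + k + 1 - k = x + 1 by lia.
  by case/andP: okx.
move=> y; rewrite /uncentred hz hX /update okx /swap_sites.
have -> : y - (k + frame_shift ok_pair 1 c x) + frame_shift ok_pair 1 c x = y - k.
  by lia.
have -> : (y - k == x) = (y == x + k) by lia.
have -> : (y - k == x + 1) = (y == x + k + 1) by lia.
by case: ifP => _; [|case: ifP => _]; congr (c _); lia.
Qed.

Lemma expand_left_val (z : R -> int -> option bool) t c x :
  (forall x, left_val (z^~ x) t (c x)) ->
  left_val (fun u => Defs.expand (z u) x) t (Defs.expand c x).
Proof.
move=> hc; rewrite /Defs.expand.
case: ifP => _; first by apply: filterS (hc x) => u ->.
case: ifP => _; first by apply: filterE.
case: ifP => _; first by apply: filterE.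
by apply: filterS (hc (x - 1)) => u ->.
Qed.

Lemma expand_cadlag (z : R -> int -> option bool) x :
  (forall x, cadlag (z^~ x)) -> cadlag (fun u => Defs.expand (z u) x).
Proof.
move=> cz; rewrite /Defs.expand.
have cc b : cadlag (fun _ : R => b : bool).
  by move=> t; split; [exact: filterE|exists b; exact: filterE].
have cv y := @cadlag_comp _ _ _ (fun v => v == Some true) _ (cz y).
by case: (ltP x 0) => _ //; case: (x =P 0) => _ //; case: (x =P 1) => _.
Qed.

(* On the expanded configuration a jump across bond [x] of the second-class
   particle picture is a swap across bond [x] ([x < 0]) or [x + 1] ([x >= 0]). *)
Lemma expand_update (c : int -> option bool) (k x : int) :
  (forall y, c y = None <-> y = 0) ->
  ok_star (c x) (c (x + 1)) ->
  let p := if x < 0 then x + k else x + k + 1 in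
  let e0 y := Defs.expand c (y - k) in
  [/\ e0 p, ~~ e0 (p + 1) &
    forall y, Defs.expand (update ok_star 0 c x) (y - (k + frame_shift ok_star 0 c x))
      = swap_sites e0 p y].
Proof.
move=> hc okx p e0.
have c0 : c 0 = None by apply/hc.
have cN y : y != 0 -> c y <> None by move=> /eqP h /hc.
have h1 : x <> 0 -> c x = Some true.
  by move=> /eqP /cN; move: okx; case: (c x) => [[]|].
have h2 : x <> -1 -> c (x + 1) = Some false.
  move=> x1; have /cN : x + 1 != 0 by lia.
  by move: okx; case: (c x) => [[]|]; case: (c (x + 1)) => [[]|].
have hx u : u = x -> x <> 0 -> (c u == Some true) = true.
  by move=> -> /h1 ->.
have hx1 u : u = x + 1 -> x <> -1 -> (c u == Some true) = false.
  by move=> -> /h2 ->.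
split; [| |move=> y; rewrite /update /frame_shift okx /swap_sites];
  rewrite /e0 /p /Defs.expand;
  case: (ltP x 0) => x_0; case: (x =P 0) => x0; case: (x =P -1) => x1;
  try (exfalso; lia); repeat match goal with
    |- context [if ?b then _ else _] =>
      lazymatch b with context [if _ then _ else _] => fail
      | _ => case: (boolP b) => ?; try (exfalso; lia) end end;
  first [done | congr (c _ == _); lia | rewrite hx //; lia
        | rewrite hx1 //; lia | symmetry; rewrite hx //; lia
        | symmetry; rewrite hx1 //; lia].
Qed.

(** Before time 0 only the process with a second-class particle comes with clocks, so the rule for
    the past is proved for the expanded star dynamics. *)
Lemma star_exchange_rule (z : R -> int -> option bool) (X : R -> int)
    (n : int -> R -> int) (t : R) :
  motion ok_star 0 -oo%E z X n ->
  (forall u x, z u x = None <-> x = 0) ->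
  (forall x, cadlag (z^~ x)) -> cadlag X ->
  exchange_rule (uncentred (fun u => Defs.expand (z u)) X) t.
Proof.
move=> hm hz0 cz cX; have [c [k [hc hk h]]] := motion_cases hm (ltNyr t) cz cX.
have hc0 y : c y = None <-> y = 0.
  have t1 : t - 1 < t by rewrite gtrBl.
  have [u [_ _ <-]] := left_exists (hc y) t1.
  exact: hz0.
apply: (@exchange_ruleP _ _ (fun y => Defs.expand c (y - k))).
  move=> y; apply: (@uncentred_left_val _ (fun u => Defs.expand (z u)) X t k) => //.
  exact: expand_left_val.
have ex c1 c2 x : c1 =1 c2 -> Defs.expand c1 x = Defs.expand c2 x.
  by move=> h12; rewrite /Defs.expand !h12.
have triv : (forall y, uncentred (fun u => Defs.expand (z u)) X t y = Defs.expand c (y - k)) -> forall y,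
    (Defs.expand c (y - k) && ~~ uncentred (fun u => Defs.expand (z u)) X t y) =
    (~~ Defs.expand c (y + 1 - k) && uncentred (fun u => Defs.expand (z u)) X t (y + 1)).
  by move=> he y; rewrite !he andbN andNb.
case: h => [[hz hX]|[x [hz hX]]].
  by apply: triv => y; rewrite /uncentred hX; exact: ex.
case okx : (ok_star (c x) (c (x + 1))); last first.
  apply: triv => y; rewrite /uncentred hX /frame_shift okx addr0; apply: ex.
  by move=> u; rewrite hz /update okx.
have [h1 h2 h3] := expand_update k hc0 okx.
apply: (@swap_exchange (fun y => Defs.expand c (y - k)) _ _ h1 h2) => y; rewrite /uncentred (ex _ _ _ hz) hX.
exact: h3.
Qed.

(** Only bonds -1, 0 and 1 touch the pair. Bond 0 carries (hole, particle) and is blocked; a swap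
    across one of the other two is compensated by the frame shift. *)
Lemma pair_kept (t0 : R) (z : R -> int -> bool) (X : R -> int)
    (n : int -> R -> int) :
  motion ok_pair 1 t0%:E z X n -> (forall x, cadlag (z^~ x)) -> cadlag X ->
  z t0 0 = false -> z t0 1 = true ->
  forall t, t0 <= t -> z t 0 = false /\ z t 1 = true.
Proof.
move=> hm cz cX h0 h1 t tt.
apply: (@real_induction _ (fun u => z u 0 = false /\ z u 1 = true) t0 t) => //.
  move=> u u0 _ [<- <-].
  have [hz0 _] := cz 0 u; have [hz1 _] := cz 1 u.
  by apply: filterS2 hz0 hz1 => v -> ->.
move=> u u0 _ hu.
have u0E : (t0%:E < u%:E)%E by rewrite lte_fin.
have [c [k [hc hk h]]] := motion_cases hm u0E cz cX.
have c0 : c 0 = false.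
  by apply: left_val_inj (hc 0) _; apply: left_val_eq u0 _ => v v0 v1; case: (hu v v0 v1).
have c1 : c 1 = true.
  by apply: left_val_inj (hc 1) _; apply: left_val_eq u0 _ => v v0 v1; case: (hu v v0 v1).
case: h => [[hz _]|[x [hz _]]]; first by rewrite !hz.
rewrite !hz /update /frame_shift.
case okx : (ok_pair (c x) (c (x + 1))) => //.
have /andP [cx cx1] := okx; rewrite /swap_sites.
case: (x =P 1) => [x1|xn1].
  by subst x; rewrite /= c1; split=> //; apply/negbTE.
case: (x =P -1) => [x1|xn2]; first by subst x; rewrite /= c0.
have xn0 : x <> 0 by move=> x0; rewrite x0 c0 in cx.
by rewrite !ifF //; lia.
Qed.

End dyn.

(** * Queues in front of the pair *)

Section queues.
Variable R : realType.

(* [i] particles separate the pair from the first hole on its right, and [j]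
   holes separate it from the first particle on its left. *)
Definition queues (c : int -> bool) (i j : nat) : Prop :=
  [/\ forall x : int, 1 <= x -> x < i%:Z + 2 -> c x = true, c (i%:Z + 2) = false,
      forall x : int, - j%:Z <= x -> x <= 0 -> c x = false &
      c (- j%:Z - 1) = true].

(** The bond between the last particle before the first hole on the right, at site [i + 1] (the
    pair's own particle if [i = 0]), and that hole, at site [i + 2]. *)
Definition right_bond (i : nat) : int := i%:Z + 1.
Definition left_bond (j : nat) : int := - j%:Z - 1.

Lemma queues_ext c c' i j : c =1 c' -> queues c i j -> queues c' i j.
Proof.
by move=> h [h1 h2 h3 h4]; split; rewrite -?h // => x; rewrite -h; [apply: h1|apply: h3].
Qed.

(** In the window from [- j - 1] to [i + 2] the pattern (particle, hole) occurs only at the two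
    active bonds. The end sites block the bonds leaving the window: the hole at [i + 2] has nothing
    to send right, the particle at [- j - 1] leaves no room for an arrival. Any other swap is thus
    outside the window and away from the bonds that shift the frame. *)
Lemma queues_inactive c i j x : queues c i j ->
  x <> right_bond i -> x <> left_bond j ->
  queues (update ok_pair 1 c x) i j /\ frame_shift ok_pair 1 c x = 0.
Proof.
rewrite /right_bond /left_bond => -[h1 h2 h3 h4] xr xl.
case okx : (ok_pair (c x) (c (x + 1))); last first.
  rewrite /frame_shift okx; split=> //; apply: queues_ext (And4 h1 h2 h3 h4).
  by move=> y; rewrite /update okx.
have /andP [cx cx1] := okx.
have hx : x < - j%:Z - 2 \/ i%:Z + 2 < x.
  case: (ltP x (- j%:Z - 2)) => [|xj]; first by left.
  case: (ltP (i%:Z + 2) x) => [|xi]; first by right.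
  case: (x =P i%:Z + 2) => [e|e]; first by move: cx; rewrite e h2.
  case: (leP 1 x) => [x1|x1].
    by move: cx1; rewrite h1 //; lia.
  case: (leP (- j%:Z) x) => [x2|x2].
    by move: cx; rewrite h3 //; lia.
  have e' : x + 1 = - j%:Z - 1 by lia.
  by move: cx1; rewrite e' h4.
have fs : frame_shift ok_pair 1 c x = 0.
  by rewrite /frame_shift okx ifF ?ifF //; lia.
have ue y : - j%:Z - 1 <= y -> y <= i%:Z + 2 -> update ok_pair 1 c x y = c y.
  by move=> y1 y2; rewrite /update okx fs addr0 /swap_sites !ifF //; lia.
split=> //; split.
- by move=> y y1 y2; rewrite ue ?h1 //; lia.
- by rewrite ue //; lia.
- by move=> y y1 y2; rewrite ue ?h3 //; lia.
- by rewrite ue //; lia.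
Qed.

Lemma queues_right c i j : queues c i j ->
  ok_pair (c (right_bond i)) (c (right_bond i + 1)).
Proof.
rewrite /right_bond => -[h1 h2 _ _]; rewrite h1; try lia.
have -> : i%:Z + 1 + 1 = i%:Z + 2 by lia.
by rewrite h2.
Qed.

Lemma queues_left c i j : queues c i j ->
  ok_pair (c (left_bond j)) (c (left_bond j + 1)).
Proof. by rewrite /left_bond => -[_ _ h3 h4]; rewrite h4 subrK h3 //; lia. Qed.

(** With an empty queue the hole is adjacent to the pair, and the ring moves the pair instead of
    shortening the queue. *)
Lemma queues_right_shift c i j : queues c i j ->
  frame_shift ok_pair 1 c (right_bond i) = (i == 0%N)%:Z.
Proof.
move=> hc; rewrite /frame_shift ifT ?(queues_right hc) // /right_bond.
case: i {hc} => [|i]; first by [].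
by rewrite ifF ?ifF //; lia.
Qed.

Lemma queues_left_shift c i j : queues c i j ->
  frame_shift ok_pair 1 c (left_bond j) = - (j == 0%N)%:Z.
Proof.
move=> hc; rewrite /frame_shift ifT ?(queues_left hc) // /left_bond.
rewrite ifF; last by lia.
case: j {hc} => [|j]; first by [].
by have -> : (- j.+1%:Z - 1 == -1) = false by lia.

Qed.

Lemma queues_right_step c i j : queues c i.+1 j ->
  queues (update ok_pair 1 c (right_bond i.+1)) i j.
Proof.
move=> hc; have okx := queues_right hc; have := queues_right_shift hc.
rewrite /= => fs; have [h1 h2 h3 h4] := hc.
have ue y : y <> i%:Z + 2 -> y <> i%:Z + 3 ->
    update ok_pair 1 c (right_bond i.+1) y = c y.
  move=> y1 y2; rewrite /update okx fs addr0 /swap_sites /right_bond !ifF //; lia.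
split.
- by move=> y y1 y2; rewrite ue ?h1 //; lia.
- rewrite /update okx fs addr0 /swap_sites ifT; last by rewrite /right_bond; lia.
  by rewrite -h2; congr (c _); rewrite /right_bond; lia.
- by move=> y y1 y2; rewrite ue ?h3 //; lia.
- by rewrite ue ?h4 //; lia.
Qed.

Lemma queues_left_step c i j : queues c i j.+1 ->
  queues (update ok_pair 1 c (left_bond j.+1)) i j.
Proof.
move=> hc; have okx := queues_left hc; have := queues_left_shift hc.
rewrite /= => fs; have [h1 h2 h3 h4] := hc.
have ue y : y <> - j%:Z - 1 -> y <> - j%:Z - 2 ->
    update ok_pair 1 c (left_bond j.+1) y = c y.
  move=> y1 y2; rewrite /update okx fs oppr0 addr0 /swap_sites /left_bond !ifF //; lia.
split.
- by move=> y y1 y2; rewrite ue ?h1 //; lia.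
- by rewrite ue ?h2 //; lia.
- by move=> y y1 y2; rewrite ue ?h3 //; lia.
- rewrite /update okx fs oppr0 addr0 /swap_sites ifF; last by rewrite /left_bond; lia.
  rewrite ifT; last by rewrite /left_bond; lia.
  by rewrite -h4; congr (c _); rewrite /left_bond; lia.
Qed.

(** At most one ring in total among the clocks [xs]. This fails with probability quadratic in
    [t - s], so the failures along a fine mesh are negligible. *)
Definition single_increment (n : int -> R -> int) (s t : R) (xs : seq int) : Prop :=
  (forall x, x \in xs -> n x t = n x s) \/
  exists b, [/\ b \in xs, n b t = n b s + 1 &
    forall x, x \in xs -> x <> b -> n x t = n x s].

(** All bonds that can be active before the pair moves, including the two whose ring moves it. *)
Definition relevant_bonds (kr kl : nat) : seq int :=
  map right_bond (iota 0 kr.+1) ++ map left_bond (iota 0 kl.+1).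

(* Number of rings up to the [l]-th mesh point, where on each mesh interval only
   the bond selected by the count so far is observed. *)
Fixpoint ring_count (n : int -> R -> int) (tm : nat -> R) (bond : nat -> int)
    (l : nat) : nat :=
  if l is l'.+1 then
    let c := ring_count n tm bond l' in
    (c + `|n (bond c) (tm l'.+1) - n (bond c) (tm l')|)%N
  else 0%N.

Section paths.
Variables (z : R -> int -> bool) (X : R -> int) (n : int -> R -> int) (t0 : R).
Hypothesis hm : motion ok_pair 1 t0%:E z X n.
Hypothesis cz : forall x, cadlag (z^~ x).
Hypothesis cX : cadlag X.
Hypothesis mn : forall x, {homo n x : u v / u <= v}.
Hypothesis cn : forall x, cadlag (n x).

Lemma queues_left_val (t : R) c i j :
  (forall x, left_val (z^~ x) t (c x)) ->
  (\forall u \near t^'-, queues (z u) i j) -> queues c i j.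
Proof.
move=> hc hq.
have hn : \forall u \near t^'-, queues (z u) i j /\
    (forall x, - j%:Z - 1 <= x -> x < i%:Z + 3 -> z u x = c x).
  have hr : \forall u \near t^'-,
      forall x, - j%:Z - 1 <= x -> x < i%:Z + 3 -> z u x = c x.
    by apply: near_int_range => x; exact: hc.
  by apply: filterS2 hq hr => u; split.
have t1 : t - 1 < t by rewrite gtrBl.
have [u [_ _ [[h1 h2 h3 h4] hu]]] := left_exists hn t1.
split.
- by move=> x x1 x2; rewrite -hu ?h1 //; lia.
- by rewrite -hu ?h2 //; lia.
- by move=> x x1 x2; rewrite -hu ?h3 //; lia.
- by rewrite -hu ?h4 //; lia.
Qed.

Lemma queues_right_cont t i j : queues (z t) i j ->
  \forall u \near t^'+, queues (z u) i j.
Proof.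
move=> [h1 h2 h3 h4].
have hn : \forall u \near t^'+,
    (forall x, - j%:Z - 1 <= x -> x < i%:Z + 3 -> z u x = z t x).
  by apply: near_int_range => x; have [] := cz x t.
apply: filterS hn => u hu; split.
- by move=> x x1 x2; rewrite hu ?h1 //; lia.
- by rewrite hu ?h2 //; lia.
- by move=> x x1 x2; rewrite hu ?h3 //; lia.
- by rewrite hu ?h4 //; lia.
Qed.

Lemma rings_incr b s t : s < t -> rings (n b) t -> n b s < n b t.
Proof.
move=> st hr; rewrite lt_neqAle mn ?(ltW st) // andbT; apply/eqP => e; apply: hr.
apply: left_val_eq st _ => u su ut.
by apply/eqP; rewrite eq_le mn ?(ltW ut) //= -e mn.
Qed.

Lemma motion_queues t c i j k : t0 < t ->
  (forall x, left_val (z^~ x) t (c x)) -> left_val X t k -> queues c i j ->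
  ~ rings (n (right_bond i)) t -> ~ rings (n (left_bond j)) t ->
  queues (z t) i j /\ X t = k.
Proof.
move=> tt hc hk hq nr nl.
have [h1 h2] := hm (tt : (t0%:E < t%:E)%E) hc hk.
have [[x hx]|hno] := pselect (exists x, rings (n x) t).
  have [hz ->] := h1 x hx.
  have xr : x <> right_bond i by move=> e; rewrite e in hx.
  have xl : x <> left_bond j by move=> e; rewrite e in hx.
  have [hq' ->] := queues_inactive hq xr xl.
  by rewrite addr0; split=> //; apply: queues_ext hq' => y; rewrite hz.
have [x hx|hz ->] := h2; first by apply: hno; exists x.
by split=> //; apply: queues_ext hq => y; rewrite hz.
Qed.

Lemma queues_persist s t i j : t0 <= s -> s <= t -> queues (z s) i j ->
  n (right_bond i) t = n (right_bond i) s ->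
  n (left_bond j) t = n (left_bond j) s ->
  forall u, s <= u -> u <= t -> queues (z u) i j /\ X u = X s.
Proof.
move=> t0s st hq hr hl.
apply: (@real_induction _ (fun u => queues (z u) i j /\ X u = X s)) => //.
  move=> u su ut [hu <-]; have [hX _] := cX u.
  by apply: filterS2 (queues_right_cont hu) hX => v.
move=> u su ut hu.
have u0 : t0 < u by exact: le_lt_trans su.
have [c [k [hc hk _]]] := motion_cases hm (u0 : (t0%:E < u%:E)%E) cz cX.
have hn : \forall v \near u^'-, queues (z v) i j /\ X v = X s.
  by apply/near_leftP; exists s => // v /ltW; exact: hu.
have <- : k = X s.
  by apply: left_val_inj hk _; apply: filterS hn => v [].
apply: (motion_queues u0 hc hk).
- by apply: queues_left_val hc _; apply: filterS hn => v [].
- move=> /(rings_incr su); rewrite -hr => /lt_le_trans /(_ (mn _ ut)); by rewrite ltxx.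
- move=> /(rings_incr su); rewrite -hl => /lt_le_trans /(_ (mn _ ut)); by rewrite ltxx.
Qed.

(** Locates the ring of [b] in [(s, t]]: up to it the queues persist, and at it the configuration is
    updated across [b]. The two active bonds may come in either order, so that both sides are
    treated at once. *)
Lemma single_ring s t i j b b' :
  (b = right_bond i /\ b' = left_bond j) \/ (b = left_bond j /\ b' = right_bond i) ->
  t0 <= s -> s <= t -> queues (z s) i j -> n b t = n b s + 1 -> n b' t = n b' s ->
  exists tau c, [/\ s < tau, tau <= t, n b tau = n b t, queues c i j &
    [/\ z tau =1 update ok_pair 1 c b, X tau = X s + frame_shift ok_pair 1 c b &
    forall u, s <= u -> u < tau -> X u = X s]].
Proof.
move=> hb t0s st hq hbt hb't.
have [tau [stau taut lb ntau]] : exists tau, [/\ s < tau, tau <= t,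
    left_val (n b) tau (n b s) & n b tau <> n b s].
  apply: contrapT => hno.
  have : n b t = n b s.
    apply: (cadlag_const (cn b) (a := s) (b := t)) => // u su ut lu.
    by apply: contrapT => ne; apply: hno; exists u.
  by rewrite hbt; lia.
have nbt : n b tau = n b t.
  have := mn b (ltW stau); have := mn b taut; lia.
have nbu u : s <= u -> u < tau -> n b u = n b s.
  move=> su ut; have [v [v1 v2 v3]] := left_exists lb ut.
  have := mn b su; have := mn b (ltW v1); rewrite v3; lia.
have nb'u u : s <= u -> u <= tau -> n b' u = n b' s.
  move=> su ut; have := mn b' su; have := mn b' (le_trans ut taut); lia.
have hpers u : s <= u -> u < tau -> queues (z u) i j /\ X u = X s.
  move=> su ut; apply: (@queues_persist s u) => //.
  - by case: hb => -[e e']; [rewrite -e nbu|rewrite -e' nb'u // ltW].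
  - by case: hb => -[e e']; [rewrite -e' nb'u // ltW|rewrite -e nbu].
have tau0 : t0 < tau by exact: le_lt_trans stau.
have [c [k [hc hk _]]] := motion_cases hm (tau0 : (t0%:E < tau%:E)%E) cz cX.
have hn : \forall v \near tau^'-, queues (z v) i j /\ X v = X s.
  by apply/near_leftP; exists s => // v /ltW; exact: hpers.
have ek : k = X s.
  by apply: left_val_inj hk _; apply: filterS hn => v [].
have [h1 _] := hm (tau0 : (t0%:E < tau%:E)%E) hc hk.
have rb : rings (n b) tau by move=> /(left_val_inj lb) e; apply: ntau; rewrite -e.
have [hz hX] := h1 b rb.
exists tau, c; split=> //.
  by apply: queues_left_val hc _; apply: filterS hn => v [].
split=> //; first by rewrite hX ek.
by move=> u su ut; have [] := hpers u su ut.
Qed.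

(** Only the clocks of the two bonds active at time [s] are read. A ring activates the next bond
    within the interval, and a ring of that one would be missed; the single increment over [xs],
    which contains all later bonds, excludes this. *)
Lemma queues_single_step s t i j (xs : seq int) :
  t0 <= s -> s <= t -> queues (z s) i j ->
  right_bond i \in xs -> left_bond j \in xs ->
  (forall i', (i' <= i)%N -> right_bond i' \in xs) ->
  (forall j', (j' <= j)%N -> left_bond j' \in xs) ->
  single_increment n s t xs ->
  let a := `|n (right_bond i) t - n (right_bond i) s|%N in
  let b := `|n (left_bond j) t - n (left_bond j) s|%N in
  if (a <= i)%N && (b <= j)%N
  then queues (z t) (i - a) (j - b) /\ forall u, s <= u -> u <= t -> X u = X s
  else exists u, [/\ s <= u, u <= t & X u <> X s].
Proof.
move=> t0s st hq hi hj hi' hj'.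
have stay : n (right_bond i) t = n (right_bond i) s ->
    n (left_bond j) t = n (left_bond j) s ->
    queues (z t) i j /\ forall u, s <= u -> u <= t -> X u = X s.
  move=> h1 h2; have hp := queues_persist t0s st hq h1 h2.
  split; first by have [] := hp t st (lexx _).
  by move=> u su ut; have [] := hp u su ut.
have rl i' j' : right_bond i' <> left_bond j' by rewrite /right_bond /left_bond; lia.
case=> [h|[b [hb nb hx]]] /=.
  by rewrite !h // !subrr absz0 !subn0 /=; apply: stay; exact: h.
have fin tau i' j' : s < tau -> tau <= t -> queues (z tau) i' j' -> X tau = X s ->
    (forall u, s <= u -> u < tau -> X u = X s) ->
    n (right_bond i') t = n (right_bond i') tau ->
    n (left_bond j') t = n (left_bond j') tau ->
    queues (z t) i' j' /\ forall u, s <= u -> u <= t -> X u = X s.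
  move=> h1 h2 hq' hX hu e1 e2.
  have hp := queues_persist (le_trans t0s (ltW h1)) h2 hq' e1 e2.
  split; first by have [] := hp t h2 (lexx _).
  move=> u su ut; case: (ltP u tau) => uu; first exact: hu.
  by have [_ ->] := hp u uu ut.
have cst x tau : x \in xs -> x <> b -> s < tau -> tau <= t -> n x t = n x tau.
  move=> hxs hxb h1 h2; have := hx x hxs hxb.
  have := mn x (ltW h1); have := mn x h2; lia.
case: (b =P right_bond i) => [br|br].
  have lb : n (left_bond j) t = n (left_bond j) s.
    by apply: hx => // e; apply: (rl i j); rewrite e.
  have [tau [c [h1 h2 h3 hc [hz hX hu]]]] :=
    single_ring (or_introl (conj br erefl)) t0s st hq nb lb.
  rewrite -br nb lb subrr subn0 addrC addKr /= andbT.
  case: i hq hi hi' br stay hc => [|i] hq hi hi' br stay hc /=.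
    exists tau; split=> //; first exact: ltW.
    by rewrite hX br (queues_right_shift hc); lia.
  rewrite subn1 /=; apply: (fin tau) => //.
  - rewrite br in hz; apply: queues_ext (queues_right_step hc) => y; by rewrite hz.
  - by rewrite hX br (queues_right_shift hc) addr0.
  (* The newly active bond differs from [b], which has used up the single ring. *)
  - apply: cst => //; first by apply: hi'.
    by rewrite br /right_bond; lia.
  - apply: cst => //; by rewrite br => e; apply: (rl i.+1 j).
have rb : n (right_bond i) t = n (right_bond i) s by apply: hx => // e; apply: br.
case: (b =P left_bond j) => [bl|bl]; last first.
  have lb : n (left_bond j) t = n (left_bond j) s by apply: hx => // e; apply: bl.
  by rewrite rb lb !subrr absz0 !subn0 /=; exact: stay.
have [tau [c [h1 h2 h3 hc [hz hX hu]]]] :=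
  single_ring (or_intror (conj bl erefl)) t0s st hq nb rb.
rewrite -bl nb rb subrr subn0 addrC addKr /=.
case: j hq hj hj' bl stay hc rl => [|j] hq hj hj' bl stay hc rl /=.
  exists tau; split=> //; first exact: ltW.
  by rewrite hX bl (queues_left_shift hc); lia.
rewrite subn1 /=; apply: (fin tau) => //.
- rewrite bl in hz; apply: queues_ext (queues_left_step hc) => y; by rewrite hz.
- by rewrite hX bl (queues_left_shift hc) addr0.
- apply: cst => //; by rewrite bl => e; apply: (rl i j.+1).
- apply: cst => //; first by apply: hj'.
  by rewrite bl /left_bond; lia.
Qed.

(** The subtraction in [kr - c] is truncated: once the queue is exhausted the clock of
    [right_bond 0] keeps being read. The count thereby stays Poisson, and since counts never
    decrease the test [a <= kr] is not affected. *)
Lemma queues_count (tm : nat -> R) (kr kl m : nat) :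
  t0 = tm 0%N -> {homo tm : a b / (a <= b)%N >-> a <= b} ->
  queues (z (tm 0%N)) kr kl ->
  (forall l, (l < m)%N ->
     single_increment n (tm l) (tm l.+1) (relevant_bonds kr kl)) ->
  let a := ring_count n tm (fun c => right_bond (kr - c)) m in
  let b := ring_count n tm (fun c => left_bond (kl - c)) m in
  if (a <= kr)%N && (b <= kl)%N
  then queues (z (tm m)) (kr - a) (kl - b) /\
       forall u, tm 0%N <= u -> u <= tm m -> X u = X (tm 0%N)
  else exists u, [/\ tm 0%N <= u, u <= tm m & X u <> X (tm 0%N)].
Proof.
move=> t00 tmn hq; elim: m => [|m IH] hs /=.
  rewrite !subn0; split=> // u h1 h2; congr X; apply/eqP.
  by rewrite eq_le h1 h2.
have {}IH := IH (fun l hl => hs l (ltnW hl)); move: IH => /=.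
set a := ring_count _ _ _ _; set b := ring_count _ _ _ _.
have tmm : tm m <= tm m.+1 by exact: tmn.
have t0m : tm 0%N <= tm m by exact: tmn.
case: ifP => [/andP [akr bkl] [hq' hX]|hf [u [u1 u2 u3]]]; last first.
  rewrite ifF; last first.
    by apply: contraFF hf => /andP [h1 h2]; rewrite !(leq_trans _ h1, leq_trans _ h2) ?leq_addr.
  by exists u; split=> //; exact: le_trans tmm.
have memr i : (i <= kr)%N -> right_bond i \in relevant_bonds kr kl.
  by move=> h; rewrite mem_cat map_f // mem_iota.
have meml j : (j <= kl)%N -> left_bond j \in relevant_bonds kr kl.
  by move=> h; rewrite mem_cat orbC map_f // mem_iota.
have := queues_single_step (i := kr - a) (j := kl - b)
  (xs := relevant_bonds kr kl) _ tmm hq' _ _ _ _ (hs m (ltnSn m)).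
rewrite t00 => /(_ t0m); rewrite !memr ?meml ?leq_subr // => /(_ isT isT).
move=> /(_ (fun i hi => memr i (leq_trans hi (leq_subr _ _)))).
move=> /(_ (fun i hi => meml i (leq_trans hi (leq_subr _ _)))).
rewrite /=; set a' := `|_|%N; set b' := `|_|%N.
have -> : (a' <= kr - a)%N && (b' <= kl - b)%N = (a + a' <= kr)%N && (b + b' <= kl)%N.
  by lia.
case: ifP => _.
  rewrite !subnDA => -[h1 h2]; split=> // u u0 u1.
  case: (leP u (tm m)) => hu; first exact: hX.
  by rewrite h2 ?(ltW hu) // hX.
move=> [u [u1 u2 u3]]; exists u; split=> //; first exact: le_trans u1.
by rewrite -(hX (tm m)).
Qed.

End paths.
End queues.

(** * Probabilities as real numbers *)

Section real_probability.
Context {R : realType} {d : measure_display} {T : measurableType d}.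
Variable P : probability T R.

Definition pr (A : set T) : R := fine (P A).

Lemma prE A : measurable A -> P A = (pr A)%:E.
Proof. by move=> mA; rewrite /pr fineK // fin_num_measure. Qed.

Lemma pr_ge0 A : 0 <= pr A.
Proof. exact: fine_ge0. Qed.

Lemma pr0 : pr set0 = 0.
Proof. by rewrite /pr measure0. Qed.

Lemma prT : pr setT = 1.
Proof. by rewrite /pr probability_setT. Qed.

Lemma pr_le A B : measurable A -> measurable B -> A `<=` B -> pr A <= pr B.
Proof.
move=> mA mB AB; rewrite -lee_fin -!prE //.
by apply: le_measure; rewrite ?inE.
Qed.

Lemma prU A B : measurable A -> measurable B -> (forall w, A w -> ~ B w) ->
  pr (A `|` B) = pr A + pr B.
Proof.
move=> mA mB AB; apply: EFin_inj; rewrite EFinD -!prE //; last exact: measurableU.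
rewrite measureU //; apply/seteqP; split=> // w [h1 h2].
exact: AB h1 h2.
Qed.

Lemma pr_split A B : measurable A -> measurable B ->
  pr A = pr (A `&` B) + pr (A `&` ~` B).
Proof.
move=> mA mB; rewrite -prU.
- by congr pr; apply/seteqP; split=> w; [case: (pselect (B w)); [left|right]|case=> -[]].
- exact: measurableI.
- by apply: measurableI => //; exact: measurableC.
- by move=> w [_ h1] [_ h2].
Qed.

Lemma prC A : measurable A -> pr (~` A) = 1 - pr A.
Proof.
move=> mA; rewrite -prT (pr_split measurableT mA) !setTI; ring.
Qed.

Lemma prU_le A B : measurable A -> measurable B -> pr (A `|` B) <= pr A + pr B.
Proof.
move=> mA mB; have mAB := measurableU _ _ mA mB.
rewrite (pr_split mAB mA) lerD //.
  by apply: pr_le => //; exact: measurableI.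
apply: pr_le => //; last by move=> w [[]].
by apply: measurableI => //; exact: measurableC.
Qed.

Lemma pr_ae0 (Q : T -> Prop) A : {ae P, forall w, Q w} -> measurable A ->
  A `<=` [set w | ~ Q w] -> pr A = 0.
Proof.
move=> [B [mB PB hB]] mA AQ; apply/eqP; rewrite eq_le pr_ge0 andbT.
have <- : pr B = 0 by rewrite /pr PB.
by apply: pr_le => // w /AQ; exact: hB.
Qed.

Lemma pr_ae_eq A B : measurable A -> measurable B ->
  {ae P, forall w, A w <-> B w} -> pr A = pr B.
Proof.
move=> mA mB hAB.
rewrite (pr_split mA mB) (pr_split mB mA) setIC.
rewrite [X in _ + X](pr_ae0 hAB) ?[X in _ = _ + X](pr_ae0 hAB) //.
- by apply: measurableI => //; exact: measurableC.
- by move=> w [h1 h2] [_ /(_ h1)].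
- by apply: measurableI => //; exact: measurableC.
- by move=> w [h1 h2] [/(_ h1)].
Qed.

Lemma pr_ae1 (Q : T -> Prop) : {ae P, forall w, Q w} -> measurable [set w | Q w] ->
  pr [set w | Q w] = 1.
Proof.
move=> hQ mQ; rewrite -prT; apply: pr_ae_eq => //.
by apply: filterS hQ => w.
Qed.

Lemma ae_pr1 A : measurable A -> pr A = 1 -> {ae P, forall w, A w}.
Proof.
move=> mA h; exists (~` A); split=> //; first exact: measurableC.
by rewrite prE ?prC ?h ?subrr //; exact: measurableC.
Qed.

Lemma ae_pr0 A : measurable A -> pr A = 0 -> {ae P, forall w, ~ A w}.
Proof.
move=> mA h; exists A; split=> //; first by rewrite prE ?h.
by move=> w /= /contrapT.
Qed.

Lemma pr_bigU (I : choiceType) (s : seq I) (F : I -> set T) :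
  uniq s -> (forall i, measurable (F i)) ->
  (forall i j w, i \in s -> j \in s -> F i w -> F j w -> i = j) ->
  pr (\big[setU/set0]_(i <- s) F i) = \sum_(i <- s) pr (F i).
Proof.
move=> us mF; elim: s us => [_ _|i s IH /= /andP [is_ us] dF].
  by rewrite !big_nil pr0.
rewrite !big_cons prU ?IH //.
- by move=> j k w js ks; apply: dF; rewrite inE ?js ?ks orbT.
- exact: bigsetU_measurable.
move=> w Fi; rewrite -bigcup_seq => -[j /= js Fj].
have ij : i = j by apply: dF Fi Fj; rewrite inE ?eqxx ?js ?orbT.
by rewrite ij js in is_.
Qed.

Lemma pr_bigU_le (I : choiceType) (s : seq I) (F : I -> set T) :
  (forall i, measurable (F i)) ->
  pr (\big[setU/set0]_(i <- s) F i) <= \sum_(i <- s) pr (F i).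
Proof.
move=> mF; elim: s => [|i s IH]; first by rewrite !big_nil pr0.
rewrite !big_cons; apply: le_trans (prU_le _ _) _ => //.
  exact: bigsetU_measurable.
by rewrite lerD2l.
Qed.

Lemma pr_cvg_bigcup (F : (set T)^nat) : (forall n, measurable (F n)) ->
  (forall n m, (n <= m)%N -> F n `<=` F m) ->
  pr (F n) @[n --> \oo] --> pr (\bigcup_n F n).
Proof.
move=> mF ndF; have mU : measurable (\bigcup_n F n) by exact: bigcup_measurable.
have h : (P \o F) n @[n --> \oo] --> (pr (\bigcup_n F n))%:E.
  rewrite -prE //; apply: nondecreasing_cvg_mu => // n m nm.
  by apply/subsetPset; exact: ndF.
exact: fine_cvg h.
Qed.

(** Continuity from below gives the lower bound for [A] and, applied to the complements, the upper
    bound. *)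
Lemma pr_cvg (A_ : (set T)^nat) (A : set T) :
  (forall n, measurable (A_ n)) -> measurable A ->
  (forall w, A w -> \forall n \near \oo, A_ n w) ->
  (forall w, ~ A w -> \forall n \near \oo, ~ A_ n w) ->
  pr (A_ n) @[n --> \oo] --> pr A.
Proof.
move=> mA_ mA h1 h2.
have low (B_ : (set T)^nat) B : (forall n, measurable (B_ n)) -> measurable B ->
    (forall w, B w -> \forall n \near \oo, B_ n w) ->
    forall e, 0 < e -> \forall n \near \oo, pr B - e < pr (B_ n).
  move=> mB_ mB h e e0.
  pose F n := B `&` \bigcap_(m in [set m | (n <= m)%N]) B_ m.
  have mF n : measurable (F n) by apply: measurableI => //; exact: bigcap_measurableType.
  have : pr (F n) @[n --> \oo] --> pr (\bigcup_n F n).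
    apply: pr_cvg_bigcup => // n m nm w [Bw hw]; split=> // k /= mk.
    by apply: hw => /=; exact: leq_trans mk.
  have -> : \bigcup_n F n = B.
    apply/seteqP; split=> [w [n _ []]//|w Bw].
    by have [N _ hN] := h w Bw; exists N => //; split=> // k; exact: hN.
  move=> /cvgrPdist_lt /(_ e e0); apply: filterS => n.
  rewrite ltr_norml => /andP [_ h3].
  have : pr (F n) <= pr (B_ n).
    by apply: pr_le => // w [_]; apply => /=.
  by lra.
apply/cvgrPdist_lt => e e0.
have hA := low A_ A mA_ mA h1 e e0.
have hC := low (fun n => ~` A_ n) (~` A) (fun n => measurableC (mA_ n))
  (measurableC mA) h2 e e0.
apply: filterS2 hA hC => n h3; rewrite !prC // => h4.
by rewrite ltr_norml; apply/andP; split; lra.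
Qed.

End real_probability.

(** * Laws determined by finite-dimensional cylinder events *)

Lemma countable_bigcapT_measurable d (T : measurableType d) U (F : U -> set T) :
  countable [set: U] -> (forall i, measurable (F i)) -> measurable (\bigcap_i F i).
Proof.
move=> cU mF; rewrite -[X in measurable X]setCK setC_bigcap.
apply: measurableC; apply: countable_bigcupT_measurable => // i.
exact: measurableC.
Qed.

Lemma cylinderP (I : choiceType) (T : Type) (A : I -> set T) (l : seq I) :
  cylinder A l = [set w | forall i, i \in l -> A i w].
Proof.
rewrite /cylinder -bigcap_seq.
by apply/seteqP; split.
Qed.

Lemma cylinder_cat (I T : Type) (A : I -> set T) (l1 l2 : seq I) :
  cylinder A (l1 ++ l2) = cylinder A l1 `&` cylinder A l2.
Proof. by rewrite /cylinder big_cat. Qed.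

Lemma measurable_cylinder (I : choiceType) d (T : measurableType d) (A : I -> set T)
    (l : seq I) : (forall i, i \in l -> measurable (A i)) -> measurable (cylinder A l).
Proof.
rewrite /cylinder; elim: l => [_|i l IH h]; first by rewrite big_nil.
rewrite big_cons; apply: measurableI; first by apply: h; rewrite mem_head.
by apply: IH => j jl; apply: h; rewrite inE jl orbT.
Qed.

(* [f w] is the set of coordinate events that [w] satisfies. *)
Section transfer.
Context {R : realType} {I : choiceType} (J : pred I).
Context {d : measure_display} {T : measurableType d} (P : {measure set T -> \bar R}).
Context {d1 : measure_display} {T1 : measurableType d1} (P1 : {measure set T1 -> \bar R}).
Context {d2 : measure_display} {T2 : measurableType d2} (P2 : {measure set T2 -> \bar R}).
Variables (f : T -> set I) (f1 : T1 -> set I) (f2 : T2 -> set I) (a1 a2 : R).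

(** Generates a sigma-algebra on one common path space, whose sets can be pulled back along
    processes living on different probability spaces. [J] selects the coordinates that may be used,
    for instance negative times only. *)
Definition coordinates : set (set (set I)) :=
  [set S | exists2 i, J i & S = [set s | s i]].

Hypothesis finP : (P setT < +oo)%E.
Hypothesis a10 : 0 <= a1.
Hypothesis a20 : 0 <= a2.
Hypothesis mf : forall i, J i -> measurable [set w | f w i].
Hypothesis mf1 : forall i, J i -> measurable [set w | f1 w i].
Hypothesis mf2 : forall i, J i -> measurable [set w | f2 w i].
Hypothesis eqP : forall l, all J l ->
  P (cylinder (fun i => [set w | f w i]) l)
  = (a1%:E * P1 (cylinder (fun i => [set w | f1 w i]) l)
     + a2%:E * P2 (cylinder (fun i => [set w | f2 w i]) l))%E.

Lemma measurable_path d' (T' : measurableType d') (g : T' -> set I) S :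
  (forall i, J i -> measurable [set w | g w i]) ->
  <<s coordinates >> S -> measurable (g @^-1` S).
Proof.
move=> mg; suff : <<s coordinates >> `<=` [set S | measurable (g @^-1` S)] by apply.
apply: smallest_sub.
  split.
  - by rewrite /= preimage_set0.
  - by move=> A mA; rewrite /= setTD preimage_setC; exact: measurableC.
  - by move=> F mF; rewrite /= preimage_bigcup; apply: bigcup_measurable => n _; exact: mF.
by move=> A [i Ji ->]; exact: mg.
Qed.

(** Dynkin's pi-lambda theorem on finite cylinders. With two weighted measures the same statement
    covers the mixture of the two jump laws and, with a zero weight and a restricted measure, the
    conditioning on an event. *)
Lemma transfer S : <<s coordinates >> S ->
  P (f @^-1` S) = (a1%:E * P1 (f1 @^-1` S) + a2%:E * P2 (f2 @^-1` S))%E.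
Proof.
pose G : set (set (set I)) := [set S | exists2 l, all J l & S = cylinder (fun i => [set s | s i]) l].
have GI : setI_closed G.
  move=> A B [l hl ->] [l' hl' ->]; exists (l ++ l'); first by rewrite all_cat hl.
  by rewrite cylinder_cat.
have cylE (U : Type) (g : U -> set I) l :
    g @^-1` (cylinder (fun i => [set s | s i]) l) = cylinder (fun i => [set w | g w i]) l.
  by rewrite !cylinderP.
have sGc : <<s G >> `<=` <<s coordinates >>.
  apply: smallest_sub; first exact: smallest_sigma_algebra.
  move=> A [l hl ->]; elim: l hl => [_|i l IH /= /andP [Ji hl]].
    by rewrite /cylinder big_nil; exact: (@measurableT _ (g_sigma_algebraType coordinates)).
  rewrite /cylinder big_cons; apply: (@measurableI _ (g_sigma_algebraType coordinates)).
    by apply: sub_gen_smallest; exists i.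
  exact: IH.
have scG : <<s coordinates >> `<=` <<s G >>.
  apply: smallest_sub; first exact: smallest_sigma_algebra.
  move=> A [i Ji ->]; apply: sub_gen_smallest; exists [:: i] => /=; first by rewrite Ji.
  by rewrite /cylinder big_seq1.
move=> /scG; rewrite -setI_closed_g_dynkin_g_sigma_algebra // => hS.
have sub : <<d G >> `<=` <<s coordinates >>.
  by rewrite setI_closed_g_dynkin_g_sigma_algebra.
pose D := [set S | <<s coordinates >> S /\ P (f @^-1` S) =
  (a1%:E * P1 (f1 @^-1` S) + a2%:E * P2 (f2 @^-1` S))%E].
suff : D S by case.
move: S hS; apply: smallest_sub; last first.
  move=> A [l hl ->]; split.
    by apply: sGc; apply: sub_gen_smallest; exists l.
  by rewrite !cylE eqP.
have ET : P setT = (a1%:E * P1 setT + a2%:E * P2 setT)%E.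
  by have := eqP (l := [::]) isT; rewrite /cylinder !big_nil.
split.
- by split; [exact: (@measurableT _ (g_sigma_algebraType coordinates))|rewrite !preimage_setT].
- move=> A [mA hA]; split.
    exact: (@measurableC _ (g_sigma_algebraType coordinates)).
  have m := measurable_path mf mA; have m1 := measurable_path mf1 mA.
  have m2 := measurable_path mf2 mA.
  rewrite -[f @^-1` _]/(~` (f @^-1` A)) -[f1 @^-1` _]/(~` (f1 @^-1` A)).
  rewrite -[f2 @^-1` _]/(~` (f2 @^-1` A)).
  (* Complementation subtracts the mass of the preimage of [A], which must be finite. *)
  have finA : P (f @^-1` A) \is a fin_num.
    rewrite ge0_fin_numE //; apply: le_lt_trans finP.
    by apply: le_measure => //; rewrite inE.
  have sp d' (T' : measurableType d') (Q : {measure set T' -> \bar R}) B :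
      measurable B -> Q setT = (Q B + Q (~` B))%E.
    by move=> mB; rewrite -measureU ?setICr ?setUv //; exact: measurableC.
  rewrite -[LHS](addeK _ finA) -[RHS](addeK _ finA); congr (_ - _)%E.
  rewrite addeC -sp // ET hA (sp _ _ P1 (f1 @^-1` A)) // (sp _ _ P2 (f2 @^-1` A)) //.
  by rewrite !ge0_muleDr // addeACA addeC.
- move=> F tF hF; have mF n : <<s coordinates >> (F n) by have [] := hF n.
  split.
    by apply: (@bigcup_measurable _ (g_sigma_algebraType coordinates)) => n _; exact: mF.
  have pre (U : Type) (g : U -> set I) : trivIset setT (fun n => g @^-1` F n).
    apply/trivIsetP => i j _ _ ij; rewrite -preimage_setI.
    by move/trivIsetP: tF => /(_ i j Logic.I Logic.I ij) ->; rewrite preimage_set0.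
  rewrite !preimage_bigcup !measure_bigcup //;
    try by move=> n _; apply: measurable_path (mF n).
  rewrite -!nneseriesZl //.
  rewrite -nneseriesD //; last 2 first.
  - by move=> n _ _; rewrite mule_ge0 // lee_fin.
  - by move=> n _ _; rewrite mule_ge0 // lee_fin.
  by apply: eq_eseriesr => n _; have [_] := hF n.
Qed.

End transfer.

(** * Counting clock rings along a mesh *)

Section poisson.
Variable R : realType.

(** The Poisson mass function without a case distinction on the sign of the parameter: at 0 it is
    the point mass at 0, which starts the induction along the mesh. *)
Definition poisson_weight (t : R) (k : nat) : R := t ^+ k / k`!%:R * expR (- t).

Definition poisson_cdf (t : R) (k : nat) : R := \sum_(j < k.+1) poisson_weight t j.

Lemma poisson_weightE t k : 0 < t -> poisson_pmf t k = poisson_weight t k.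
Proof. by rewrite /poisson_pmf => ->. Qed.

Lemma poisson_weight0 k : poisson_weight 0 k = (k == 0%N)%:R.
Proof.
rewrite /poisson_weight oppr0 expR0 mulr1; case: k => [|k]; first by rewrite expr0 fact0 divr1.
by rewrite expr0n /= mul0r.
Qed.

Lemma poisson_weight_conv s t n :
  \sum_(k < n.+1) poisson_weight s k * poisson_weight t (n - k) = poisson_weight (s + t) n.
Proof.
rewrite /poisson_weight addrC exprDn opprD expRD !mulr_suml; apply: eq_bigr => k _.
have kn : (k <= n)%N by rewrite -ltnS.
rewrite -mulr_natr.
have -> : n`!%:R = 'C(n, k)%:R * (k`!%:R * (n - k)`!%:R) :> R.
  by rewrite -!natrM bin_fact.
have h1 : k`!%:R != 0 :> R by rewrite pnatr_eq0 -lt0n fact_gt0.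
have h2 : (n - k)`!%:R != 0 :> R by rewrite pnatr_eq0 -lt0n fact_gt0.
have h3 : 'C(n, k)%:R != 0 :> R by rewrite pnatr_eq0 -lt0n bin_gt0.
by field; rewrite h1 h2 h3.
Qed.

End poisson.

Lemma measurable_int_diff d (T : measurableType d) (f g : T -> int) (k : int) :
  (forall j, measurable [set w | f w = j]) ->
  (forall j, measurable [set w | g w = j]) ->
  measurable [set w | f w - g w = k].
Proof.
move=> mf mg.
have -> : [set w | f w - g w = k] =
    \bigcup_(j : int) ([set w | f w = k + j] `&` [set w | g w = j]).
  apply/seteqP; split=> [w /= <-|w [j _ [/= -> ->]]]; last by rewrite addrK.
  by exists (g w) => //; split=> //=; rewrite subrK.
by apply: countable_bigcupT_measurable => // j; apply: measurableI.
Qed.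

Section clocks.
Context {R : realType} {d : measure_display} {T : measurableType d}.
Variables (P : probability T R) (S : Type) (z : T -> R -> int -> S)
  (X : T -> R -> int) (N : T -> int -> R -> int).
Hypothesis hreg : regular_process z X.
Hypothesis hN : poisson_clocks 0%:E P z X N.

Local Notation H := (history 0%:E z X N).

Lemma history_mono s s' A : s <= s' -> H s A -> H s' A.
Proof.
move=> ss; apply: sub_smallest2r; first exact: smallest_sigma_algebra.
move=> B [[u [x [v [us ->]]]]|[u [u' [k [us us' ->]]]]|[u [u' [x [k [[u0 us] [u0' us'] ->]]]]]].
- by constructor 1; exists u, x, v; split=> //; exact: le_trans ss.
- by constructor 2; exists u, u', k; split=> //; exact: le_trans ss.
- constructor 3; exists u, u', x, k; split=> //; split=> //; exact: le_trans ss.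
Qed.

Lemma history_measurable s A : H s A -> measurable A.
Proof.
have [mz mX _] := hreg; have [mN _ _] := hN.
suff : H s `<=` measurable by apply.
apply: smallest_sub; first exact: sigma_algebra_measurable.
move=> B [[u [x [v [us ->]]]]|[u [u' [k [us us' ->]]]]|[u [u' [x [k [[u0 us] [u0' us'] ->]]]]]].
- exact: mz.
- exact: measurable_int_diff.
- exact: measurable_int_diff.
Qed.

Definition window (s t : R) (xs : seq int) (k : int -> nat) : set T :=
  cylinder (fun x => [set w | N w x t - N w x s = (k x)%:Z]) xs.

Lemma windowP s t xs k w :
  window s t xs k w <-> forall x, x \in xs -> N w x t - N w x s = (k x)%:Z.
Proof. by rewrite /window cylinderP. Qed.

Lemma history_incr s t x k : 0 <= s -> s <= t ->
  H t [set w | N w x t - N w x s = k].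
Proof.
move=> s0 st; apply: sub_gen_smallest; constructor 3; exists t, s, x, k.
by split=> //; rewrite lee_fin ?(le_trans s0 st).
Qed.

Lemma history_window s t xs k : 0 <= s -> s <= t -> H t (window s t xs k).
Proof.
move=> s0 st; apply: (@measurable_cylinder _ _ (g_sigma_algebraType _)) => x _.
exact: history_incr.
Qed.

Lemma clock_window s t A (xs : seq int) (k : int -> nat) :
  0 <= s -> s < t -> H s A -> uniq xs ->
  pr P (A `&` window s t xs k)
  = pr P A * \prod_(x <- xs) poisson_weight (t - s) (k x).
Proof.
move=> s0 st hA ux; have [_ _ hP] := hN.
have mW := history_measurable (history_window xs k s0 (ltW st)).
have mA := history_measurable hA.
apply: EFin_inj; rewrite EFinM -!prE //; last exact: measurableI.
rewrite hP //; congr (_ * (_)%:E)%E; apply: eq_bigr => x _.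
by rewrite poisson_weightE // subr_gt0.
Qed.

Section count.
Variables (tm : nat -> R) (br bl : nat -> int).
Hypothesis tm0 : 0 <= tm 0%N.
Hypothesis tmS : forall l, tm l < tm l.+1.
Hypothesis brl : forall a b, br a <> bl b.

Let ca l w := ring_count (N w) tm br l.
Let cb l w := ring_count (N w) tm bl l.

Let Cn l a b := [set w | ca l w = a /\ cb l w = b].

Lemma tm_ge0 l : 0 <= tm l.
Proof. by elim: l => // l IH; apply: le_trans IH (ltW (tmS l)). Qed.

Lemma tm_le m l : (m <= l)%N -> tm m <= tm l.
Proof.
elim: l => [|l IH]; first by rewrite leqn0 => /eqP ->.
rewrite leq_eqVlt => /predU1P [->//|/IH h]; exact: le_trans h (ltW (tmS l)).
Qed.

(** Splitting over the counts at [tm l] makes the observed bonds deterministic: each piece is a past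
    event intersected with a window of two fixed clocks. *)
Lemma count_succE l a b : Cn l.+1 a b =
  \big[setU/set0]_(i <- [seq (i1, i2) | i1 <- iota 0 a.+1, i2 <- iota 0 b.+1])
   (Cn l i.1 i.2 `&` window (tm l) (tm l.+1) [:: br i.1; bl i.2]
      (fun x => if x == br i.1 then (a - i.1)%N else (b - i.2)%N)).
Proof.
have [_ mono _] := hN.
have hge w x : N w x (tm l) <= N w x (tm l.+1).
  by have [h _] := mono w x; apply: h; exact: ltW.
have memi c i : (i \in iota 0 c.+1) = (i <= c)%N by rewrite mem_iota add0n ltnS.
move: (iota 0 a.+1) (iota 0 b.+1) (memi a) (memi b) => ra rb hra hrb.
rewrite -bigcup_seq; apply/seteqP; split=> w /=.
  move=> [ea eb]; exists (ca l w, cb l w) => /=.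
    by apply: allpairs_f; rewrite ?hra ?hrb -?ea -?eb /ca /cb /= leq_addr.
  split=> //; apply/windowP => x; rewrite !inE => /orP [] /eqP ->.
    rewrite eqxx -ea /ca /= addKn; have := hge w (br (ca l w)).
    by rewrite /ca; lia.
  rewrite ifF; last by apply/eqP => /esym; exact: brl.
  rewrite -eb /cb /= addKn; have := hge w (bl (cb l w)).
  by rewrite /cb; lia.
move=> [[i j] /= /allpairsP [[i' j'] [/=]]]; rewrite hra hrb.
move=> ia jb [-> ->] [[ei ej] /windowP h].
have h1 := h (br i'); have h2 := h (bl j'); rewrite !inE eqxx /= in h1.
rewrite !inE eqxx orbT in h2.
rewrite /Cn /ca /cb /= -/(ca l w) -/(cb l w) ei ej h1 // h2 //.
rewrite ifF; last by apply/eqP => /esym; exact: brl.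
by rewrite !absz_nat !subnKC.
Qed.

Lemma count_history l a b : H (tm l) (Cn l a b).
Proof.
elim: l a b => [|l IH] a b.
  have -> : Cn 0%N a b = if (a == 0%N) && (b == 0%N) then setT else set0.
    apply/seteqP; split=> w; rewrite /Cn /ca /cb /=; first by move=> [<- <-].
    by case: ifP => // /andP [/eqP -> /eqP ->].
  case: ifP => _; last exact: (@measurable0 _ (g_sigma_algebraType _)).
  exact: (@measurableT _ (g_sigma_algebraType _)).
rewrite count_succE.
apply: (@bigsetU_measurable _ (g_sigma_algebraType _)) => -[i j] _ /=.
apply: (@measurableI _ (g_sigma_algebraType _)).
  by apply: (history_mono _ (IH i j)); exact: ltW.
by apply: history_window; [exact: tm_ge0|exact: ltW].
Qed.

(** Which bond is read depends only on the past, and all clocks have rate 1, so the adaptive reading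
    does not alter the law of the increments. The two bonds being distinct, the counts are moreover
    independent of each other and of [A]. Each mesh step is a convolution of Poisson weights. *)
Lemma count_law A l a b : H (tm 0%N) A ->
  pr P (A `&` Cn l a b) =
  pr P A * (poisson_weight (tm l - tm 0%N) a * poisson_weight (tm l - tm 0%N) b).
Proof.
move=> hA; elim: l a b => [|l IH] a b.
  rewrite subrr !poisson_weight0.
  case: (boolP ((a == 0%N) && (b == 0%N))) => [/andP [/eqP -> /eqP ->]|].
    rewrite !eqxx !mulr1; congr pr; apply/seteqP; split=> w; first by case.
    by split.
  move=> hab; rewrite -natrM mulnb (negbTE hab) mulr0.
  have -> : A `&` Cn 0%N a b = set0; last by rewrite pr0.
  apply/seteqP; split=> // w [_ [ha hb]]; move: hab.
  by rewrite -ha -hb.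
rewrite count_succE setIC -bigcup_seq setI_bigcupl bigcup_seq.
rewrite pr_bigU; last first.
- move=> [i j] [i' j'] w _ _ [[[/= h1 h2] _] _] [[[/= h3 h4] _] _].
  by rewrite -h1 -h2 -h3 -h4.
- move=> [i j]; apply: (@history_measurable (tm l.+1)).
  apply: (@measurableI _ (g_sigma_algebraType _)); last first.
    by apply: (history_mono _ hA); exact: tm_le.
  apply: (@measurableI _ (g_sigma_algebraType _)).
    by apply: (history_mono _ (count_history i j)); exact: ltW.
  by apply: history_window; [exact: tm_ge0|exact: ltW].
- by apply: allpairs_uniq; rewrite ?iota_uniq // => -[? ?] [? ?].
pose wt := poisson_weight (tm l - tm 0%N); pose dl := poisson_weight (tm l.+1 - tm l).
have -> : tm l.+1 - tm 0%N = (tm l - tm 0%N) + (tm l.+1 - tm l) by ring.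
rewrite -!poisson_weight_conv big_allpairs.
rewrite big_distrl /= mulr_sumr -[in RHS](big_mkord xpredT (fun i =>
  pr P A * (wt i * dl (a - i)%N * _))) /index_iota subn0.
apply: eq_bigr => i _.
rewrite mulr_sumr mulr_sumr -[in RHS](big_mkord xpredT (fun j =>
  pr P A * (wt i * dl (a - i)%N * (wt j * dl (b - j)%N)))) /index_iota subn0.
apply: eq_bigr => j _ /=.
rewrite setIAC (setIC (Cn l _ _)).
have hAC : H (tm l) (A `&` Cn l i j).
  apply: (@measurableI _ (g_sigma_algebraType _)); last exact: count_history.
  by apply: (history_mono _ hA); exact: tm_le.
have us : uniq [:: br i; bl j] by rewrite /= inE andbT; apply/eqP; exact: brl.
rewrite (clock_window _ (tm_ge0 l) (tmS l) hAC us).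
rewrite IH !big_cons big_nil eqxx ifF; last by apply/eqP => /esym; exact: brl.
rewrite -/wt -/dl; ring.
Qed.

End count.
End clocks.

Arguments history_window {R d T S z X N s t} xs k _ _.
Arguments count_history {R d T P S z X N} hN {tm br bl} tm0 tmS brl l a b.

Lemma pr_le_ae (R : realType) d (T : measurableType d) (P : probability T R)
    (A B : set T) : measurable A -> measurable B ->
  {ae P, forall w, A w -> B w} -> pr P A <= pr P B.
Proof.
move=> mA mB hAB; rewrite (pr_split P mA mB) [X in _ + X](pr_ae0 hAB) ?addr0.
- by apply: pr_le => //; exact: measurableI.
- by apply: measurableI => //; exact: measurableC.
- by move=> w [h1 h2] /(_ h1).
Qed.

Lemma eq_of_le_div (R : realType) (x y C : R) :
  (forall n : nat, `|x - y| <= C / n.+1%:R) -> x = y.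
Proof.
move=> h; apply/eqP; rewrite -subr_eq0 -normr_eq0; apply/eqP/le_anti.
rewrite normr_ge0 andbT leNgt; apply/negP => h0.
have C0 : 0 <= C by have := h 0%N; rewrite divr1; exact: le_trans.
have [n hn] : exists n : nat, C / `|x - y| < n%:R.
  by exists (Num.bound (C / `|x - y|)); apply: le_lt_trans (archi_boundP _); rewrite ?divr_ge0 // ler_norm.
have := h n; apply/negP; rewrite -ltNge ltr_pdivrMr //.
rewrite ltr_pdivrMr // in hn; apply: lt_le_trans hn _.
by rewrite mulrC ler_pM2l // ler_nat.
Qed.

(** * Probability of staying still from given queues *)

Section mesh.
Context {R : realType} {d : measure_display} {T : measurableType d}.
Variables (P : probability T R) (z : T -> R -> int -> bool)
  (X : T -> R -> int) (N : T -> int -> R -> int).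
Hypothesis hreg : regular_process z X.
Hypothesis hN : poisson_clocks 0%:E P z X N.

Lemma prod_poisson_weight (dl : R) (xs : seq int) (k : pred int) :
  \prod_(x <- xs) poisson_weight dl (k x) = dl ^+ count k xs * expR (- dl) ^+ size xs.
Proof.
elim: xs => [|x xs IH]; first by rewrite big_nil !expr0 mulr1.
rewrite big_cons IH /= exprD exprS /poisson_weight.
by case: (k x); rewrite /= ?expr0 ?expr1 ?fact0 ?divr1; ring.
Qed.

Definition good s t xs := [set w | single_increment (N w) s t xs].

Lemma goodE s t xs : good s t xs = window N s t xs (fun=> 0%N) `|`
  \big[setU/set0]_(b <- xs) window N s t xs (fun x => (x == b)%N).
Proof.
rewrite -bigcup_seq; apply/seteqP; split=> w.
  case=> [h|[b [hb nb h]]].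
    by left; apply/windowP => x xx; rewrite h ?subrr.
  right; exists b => //; apply/windowP => x xx.
  by case: (x =P b) => [->|xb]; rewrite ?nb ?h //; lia.
case=> [/windowP h|[b bx /windowP h]].
  by left=> x xx; have := h x xx; lia.
right; exists b; split=> //; first by have := h b bx; rewrite eqxx /=; lia.
by move=> x xx /eqP xb; have := h x xx; rewrite (negbTE xb) /=; lia.
Qed.

Lemma good_measurable s t xs : 0 <= s -> s <= t -> measurable (good s t xs).
Proof.
move=> s0 st; have mW k : measurable (window N s t xs k).
  exact: (history_measurable hreg hN (history_window xs k s0 st)).
rewrite goodE; apply: measurableU => //.
by apply: bigsetU_measurable.
Qed.

(** At most one ring has probability [(1 + c) exp(- c)] with [c = size xs * (t - s)], and
    [exp(- c) >= 1 - c] leaves at most [c ^ 2] for the complement. *)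
Lemma good_prob s t xs : 0 <= s -> s < t -> uniq xs ->
  pr P (~` good s t xs) <= ((size xs)%:R * (t - s)) ^+ 2.
Proof.
move=> s0 st ux; have mW k : measurable (window N s t xs k).
  exact: (history_measurable hreg hN (history_window xs k s0 (ltW st))).
rewrite prC; last by apply: good_measurable => //; exact: ltW.
have hT : history 0%:E z X N s setT by exact: (@measurableT _ (g_sigma_algebraType _)).
have pW k : pr P (window N s t xs k) = \prod_(x <- xs) poisson_weight (t - s) (k x).
  by rewrite -[window _ _ _ _ _]setTI (clock_window hreg hN _ s0 st hT ux) prT mul1r.
rewrite goodE prU //; last 2 first.
- exact: bigsetU_measurable.
- move=> w /windowP h; rewrite -bigcup_seq => -[b bx /windowP /(_ b bx)].
  by rewrite h // eqxx.
rewrite pr_bigU //; last first.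
  move=> b b' w bx _ /windowP h /windowP h'.
  by have := h b bx; rewrite h' // eqxx; case: (b =P b').
set c := _ * (t - s).
have E0 : pr P (window N s t xs (fun=> 0%N)) = expR (- c).
  rewrite pW (prod_poisson_weight _ _ pred0) count_pred0 expr0 mul1r.
  by rewrite -expRM_natl mulrN.
have E1 : \sum_(b <- xs) pr P (window N s t xs (fun x => (x == b)%N)) = c * expR (- c).
  have -> : c * expR (- c) = \sum_(b <- xs) (t - s) * expR (- c).
    by rewrite big_const_seq count_predT iter_addr_0 -mulr_natl mulrA.
  rewrite big_seq [in RHS]big_seq; apply: eq_bigr => b bx.
  rewrite pW (prod_poisson_weight _ _ (pred1 b)) count_uniq_mem // bx expr1.
  by rewrite -expRM_natl mulrN.
rewrite E0 E1.
have c0 : 0 <= c by rewrite mulr_ge0 // subr_ge0 ltW.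
have hc : 1 - c <= expR (- c) by exact: expR_ge1Dx.
have : (1 - c) * (1 + c) <= expR (- c) * (1 + c) by rewrite ler_wpM2r //; lra.
by rewrite expr2; lra.
Qed.

Definition still (h : R) : set T := [set w | forall u, 0 <= u -> u <= h -> X w u = X w 0].

(** Right continuity reduces the times in [[0, h)] to rational ones; the endpoint [h] is treated on
    its own. *)
Lemma still_measurable h : 0 <= h -> measurable (still h).
Proof.
move=> h0; have [_ mX cad] := hreg.
have -> : still h = [set w | X w h - X w 0 = 0] `&`
    \bigcap_(q : rat) (if (0 <= ratr q :> R) && (ratr q <= h :> R)
      then [set w | X w (ratr q) - X w 0 = 0] else setT).
  apply/seteqP; split=> w.
    move=> hw; split=> [|q _] /=; first by rewrite hw ?subrr.
    by case: ifP => // /andP [q0 qh] /=; rewrite hw // subrr.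
  move=> [/eqP]; rewrite subr_eq0 => /eqP hh hq u u0.
  rewrite le_eqVlt => /predU1P [->//|uh].
  have [_ cX] := cad w; have [/near_rightP [b ub hb] _] := cX u.
  have [q] := @rat_in_itvoo R u (Num.min b h) ltac:(by rewrite lt_min ub uh).
  rewrite in_itv /= lt_min => /and3P [q1 q2 q3].
  have := hq q Logic.I; rewrite ifT; last by rewrite (le_trans u0 (ltW q1)) ltW.
  by move=> /= /eqP; rewrite subr_eq0 => /eqP <-; rewrite hb.
apply: measurableI; first exact: measurable_int_diff.
apply: countable_bigcapT_measurable => // q; case: ifP => // _.
exact: measurable_int_diff.
Qed.

Lemma relevant_bonds_uniq kr kl : uniq (relevant_bonds kr kl).
Proof.
rewrite cat_uniq; apply/and3P; split.
- rewrite map_inj_uniq ?iota_uniq // => i j; rewrite /right_bond; lia.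
- apply/hasPn => x /mapP [j _ ->].
  by apply/negP => /mapP [i _]; rewrite /left_bond /right_bond; lia.
- rewrite map_inj_uniq ?iota_uniq // => i j; rewrite /left_bond; lia.
Qed.

Hypothesis hmotion : {ae P, forall w, motion ok_pair 1 0%:E (z w) (X w) (N w)}.

(** The event [D] that both counts stay within the queues has exactly the claimed probability for
    every mesh. It agrees with stillness off the event [B] that some mesh interval contains two
    relevant rings, and P(B) is of order [1 / n]. Neither side of the claim depends on [n], so they
    are equal. *)
Lemma still_prob (A : set T) (kr kl : nat) (h : R) : 0 <= h ->
  history 0%:E z X N 0 A -> (forall w, A w -> queues (z w 0) kr kl) ->
  pr P (A `&` still h) = pr P A * (poisson_cdf h kr * poisson_cdf h kl).
Proof.
move=> h0 hA hq; have mA := history_measurable hreg hN hA.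
(* For [h = 0] the mesh would be degenerate; both distribution functions are then 1. *)
move: h0; rewrite le_eqVlt => /predU1P [<-|h0].
  have c0 k : poisson_cdf (0 : R) k = 1.
    rewrite /poisson_cdf big_ord_recl poisson_weight0 big1 ?addr0 // => i _.
    by rewrite poisson_weight0.
  rewrite !c0 !mulr1; congr pr; apply/seteqP; split=> [w [] //|w Aw]; split=> // u u0 u1.
  by congr (X w); apply/le_anti; rewrite u0 u1.
have mS := still_measurable (ltW h0).
set xs := relevant_bonds kr kl; pose m : R := (size xs)%:R.
apply: (@eq_of_le_div R _ _ ((m * h) ^+ 2)) => n.
pose dl := h / n.+1%:R; pose tm (l : nat) : R := l%:R * dl.
have dl0 : 0 < dl by rewrite divr_gt0.
have tm0 : tm 0%N = 0 by rewrite /tm mul0r.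
have tmn : tm n.+1 = h by rewrite /tm /dl mulrC divfK // pnatr_eq0.
have tmS l : tm l < tm l.+1 by rewrite /tm ltr_pM2r // ltr_nat.
have tm_mono : {homo tm : a b / (a <= b)%N >-> a <= b}.
  by move=> a b ab; rewrite /tm ler_pM2r // ler_nat.
have tm_ge l : 0 <= tm l by rewrite -tm0; exact: tm_mono.
pose br c := right_bond (kr - c); pose bl c := left_bond (kl - c).
have brl a b : br a <> bl b by rewrite /br /bl /right_bond /left_bond; lia.
pose F (i : nat * nat) := A `&` [set w | ring_count (N w) tm br n.+1 = i.1 /\
  ring_count (N w) tm bl n.+1 = i.2].
pose D := \big[setU/set0]_(i <- [seq (i1, i2) | i1 <- iota 0 kr.+1, i2 <- iota 0 kl.+1]) F i.
have hA' : history 0%:E z X N (tm 0%N) A by rewrite tm0.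
have tm0' : 0 <= tm 0%N by rewrite tm0.
have mF i : measurable (F i).
  apply: measurableI => //.
  exact: (history_measurable hreg hN (count_history hN tm0' tmS brl n.+1 i.1 i.2)).
have mD : measurable D by apply: bigsetU_measurable.
have DP w : D w <-> A w /\ (ring_count (N w) tm br n.+1 <= kr)%N &&
    (ring_count (N w) tm bl n.+1 <= kl)%N.
  have memi c i : (i \in iota 0 c.+1) = (i <= c)%N by rewrite mem_iota add0n ltnS.
  rewrite /D; move: (iota 0 kr.+1) (iota 0 kl.+1) (memi kr) (memi kl) => ra rb hra hrb.
  rewrite -bigcup_seq; split.
    move=> [[i j] /= /allpairsP [[i' j'] [/= i1 j1 [-> ->]]] [Aw [/= e1 e2]]].
    by rewrite e1 e2 -hra -hrb i1 j1.
  move=> [Aw /andP [h1 h2]].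
  exists (ring_count (N w) tm br n.+1, ring_count (N w) tm bl n.+1) => //.
  by apply: allpairs_f; rewrite ?hra ?hrb.
have prD : pr P D = pr P A * (poisson_cdf h kr * poisson_cdf h kl).
  rewrite pr_bigU //; last 2 first.
  - by apply: allpairs_uniq; rewrite ?iota_uniq // => -[? ?] [? ?].
  - by move=> [i j] [i' j'] w _ _ [_ [/= <- <-]] [_ [/= <- <-]].
  rewrite big_allpairs /poisson_cdf big_distrl /= mulr_sumr.
  rewrite -[in RHS](big_mkord xpredT (fun i => pr P A * (poisson_weight h i *
    \sum_(j < kl.+1) poisson_weight h j))) /index_iota subn0.
  apply: eq_bigr => i _; rewrite !mulr_sumr.
  rewrite -[in RHS](big_mkord xpredT (fun j => pr P A * (poisson_weight h i *
    poisson_weight h j))) /index_iota subn0.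
  apply: eq_bigr => j _.
  rewrite /F (count_law hreg hN tm0' tmS brl n.+1 _ _ hA') /=.
  by rewrite tmn tm0 subr0.
pose B := \big[setU/set0]_(l <- iota 0 n.+1) ~` good (tm l) (tm l.+1) xs.
have mG l : measurable (~` good (tm l) (tm l.+1) xs).
  by apply: measurableC; apply: good_measurable => //; exact: ltW.
have mB : measurable B by apply: bigsetU_measurable.
(* Each of the [n.+1] intervals contributes at most [(m * h / n.+1) ^ 2]. *)
have prB : pr P B <= (m * h) ^+ 2 / n.+1%:R.
  apply: le_trans (pr_bigU_le _ _ mG) _.
  have -> : (m * h) ^+ 2 / n.+1%:R = \sum_(l <- iota 0 n.+1) (m * dl) ^+ 2.
    rewrite big_const_seq count_predT iter_addr_0 size_iota /dl -[RHS]mulr_natl.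
    have x0 : n.+1%:R != 0 :> R by rewrite pnatr_eq0.
    by move: (n.+1%:R : R) x0 => x x0; field.
  apply: ler_sum => l _.
  have -> : dl = tm l.+1 - tm l by rewrite /tm -mulrBl -natrB // subSnn mul1r.
  by apply: good_prob => //; exact: relevant_bonds_uniq.
have [_ mono _] := hN; have [_ _ cad] := hreg.
have key : {ae P, forall w, ~ B w -> A w -> still h w <-> D w}.
  apply: filterS hmotion => w hm nB Aw.
  have hs l : (l < n.+1)%N -> single_increment (N w) (tm l) (tm l.+1) xs.
    move=> ln; apply: contrapT => hng; apply: nB; rewrite /B -bigcup_seq.
    have lm : l \in iota 0 n.+1 by rewrite mem_iota add0n ln.
    by exists l; [exact: lm|exact: hng].
  have [cz cX] := cad w.
  have mn x : {homo N w x : u v / u <= v} by have [] := mono w x.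
  have cn x : cadlag (N w x) by have [] := mono w x.
  have hq0 : queues (z w (tm 0%N)) kr kl by rewrite tm0; exact: hq.
  have := queues_count (t0 := 0) hm cz cX mn cn (esym tm0) tm_mono hq0 hs.
  rewrite -/br -/bl /=.
  rewrite DP; case: ifP => hc.
    move=> [_ hX]; split=> // _ u u0 uh; rewrite -tm0 hX //; last by rewrite tmn.
    by rewrite tm0.
  move=> [u [u1 u2 u3]]; split; last by case.
  by move=> hst; case: u3; rewrite tm0 hst -?tmn // -tm0.
have mAS : measurable (A `&` still h) by exact: measurableI.
have h1 : pr P D <= pr P ((A `&` still h) `|` B).
  apply: pr_le_ae => //; first exact: measurableU.
  apply: filterS key => w hk Dw; have [Bw|nB] := pselect (B w); first by right.
  by left; have [Aw _] := (DP w).1 Dw; split=> //; apply/(hk nB Aw).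
have h2 : pr P (A `&` still h) <= pr P (D `|` B).
  apply: pr_le_ae => //; first exact: measurableU.
  apply: filterS key => w hk [Aw sw]; have [Bw|nB] := pselect (B w); first by right.
  by left; apply/(hk nB Aw).
have := prU_le P mAS mB; have := prU_le P mD mB.
rewrite -prD ler_norml => h3 h4; move: ((m * h) ^+ 2 / n.+1%:R) prB => c hc.
move: h1 h2 h3 h4 hc; clear => h1 h2 h3 h4 hc; apply/andP; split; lra.
Qed.

End mesh.

(** * Summing over the queue lengths *)

Section limits.
Variable R : realType.

(** [tail theta (1 - theta)] is the tail of a run length under the initial law; the free [e] also
    covers a run prolonged by one site. *)
Definition tail (c e : R) (j : nat) : R := c ^+ j * (1 + j%:R * e).

(** With [s = sqrt c], Bernoulli's inequality for [s^-1] bounds [n] by a multiple of [s ^- n], and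
    [c ^ n = s ^ n * s ^ n] leaves a factor [s ^ n] tending to 0. *)
Lemma cvg_natr_geometric (c : R) : 0 < c < 1 ->
  n%:R * c ^+ n @[n --> \oo] --> (0 : R).
Proof.
move=> /andP [c0 c1]; pose s := Num.sqrt c.
have s0 : 0 < s by rewrite sqrtr_gt0.
have sc : s ^+ 2 = c by rewrite sqr_sqrtr // ltW.
have s1 : s < 1 by rewrite -sqrtr1 ltr_sqrt.
have hs : `|s| < 1 by rewrite gtr0_norm.
have hx : 0 < s^-1 - 1 by rewrite subr_gt0 invf_gt1.
have bern n : n%:R * (s^-1 - 1) <= s^-1 ^+ n.
  elim: n => [|n IH]; first by rewrite mul0r expr0.
  rewrite exprS -natr1 mulrDl mul1r.
  have h1 : 1 <= s^-1 ^+ n by rewrite exprn_ege1 // ltW // invf_gt1.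
  have h2 := ltW hx.
  have : (s^-1 - 1) * 1 <= (s^-1 - 1) * s^-1 ^+ n by rewrite ler_wpM2l.
  have -> : s^-1 * s^-1 ^+ n = s^-1 ^+ n + (s^-1 - 1) * s^-1 ^+ n by ring.
  by lra.
apply: (@squeeze_cvgr _ _ _ _ (fun=> 0) (fun n => (s^-1 - 1)^-1 * s ^+ n)).
- apply: nearW => n; apply/andP; split; first by rewrite mulr_ge0 ?exprn_ge0 ?(ltW c0).
  have -> : c ^+ n = s ^+ n * s ^+ n by rewrite -sc exprAC expr2.
  rewrite mulrA ler_pM2r ?exprn_gt0 // -(ler_pM2r hx) mulVf ?gt_eqF //.
  have : n%:R * (s^-1 - 1) * s ^+ n <= s^-1 ^+ n * s ^+ n.
    by rewrite ler_pM2r ?exprn_gt0.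
  by rewrite -exprMn mulVf ?gt_eqF // expr1n mulrAC.
- exact: cvg_cst.
- rewrite -(mulr0 (s^-1 - 1)^-1); apply: cvgMr; exact: cvg_expr.
Qed.

Lemma cvg_tail (c e : R) : 0 < c < 1 -> tail c e n @[n --> \oo] --> (0 : R).
Proof.
move=> hc; have -> : tail c e = (fun n => c ^+ n + e * (n%:R * c ^+ n)).
  by apply/funext => n; rewrite /tail; ring.
rewrite -[X in _ --> X]addr0; apply: cvgD.
  by apply: cvg_expr; case/andP: hc => c0 c1; rewrite gtr0_norm.
rewrite -(mulr0 e); apply: cvgMr; exact: cvg_natr_geometric.
Qed.

Lemma cvg_exp_sum (x : R) : \sum_(j < n) x ^+ j / j`!%:R @[n --> \oo] --> expR x.
Proof.
have := is_cvg_series_exp_coeff x => h.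
have -> : (fun n => \sum_(j < n) x ^+ j / j`!%:R) = series (exp_coeff x).
  by apply/funext => n; rewrite /series /= big_mkord.
exact: h.
Qed.

(** The factor [j] cancels against [j!] and shifts the index, so every partial sum is exactly a
    combination of two partial sums of the exponential series at [h * c]. *)
Lemma cvg_poisson_tail (c e h : R) :
  \sum_(j < n) tail c e j * poisson_weight h j @[n --> \oo] -->
  expR (- h + h * c) * (1 + e * h * c).
Proof.
pose E (n : nat) : R := \sum_(j < n) (h * c) ^+ j / j`!%:R.
have sumE n : \sum_(j < n.+1) tail c e j * poisson_weight h j =
    expR (- h) * (E n.+1 + e * h * c * E n).
  have ES k : E k.+1 = E k + (h * c) ^+ k / k`!%:R by rewrite /E big_ord_recr.
  have E0 : E 0%N = 0 by rewrite /E big_ord0.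
  elim: n => [|n IH].
    by rewrite big_ord_recr big_ord0 /= ES E0 /tail /poisson_weight !expr0 fact0; field.
  rewrite big_ord_recr /= IH !ES /tail /poisson_weight factS natrM exprMn !exprS.
  have h1 : n`!%:R != 0 :> R by rewrite pnatr_eq0 -lt0n fact_gt0.
  have h2 : n.+1%:R != 0 :> R by rewrite pnatr_eq0.
  move: (E n) (expR _) (n`!%:R) h1 => e0 x0 f0 h1.
  move: (n.+1%:R) h2 => m0 h2; rewrite exprMn.
  by field; rewrite h1 h2.
rewrite -cvg_shiftS /=.
have -> : (fun n => \sum_(j < n.+1) tail c e j * poisson_weight h j) =
  (fun n => expR (- h) * (E n.+1 + e * h * c * E n)) by exact/funext.
have -> : expR (- h + h * c) * (1 + e * h * c) =
  expR (- h) * (expR (h * c) + e * h * c * expR (h * c)) by rewrite expRD; ring.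
apply: cvgMr; apply: cvgD; first by rewrite cvg_shiftS; exact: cvg_exp_sum.
by apply: cvgMr; exact: cvg_exp_sum.
Qed.

(** Summation by parts. With [a j = P(K >= j)] it turns the expectation of the Poisson distribution
    function at [K] into a sum of [a j] against Poisson weights. *)
Lemma abel_poisson (a : nat -> R) h n :
  \sum_(i < n) (a i - a i.+1) * poisson_cdf h i =
  \sum_(i < n) a i * poisson_weight h i - a n * \sum_(i < n) poisson_weight h i.
Proof.
elim: n => [|n IH]; first by rewrite !big_ord0 mulr0 subr0.
rewrite big_ord_recr IH /= /poisson_cdf ![\sum_(i < n.+1) _]big_ord_recr /=; ring.
Qed.

Lemma cvg_poisson_cdf (c e h : R) : 0 < c < 1 ->
  \sum_(i < n) (tail c e i - tail c e i.+1) * poisson_cdf h i @[n --> \oo] -->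
  expR (- h + h * c) * (1 + e * h * c).
Proof.
move=> hc.
have -> : (fun n => \sum_(i < n) (tail c e i - tail c e i.+1) * poisson_cdf h i) =
  (fun n => \sum_(i < n) tail c e i * poisson_weight h i
    - tail c e n * \sum_(i < n) poisson_weight h i).
  by apply/funext => n; exact: abel_poisson.
rewrite -[X in _ --> X]subr0; apply: cvgB; first exact: cvg_poisson_tail.
have h1 : \sum_(i < n) poisson_weight h i @[n --> \oo] --> (1 : R).
  (* The Poisson weights sum to 1: this is the case [c = 1], [e = 0] of the preceding limit. *)
  have := @cvg_poisson_tail 1 0 h; rewrite mulr1 addNr expR0 !mul0r addr0 mulr1.
  have -> : (fun n => \sum_(j < n) tail 1 0 j * poisson_weight h j) =
    (fun n => \sum_(j < n) poisson_weight h j); last by [].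
  apply/funext => n; apply: eq_bigr => j _.
  by rewrite /tail expr1n mulr0 addr0 !mul1r.
rewrite -[X in _ --> X](mul0r (1 : R)); apply: cvgM; [exact: cvg_tail|exact: h1].
Qed.

End limits.

Lemma queues_inj c i j i' j' : queues c i j -> queues c i' j' -> i = i' /\ j = j'.
Proof.
move=> [h1 h2 h3 h4] [h1' h2' h3' h4']; split; apply/eqP; rewrite eqn_leq.
  apply/andP; split; rewrite leqNgt; apply/negP => hh.
    by have := h2'; rewrite h1 //; lia.
  by have := h2; rewrite h1' //; lia.
apply/andP; split; rewrite leqNgt; apply/negP => hh.
  by have := h4'; rewrite h3 //; lia.
by have := h4; rewrite h3' //; lia.
Qed.

Lemma last_index (p : nat -> Prop) n : p 0%N -> ~ p n ->
  exists i, [/\ (i < n)%N, p i & ~ p i.+1].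
Proof.
move=> p0; elim: n => [//|n IH] pn.
have [hq|hq] := pselect (p n); first by exists n.
by have [i [i1 i2 i3]] := IH hq; exists i; split=> //; exact: ltnW.
Qed.

Section total.
Context {R : realType} {d : measure_display} {T : measurableType d}.
Variables (P : probability T R) (z : T -> R -> int -> bool) (X : T -> R -> int).
Hypothesis htasep : tasep_from ok_pair 1 0%:E P z X.

(** Sites 0 and 1 carry no condition: the pair occupies them almost surely, and the other sites are
    those whose law is known. *)
Definition queues_ge (i j : nat) : set T :=
  [set w | (forall x : int, 1 < x -> x < i%:Z + 2 -> z w 0 x = true) /\
           (forall x : int, - j%:Z <= x -> x < 0 -> z w 0 x = false)].

(** Exact queue lengths as a difference of differences, one per side, so that a product form for
    [queues_ge] yields a product of increments. *)
Definition queues_eq (i j : nat) : set T :=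
  (queues_ge i j `&` ~` queues_ge i.+1 j) `&`
  ~` (queues_ge i j.+1 `&` ~` queues_ge i.+1 j.+1).

Lemma queues_ge_cylinder i j : queues_ge i j =
  cylinder (fun p : nat * bool => [set w | z w 0 p.1%:Z = p.2])
    [seq (x.+2, true) | x <- iota 0 i] `&`
  cylinder (fun p : nat * bool => [set w | z w 0 (- p.1%:Z) = p.2])
    [seq (x.+1, false) | x <- iota 0 j].
Proof.
rewrite !cylinderP; apply/seteqP; split=> w [h1 h2]; split.
- move=> p /mapP [x]; rewrite mem_iota /= add0n => xi -> /=; apply: h1; lia.
- move=> p /mapP [x]; rewrite mem_iota /= add0n => xi -> /=; apply: h2; lia.
- move=> x x1 x2; have := h1 (`|x|%N, true); rewrite /= gtz0_abs; last by lia.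
  apply; apply/mapP; exists (`|x| - 2)%N; first by rewrite mem_iota; lia.
  by congr (_, _); lia.
- move=> x x1 x2; have := h2 (`|x|%N, false); rewrite /=.
  have -> : - `|x|%N%:Z = x by lia.
  apply; apply/mapP; exists (`|x| - 1)%N; first by rewrite mem_iota; lia.
  by congr (_, _); lia.
Qed.

Lemma queues_ge_algebra (M : set (set T)) i j : sigma_algebra setT M ->
  (forall x v, M [set w | z w 0 x = v]) -> M (queues_ge i j).
Proof.
move=> sM hM; rewrite queues_ge_cylinder.
have eM : <<s M >> = M by exact: sigma_algebra_id.
rewrite -eM; apply: (@measurableI _ (g_sigma_algebraType M));
  apply: (@measurable_cylinder _ _ (g_sigma_algebraType M)) => p _;
  by apply: sub_gen_smallest; exact: hM.
Qed.

Lemma queues_ge_mono i j i' j' : (i <= i')%N -> (j <= j')%N ->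
  queues_ge i' j' `<=` queues_ge i j.
Proof. by move=> ii jj w [h1 h2]; split=> x x1 x2; [apply: h1|apply: h2]; lia. Qed.

Lemma queues_eqP i j w : queues_eq i j w -> z w 0 0 = false -> z w 0 1 = true ->
  queues (z w 0) i j.
Proof.
move=> [[[h1 h2] h3] h4] z0 z1.
have zi : z w 0 (i%:Z + 2) = false.
  apply/negP => zi; apply: h3; split=> // x x1 x2.
  by case: (x =P i%:Z + 2) => [->//|xi]; apply: h1; lia.
have zj : z w 0 (- j%:Z - 1) = true.
  apply/negPn/negP => /negbTE zj; apply: h4; split.
    split=> // x x1 x2.
    by case: (x =P - j%:Z - 1) => [->//|xi]; apply: h2; lia.
  by move=> [h5 _]; have := h5 (i%:Z + 2); rewrite zi => h6; have := h6 ltac:(lia) ltac:(lia).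
split=> // x x1 x2.
  by case: (x =P 1) => [->//|xi]; apply: h1; lia.
by case: (x =P 0) => [->//|xi]; apply: h2; lia.
Qed.

Hypothesis z00 : {ae P, forall w, z w 0 0 = false /\ z w 0 1 = true}.

(** Queues are truncated at [n] on both sides. The pieces with [i, j < n] are disjoint with product
    probabilities, and what is left out has probability at most [tail cr er n + tail cl el n], which
    vanishes. Both sides of the claim are then limits of one sequence. *)
Lemma still_total (cr er cl el h : R) : 0 <= h -> 0 < cr < 1 -> 0 < cl < 1 ->
  (forall i j, pr P (queues_ge i j) = tail cr er i * tail cl el j) ->
  pr P (still X h) = (expR (- h + h * cr) * (1 + er * h * cr)) *
    (expR (- h + h * cl) * (1 + el * h * cl)).
Proof.
move=> h0 hcr hcl hlaw; have [hreg [N [hN hm]]] := htasep.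
have [mz mX cad] := hreg.
have mQ i j : measurable (queues_ge i j).
  by apply: queues_ge_algebra => //; exact: sigma_algebra_measurable.
have mS := still_measurable hreg h0.
pose Z := [set w | z w 0 0 = false] `&` [set w | z w 0 1 = true].
have mZ : measurable Z by exact: measurableI.
have mE i j : measurable (queues_eq i j).
  by apply: measurableI; [|apply: measurableC]; apply: measurableI => //; exact: measurableC.
pose F (p : nat * nat) := (queues_eq p.1 p.2 `&` Z) `&` still X h.
have mF p : measurable (F p).
  by apply: measurableI => //; exact: measurableI.
have prQ i j : pr P (queues_eq i j) =
    (tail cr er i - tail cr er i.+1) * (tail cl el j - tail cl el j.+1).
  have prV j' : pr P (queues_ge i j' `&` ~` queues_ge i.+1 j') =
      (tail cr er i - tail cr er i.+1) * tail cl el j'.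
    have := pr_split P (mQ i j') (mQ i.+1 j').
    have -> : queues_ge i j' `&` queues_ge i.+1 j' = queues_ge i.+1 j'.
      by apply/setIidr; exact: queues_ge_mono.
    by rewrite !hlaw => e; rewrite mulrBl e addrC addKr.
  have mV j' : measurable (queues_ge i j' `&` ~` queues_ge i.+1 j').
    by apply: measurableI => //; exact: measurableC.
  have := pr_split P (mV j) (mV j.+1).
  have -> : (queues_ge i j `&` ~` queues_ge i.+1 j) `&`
      (queues_ge i j.+1 `&` ~` queues_ge i.+1 j.+1) =
      queues_ge i j.+1 `&` ~` queues_ge i.+1 j.+1.
    apply/setIidr => w [h1 h2]; split; first by exact: queues_ge_mono h1.
    move=> [h3 _]; apply: h2; split=> //; by have [] := h1.
  by rewrite !prV => e; rewrite mulrBr e addrC addKr.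
have prF i j : pr P (F (i, j)) =
    ((tail cr er i - tail cr er i.+1) * poisson_cdf h i) *
    ((tail cl el j - tail cl el j.+1) * poisson_cdf h j).
  rewrite /F (still_prob hreg hN hm (kr := i) (kl := j)) //.
  - have -> : pr P (queues_eq i j `&` Z) = pr P (queues_eq i j).
      apply: pr_ae_eq => //; first exact: measurableI.
      by apply: filterS z00 => w [e1 e2]; split=> [[]|] //.
    by rewrite prQ; ring.
  - have hz0 x v : history 0%:E z X N 0 [set w | z w 0 x = v].
      by apply: sub_gen_smallest; constructor 1; exists 0, x, v.
    apply: (@measurableI _ (g_sigma_algebraType _)); last first.
      by apply: (@measurableI _ (g_sigma_algebraType _)); exact: hz0.
    have hQ i' j' : history 0%:E z X N 0 (queues_ge i' j').
      by apply: queues_ge_algebra => //; exact: smallest_sigma_algebra.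
    apply: (@measurableI _ (g_sigma_algebraType _));
      [|apply: (@measurableC _ (g_sigma_algebraType _))];
      apply: (@measurableI _ (g_sigma_algebraType _)); try exact: hQ;
      apply: (@measurableC _ (g_sigma_algebraType _)); exact: hQ.
  - by move=> w [hq [e1 e2]]; exact: queues_eqP.
pose al (n : nat) : R := \sum_(i < n) (tail cr er i - tail cr er i.+1) * poisson_cdf h i.
pose be (n : nat) : R := \sum_(i < n) (tail cl el i - tail cl el i.+1) * poisson_cdf h i.
pose U n := \big[setU/set0]_(p <- [seq (i1, i2) | i1 <- iota 0 n, i2 <- iota 0 n]) F p.
have mU n : measurable (U n) by apply: bigsetU_measurable.
have prU n : pr P (U n) = al n * be n.
  rewrite pr_bigU //; last 2 first.
  - by apply: allpairs_uniq; rewrite ?iota_uniq // => -[? ?] [? ?].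
  - move=> [i j] [i' j'] w _ _ [[q [e1 e2]] _] [[q' _] _].
    by have [/= -> ->] := queues_inj (queues_eqP q e1 e2) (queues_eqP q' e1 e2).
  rewrite big_allpairs /al /be big_distrl /=.
  rewrite -[in RHS](big_mkord xpredT (fun i => (tail cr er i - tail cr er i.+1) *
     poisson_cdf h i * be n)) /index_iota subn0.
  apply: eq_bigr => i _; rewrite mulr_sumr.
  rewrite -[in RHS](big_mkord xpredT (fun j => (tail cr er i - tail cr er i.+1) *
     poisson_cdf h i * ((tail cl el j - tail cl el j.+1) * poisson_cdf h j)))
     /index_iota subn0.
  by apply: eq_bigr => j _; exact: prF.
have tail0 c e : tail c e 0 = 1 :> R by rewrite /tail expr0 mul0r addr0 mulr1.
have bound n : `|pr P (still X h) - al n * be n| <= tail cr er n + tail cl el n.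
  have mQQ : measurable (queues_ge n 0 `|` queues_ge 0 n) by exact: measurableU.
  have h1 : pr P (U n) <= pr P (still X h).
    apply: pr_le => // w; rewrite /U -bigcup_seq => -[p _ [_]] //.
  have h2 : pr P (still X h) <= pr P (U n `|` (queues_ge n 0 `|` queues_ge 0 n)).
    apply: pr_le_ae => //; first exact: measurableU.
    apply: filterS z00 => w [e1 e2] hs.
    have [hn|hn] := pselect ((queues_ge n 0 `|` queues_ge 0 n) w); first by right.
    left; rewrite /U -bigcup_seq.
    have q0 : queues_ge 0 0 w by split=> x; lia.
    have [i [ilt hi hi']] := last_index (p := fun i => queues_ge i 0 w) q0
      (fun hq => hn (or_introl hq)).
    have [j [jlt hj hj']] := last_index (p := fun j => queues_ge 0 j w) q0
      (fun hq => hn (or_intror hq)).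
    have sp i' j' : queues_ge i' j' w <-> queues_ge i' 0 w /\ queues_ge 0 j' w.
      split; first by move=> hq; split; apply: queues_ge_mono hq.
      by move=> [[s1 _] [_ s2]]; split.
    exists (i, j); first by apply: allpairs_f; rewrite mem_iota.
    split=> //; split=> //; split.
      by split; [apply/sp|move=> /sp [/hi']].
    by move=> [/sp [_ /hj']].
  have := prU_le P (mU n) mQQ; have := prU_le P (mQ n 0%N) (mQ 0%N n).
  rewrite !hlaw !tail0 mul1r mulr1 -prU => h3 h4.
  by rewrite ger0_norm; lra.
have lim1 : al n * be n @[n --> \oo] --> pr P (still X h).
  apply/cvgrPdist_le => e e0.
  have lt0 : tail cr er n + tail cl el n @[n --> \oo] --> (0 : R).
    by rewrite -[X in _ --> X]addr0; apply: cvgD; exact: cvg_tail.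
  move/cvgrPdist_le: lt0 => /(_ e e0); apply: filterS => n.
  rewrite sub0r normrN => hn; apply: le_trans (bound n) _.
  exact: le_trans (ler_norm _) hn.
have lim2 : al n * be n @[n --> \oo] --> (expR (- h + h * cr) * (1 + er * h * cr)) *
    (expR (- h + h * cl) * (1 + el * h * cl)).
  by apply: cvgM; exact: cvg_poisson_cdf.
by have := cvg_unique _ lim1 lim2; apply.
Qed.

End total.

(** * The initial law *)

Section records.
Variables y1 y2 : nat -> bool.

Definition occupied (x : nat) : bool := y1 x || is_record y1 y2 x.

(** Distance of the walk below its running maximum, a walk reflected at 0; it decides which steps
    are records. *)
Definition gap (x : nat) : int := walk_max y1 y2 x - walk y1 y2 x.

Lemma walkS x : walk y1 y2 x.+1 = walk y1 y2 x + ((y2 x.+1)%:Z - (y1 x.+1)%:Z).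
Proof. by rewrite /walk big_nat_recr. Qed.

Lemma walk_maxS x : walk_max y1 y2 x.+1 = Num.max (walk_max y1 y2 x) (walk y1 y2 x.+1).
Proof.
rewrite /walk_max.
have -> : index_iota 0 x.+2 = rcons (index_iota 0 x.+1) x.+1.
  by rewrite /index_iota !subn0 -[x.+2]addn1 iotaD cats1.
elim: (index_iota 0 x.+1) => [|y s IH] /=; first by rewrite big_cons !big_nil maxC.
by rewrite !big_cons IH maxA.
Qed.

Lemma gap0 : gap 0 = 0.
Proof. by rewrite /gap /walk_max /walk /index_iota /= big_cons !big_nil maxxx. Qed.

Lemma gapS x : gap x.+1 = Num.max (gap x + (y1 x.+1)%:Z - (y2 x.+1)%:Z) 0.
Proof. by rewrite /gap walk_maxS walkS; lia. Qed.

Lemma gap_vacant s :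
  (forall x, (0 < x)%N -> (x <= s)%N -> ~~ y1 x && ~~ y2 x) -> gap s = 0.
Proof.
elim: s => [_|s IH h]; first exact: gap0.
rewrite gapS IH; last by move=> x x0 xs; apply: h => //; exact: ltnW.
by have /andP [/negbTE -> /negbTE ->] := h s.+1 isT (leqnn _).
Qed.

Lemma gap_ge0 x : 0 <= gap x.
Proof. by case: x => [|x]; rewrite ?gap0 // gapS; lia. Qed.

(** If [y1] fails the step is 0 or 1, and it produces a record exactly when it is 1 and starts from
    the maximum. *)
Lemma occupiedS x : occupied x.+1 = y1 x.+1 || (gap x == 0) && y2 x.+1.
Proof.
rewrite /occupied /is_record /= walk_maxS walkS; have := gap_ge0 x; rewrite /gap.
by case: (y1 x.+1); case: (y2 x.+1) => /=; lia.
Qed.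

(** Starting at the maximum, steps with [y2] inside the first stretch keep the gap at 0. The first
    site of the run without [y2] must have [y1] and opens a gap; steps with [y1] cannot close it, so
    records become impossible and occupation forces [y1]. The induction carries the gap at the end
    of the run, which separates the two alternatives. *)
Lemma occupied_run s k : gap s = 0 ->
  (forall x, (s < x)%N -> (x <= s + k)%N -> occupied x) <->
  (forall x, (s < x)%N -> (x <= s + k)%N -> y2 x) \/
  exists m, [/\ (s < m)%N, (m <= s + k)%N,
    (forall x, (s < x)%N -> (x < m)%N -> y2 x), y1 m && ~~ y2 m &
    forall x, (m < x)%N -> (x <= s + k)%N -> y1 x].
Proof.
move=> g0.
pose A k := forall x, (s < x)%N -> (x <= s + k)%N -> y2 x.
pose B k := exists m, [/\ (s < m)%N, (m <= s + k)%N,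
    (forall x, (s < x)%N -> (x < m)%N -> y2 x), y1 m && ~~ y2 m &
    forall x, (m < x)%N -> (x <= s + k)%N -> y1 x].
pose O k := forall x, (s < x)%N -> (x <= s + k)%N -> occupied x.
suff : (O k <-> A k \/ B k) /\ (A k -> gap (s + k) = 0) /\ (B k -> 0 < gap (s + k)).
  by case.
elim: k => [|k [IHO [IHA IHB]]].
  rewrite addn0; split; [split|split] => //.
  - by move=> _; left=> x; lia.
  - by move=> _ x; lia.
  - by move=> [m [h1 h2]]; lia.
have OS : O k.+1 = (O k /\ occupied (s + k).+1).
  apply/propext; split=> [h|[h1 h2] x x1 x2].
    by split=> [x x1 x2|]; apply: h; lia.
  have [->//|e] := eqVneq x (s + k).+1; apply: h1 => //; lia.
have AS : A k.+1 = (A k /\ y2 (s + k).+1).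
  apply/propext; split=> [h|[h1 h2] x x1 x2].
    by split=> [x x1 x2|]; apply: h; lia.
  have [->//|e] := eqVneq x (s + k).+1; apply: h1 => //; lia.
have BS : B k.+1 = ((B k /\ y1 (s + k).+1) \/
    (A k /\ y1 (s + k).+1 && ~~ y2 (s + k).+1)).
  apply/propext; split=> [[m [h1 h2 h3 h4 h5]]|[[[m [h1 h2 h3 h4 h5]] h6]|[h1 h2]]].
  - have [e|e] := eqVneq m (s + k).+1.
      right; split; last by rewrite -e.
      by move=> x x1 x2; apply: h3; lia.
    left; split; last by apply: h5; lia.
    by exists m; split=> // [|x x1 x2]; [lia|apply: h5; lia].
  - exists m; split=> // [|x x1 x2]; first by lia.
    by have [->//|e] := eqVneq x (s + k).+1; apply: h5 => //; lia.
  - exists (s + k).+1; split; [lia|lia| |exact: h2|by move=> x; lia].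
    by move=> x x1 x2; apply: h1; lia.
have notAB : A k -> B k -> False.
  by move=> /IHA e /IHB; rewrite e ltxx.
have gS := gapS (s + k); have oS := occupiedS (s + k).
rewrite OS AS BS addnS; split; [split|split].
- move=> [/IHO [hA|hB]]; rewrite oS.
    rewrite IHA // eqxx /=; case: (y2 _); first by left.
    by rewrite orbF => ->; right; right.
  by have := IHB hB; rewrite orbC => g; rewrite gt_eqF //= => ->; right; left.
- rewrite oS => -[[hA h2]|[[hB h1]|[hA /andP [h1 h2]]]].
  + by split; [apply/IHO; left|rewrite IHA // h2 orbT].
  + by split; [apply/IHO; right|rewrite h1].
  + by split; [apply/IHO; left|rewrite h1].
- by move=> [/IHA h1 h2]; rewrite gS h1 h2; case: (y1 _).
- case=> [[/IHB h1 h2]|[/IHA h1 /andP [h2 h3]]]; rewrite gS; last first.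
    by rewrite h1 h2 (negbTE h3).
  by rewrite h2; case: (y2 _); lia.
Qed.

End records.

(** * Run lengths driven by independent Bernoulli pairs *)

Section bernoulli.
Context {R : realType} {d : measure_display} {T : measurableType d}.
Variables (theta : R) (P : probability T R) (Y1 Y2 : nat -> T -> bool).
Hypothesis hY : iid_bernoulli_pair theta P Y1 Y2.

Let bp := bernoulli_pmf theta.

Definition pair_weight (C : bool -> bool -> bool) : R :=
  \sum_(p : bool * bool | C p.1 p.2) bp p.1 * bp p.2.

Definition all_in (C : nat -> bool -> bool -> bool) n : set T :=
  [set w | forall x, (0 < x)%N -> (x <= n)%N -> C x (Y1 x w) (Y2 x w)].

Lemma all_in_measurable C n : measurable (all_in C n).
Proof.
have [mY _] := hY.
have mC x : measurable [set w | C x (Y1 x w) (Y2 x w)].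
  have -> : [set w | C x (Y1 x w) (Y2 x w)] = \bigcup_(p : bool * bool)
      (if C x p.1 p.2 then [set w | Y1 x w = p.1] `&` [set w | Y2 x w = p.2] else set0).
    apply/seteqP; split=> w.
      by move=> h; exists (Y1 x w, Y2 x w) => //=; rewrite h.
    by move=> [[b1 b2] _] /=; case: ifP => // h [/= -> ->].
  apply: countable_bigcupT_measurable => // p; case: ifP => // _.
  by apply: measurableI; have [] := mY x p.1; have [] := mY x p.2.
have -> : all_in C n = \big[setI/setT]_(x <- iota 1 n) [set w | C x (Y1 x w) (Y2 x w)].
  rewrite -bigcap_seq; apply/seteqP; split=> w h.
    by move=> x /=; rewrite mem_iota => xn; apply: h; lia.
  by move=> x x0 xn; apply: h => /=; rewrite mem_iota; lia.
by apply: bigsetI_measurable.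
Qed.

(** The hypothesis prices only complete specifications of the first [n] pairs. Constraints at the
    sites [1, ..., m] are freed by induction on [m], each time summing over the admissible values of
    one pair. *)
Lemma all_in_prob C n :
  pr P (all_in C n) = \prod_(1 <= x < n.+1) pair_weight (C x).
Proof.
have [mY hP] := hY.
have step m : (m <= n)%N -> forall C,
   (forall x, (m < x)%N -> exists b1 b2, C x = (fun u v => (u == b1) && (v == b2))) ->
   pr P (all_in C n) = \prod_(1 <= x < n.+1) pair_weight (C x).
  elim: m => [_ C0 hC|m IH mn C0 hC].
    have /choice [b hb] : forall x, exists b : bool * bool, (0 < x)%N ->
        C0 x = (fun u v => (u == b.1) && (v == b.2)).
      move=> x; case: (posnP x) => [->|x0]; first by exists (true, true).
      by have [b1 [b2 e]] := hC x x0; exists (b1, b2).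
    have bigE : \big[setI/setT]_(1 <= x < n.+1)
        ([set w | Y1 x w = (b x).1] `&` [set w | Y2 x w = (b x).2]) = all_in C0 n.
      rewrite -bigcap_seq; apply/seteqP; split=> w h.
        move=> x x0 xn; rewrite hb //; have /= := h x.
        by rewrite mem_index_iota => /(_ ltac:(lia)) [-> ->]; rewrite !eqxx.
      move=> x /=; rewrite mem_index_iota => /andP [x0 xn].
      by have := h x x0 xn; rewrite hb // => /andP [/eqP ? /eqP ?].
    rewrite /pr -bigE (hP n (fun x => (b x).1) (fun x => (b x).2)) /=.
    rewrite big_nat [in RHS]big_nat; apply: eq_bigr => x /andP [x0 _].
    by rewrite hb // /pair_weight (big_pred1 (b x)).
  pose upd (p : bool * bool) x := if x == m.+1 then (fun u v => (u == p.1) && (v == p.2)) else C0 x.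
  have hupd p x : (m < x)%N -> exists b1 b2, upd p x = (fun u v => (u == b1) && (v == b2)).
    move=> mx; rewrite /upd; case: eqP => [_|e]; first by exists p.1, p.2.
    by apply: hC; lia.
  have -> : all_in C0 n = \big[setU/set0]_(p <- [seq p <- index_enum (bool * bool)%type | C0 m.+1 p.1 p.2])
      all_in (upd p) n.
    rewrite -bigcup_seq; apply/seteqP; split=> w.
      move=> h; exists (Y1 m.+1 w, Y2 m.+1 w).
        by rewrite /= mem_filter mem_index_enum andbT /=; apply: h.
      by move=> x x0 xn; rewrite /upd; case: eqP => [->|_]; rewrite ?eqxx //; exact: h.
    move=> [p /=]; rewrite mem_filter => /andP [hp _] h x x0 xn.
    have := h x x0 xn; rewrite /upd; case: eqP => [->|//].
    by move=> /andP [/eqP -> /eqP ->].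
  rewrite pr_bigU; last 3 first.
  - by rewrite filter_uniq // index_enum_uniq.
  - by move=> p; exact: all_in_measurable.
  - move=> [u v] [u' v'] w _ _ /(_ m.+1 isT mn) + /(_ m.+1 isT mn).
    by rewrite /upd eqxx /= => /andP [/eqP <- /eqP <-] /andP [/eqP <- /eqP <-].
  rewrite big_filter.
  have mi : m.+1 \in index_iota 1 n.+1 by rewrite mem_index_iota.
  rewrite (bigD1_seq m.+1) ?iota_uniq //= /pair_weight big_distrl /=.
  apply: eq_bigr => p _; rewrite (IH (ltnW mn)); last exact: hupd.
  rewrite (bigD1_seq m.+1) ?iota_uniq //=; congr (_ * _).
    by rewrite /upd eqxx /pair_weight (big_pred1 p).
  by apply: eq_bigr => x xm; rewrite /upd (negbTE xm).
(* Constraints beyond [n] do not enter the event; singletons are put there to meet the hypothesis of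
   [step]. *)
have -> : all_in C n = all_in (fun x => if (x <= n)%N then C x else
    fun u v => (u == true) && (v == true)) n.
  by apply/seteqP; split=> w h x x0 xn; have := h x x0 xn; rewrite xn.
rewrite (step n) //; last by move=> x xn; rewrite leqNgt xn; exists true, true.
by rewrite big_nat [RHS]big_nat; apply: eq_bigr => x /andP [_]; rewrite ltnS => ->.
Qed.

Lemma pair_weightE C : pair_weight C =
  (C true true)%:R * (theta * theta) + (C true false)%:R * (theta * (1 - theta)) +
  (C false true)%:R * ((1 - theta) * theta) + (C false false)%:R * ((1 - theta) * (1 - theta)).
Proof.
rewrite /pair_weight big_mkcond.
rewrite -(pair_bigA _ (fun u v => if C u v then bp u * bp v else 0)) /=.
rewrite !big_bool /= /bp /bernoulli_pmf.
by do 4 case: (C _ _); rewrite ?mul1r ?mul0r; ring.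
Qed.

(** [s = 0] describes a plain run, [s = 1] a run behind a first vacant site, as needed when the site
    next to the pair is conditioned on. *)
Definition vacant_then_run s k : set T :=
  [set w | (forall x, (0 < x)%N -> (x <= s)%N -> ~~ Y1 x w && ~~ Y2 x w) /\
    forall x, (s < x)%N -> (x <= s + k)%N -> occupied (Y1^~ w) (Y2^~ w) x].

(** Vacant steps leave the gap at 0, so the run behind them is like a run from the start. A run of
    [k] sites has either all [Y2 = 1], with weight [theta ^ k], or one of [k] places for the step
    [(1, 0)], each with weight [theta ^ k * (1 - theta)]. *)
Lemma vacant_then_run_prob s k : measurable (vacant_then_run s k) /\
  pr P (vacant_then_run s k) = ((1 - theta) ^+ 2) ^+ s * tail theta (1 - theta) k.
Proof.
pose vac u v := ~~ u && ~~ v.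
pose CA x := if (x <= s)%N then vac else fun _ v : bool => v.
pose CB m x := if (x <= s)%N then vac else if (x < m)%N then fun _ v : bool => v
  else if x == m then fun u v => u && ~~ v else fun u _ : bool => u.
have E : vacant_then_run s k = all_in CA (s + k) `|`
    \big[setU/set0]_(m <- iota s.+1 k) all_in (CB m) (s + k).
  have gap_s w : (forall x, (0 < x)%N -> (x <= s)%N -> ~~ Y1 x w && ~~ Y2 x w) ->
      gap (Y1^~ w) (Y2^~ w) s = 0.
    exact: gap_vacant.
  rewrite -bigcup_seq; apply/seteqP; split=> w.
    move=> [hv /(occupied_run k (gap_s w hv)) [hA|[m [m1 m2 h1 h2 h3]]]].
      left=> x x0 xs; rewrite /CA; case: (leqP x s) => xs'; first exact: hv.
      exact: hA.
    right; exists m; first by rewrite /= mem_iota; lia.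
    move=> x x0 xs; rewrite /CB; case: (leqP x s) => xs'; first exact: hv.
    case: (ltngtP x m) => xm; first exact: h1; last by rewrite xm.
    exact: h3.
  have hv C : (forall x, (x <= s)%N -> C x = vac) -> all_in C (s + k) w ->
      forall x, (0 < x)%N -> (x <= s)%N -> ~~ Y1 x w && ~~ Y2 x w.
    move=> hC h x x0 xs; have := h x x0; rewrite hC // => /(_ _).
    by apply; rewrite (leq_trans xs) // leq_addr.
  case=> [hA|[m /=]].
    have hv' := hv CA (fun x xs => ltac:(by rewrite /CA xs)) hA.
    split=> //; apply/(occupied_run k (gap_s w hv')); left=> x x0 xs.
    have := hA x (leq_ltn_trans (leq0n s) x0) xs; by rewrite /CA leqNgt x0.
  rewrite mem_iota => /andP [m1 m2] hB.
  have hv' := hv (CB m) (fun x xs => ltac:(by rewrite /CB xs)) hB.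
  split=> //; apply/(occupied_run k (gap_s w hv')); right; exists m.
  have hB' x : (s < x)%N -> (x <= s + k)%N -> CB m x (Y1 x w) (Y2 x w).
    by move=> x0 xs; apply: hB => //; exact: leq_ltn_trans x0.
  split=> //; try lia.
  - by move=> x x0 xm; have := hB' x x0 ltac:(lia); rewrite /CB leqNgt x0 /= xm.
  - by have := hB' m m1 ltac:(lia); rewrite /CB leqNgt m1 /= ltnn eqxx.
  - move=> x xm xs; have := hB' x ltac:(lia) xs; rewrite /CB.
    by rewrite leqNgt (ltn_trans m1 xm) /= ltnNge (ltnW xm) /= gtn_eqF.
have mU : measurable (\big[setU/set0]_(m <- iota s.+1 k) all_in (CB m) (s + k)).
  by apply: bigsetU_measurable => m _; exact: all_in_measurable.
split; first by rewrite E; apply: measurableU => //; exact: all_in_measurable.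
rewrite E prU //; last 2 first.
- exact: all_in_measurable.
- move=> w hA; rewrite -bigcup_seq => -[m /=]; rewrite mem_iota => /andP [m1 m2] hB.
  have m0 : (0 < m)%N by exact: leq_ltn_trans m1.
  have := hA m m0 ltac:(lia); have := hB m m0 ltac:(lia).
  by rewrite /CA /CB leqNgt m1 /= ltnn eqxx => /andP [_ /negbTE ->].
rewrite pr_bigU; last 3 first.
- exact: iota_uniq.
- by move=> m; exact: all_in_measurable.
- have key m m' w : m \in iota s.+1 k -> all_in (CB m) (s + k) w ->
      all_in (CB m') (s + k) w -> (m < m')%N -> False.
    rewrite mem_iota => /andP [m1 m2] h h' mm.
    have m0 : (0 < m)%N by exact: leq_ltn_trans m1.
    have := h m m0 ltac:(lia); have := h' m m0 ltac:(lia).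
    by rewrite /CB leqNgt m1 /= ltnn eqxx mm => -> /andP [].
  move=> m m' w im im' h h'; case: (ltngtP m m') => // mm.
    by case: (key _ _ _ im h h' mm).
  by case: (key _ _ _ im' h' h mm).
have prodE C f : (forall x, (x <= s)%N -> C x = vac) ->
    (forall x, (s < x)%N -> pair_weight (C x) = theta * f x) ->
    pr P (all_in C (s + k)) = ((1 - theta) ^+ 2) ^+ s *
      (theta ^+ k * \prod_(s.+1 <= x < (s + k).+1) f x).
  move=> hC hf; rewrite all_in_prob (@big_cat_nat _ _ _ s.+1) //=; last by rewrite ltnS leq_addr.
  congr (_ * _).
    rewrite big_nat (eq_bigr (fun=> (1 - theta) ^+ 2)); last first.
      by move=> x /andP [_ xs]; rewrite hC // pair_weightE /= ; ring.
    by rewrite -big_nat prodr_const_nat subn1.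
  rewrite big_nat (eq_bigr (fun x => theta * f x)); last first.
    by move=> x /andP [xs _]; exact: hf.
  rewrite -big_nat big_split /= prodr_const_nat; congr (theta ^+ _ * _); lia.
rewrite (prodE CA (fun=> 1)); last 2 first.
- by move=> x xs; rewrite /CA xs.
- by move=> x xs; rewrite /CA leqNgt xs /= pair_weightE /=; ring.
rewrite big1 // mulr1.
have -> : \sum_(m <- iota s.+1 k) pr P (all_in (CB m) (s + k)) =
    \sum_(m <- iota s.+1 k) ((1 - theta) ^+ 2) ^+ s * (theta ^+ k * (1 - theta)).
  rewrite big_seq [RHS]big_seq; apply: eq_bigr => m; rewrite mem_iota => /andP [m1 m2].
  rewrite (prodE (CB m) (fun x => if x == m then 1 - theta else 1)).
  - congr (_ * (_ * _)); rewrite (bigD1_seq m) ?iota_uniq //=.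
      by rewrite eqxx big1 ?mulr1 // => x /negbTE ->.
    by rewrite mem_index_iota; lia.
  - by move=> x xs; rewrite /CB xs.
  - move=> x xs; rewrite /CB leqNgt xs /= pair_weightE.
    by case: (ltngtP x m) => xm /=; ring.
rewrite big_const_seq count_predT size_iota iter_addr_0 -mulr_natl /tail; ring.
Qed.

End bernoulli.

Definition run_from (s k : nat) : seq (nat * bool) := [seq (x, true) | x <- iota s.+1 k].

Section psi_plus.
Context {R : realType} {d : measure_display} {T : measurableType d}.
Variables (theta : R) (P : probability T R) (a : nat -> T -> bool).
Hypothesis ha : law_Psi_plus theta P a.

Let cyl l := cylinder (fun i : nat * bool => [set w | a i.1 w = i.2]) l.

Lemma Psi_plus_run k : fine (P (cyl (run_from 0 k))) = tail theta (1 - theta) k.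
Proof.
have [d' [T' [P' [Y1 [Y2 [hY hl]]]]]] := ha.
have := vacant_then_run_prob hY 0 k; rewrite expr0 mul1r => -[_ <-].
rewrite /cyl hl; last by apply/allP => p /mapP [x]; rewrite mem_iota => /andP [h _] ->.
rewrite /pr; congr (fine (P' _)); rewrite cylinderP; apply/seteqP; split=> w.
  move=> h; split=> [x|x x0 xk]; first by lia.
  by apply: (h (x, true)); apply/mapP; exists x; rewrite // mem_iota; lia.
move=> [_ h] p /mapP [x]; rewrite mem_iota => /andP [x0 xk] -> /=.
by apply: h => //; lia.
Qed.

Lemma Psi_plus_vacant_run k :
  fine (P (cyl ((1%N, false) :: run_from 1 k))) = (1 - theta) ^+ 2 * tail theta (1 - theta) k.
Proof.
have [d' [T' [P' [Y1 [Y2 [hY hl]]]]]] := ha.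
have := vacant_then_run_prob hY 1 k; rewrite expr1 => -[_ <-].
rewrite /cyl hl; last first.
  apply/allP => p; rewrite inE => /predU1P [->//|/mapP [x]]; rewrite mem_iota.
  by move=> /andP [h _] ->; exact: ltnW.
rewrite /pr; congr (fine (P' _)); rewrite cylinderP; apply/seteqP; split=> w.
  move=> h; split=> [x x0 x1|x x0 xk]; last first.
    by apply: (h (x, true)); rewrite inE orbC map_f // mem_iota; lia.
  have -> : x = 1%N by lia.
  have := h (1%N, false); rewrite inE eqxx => /(_ isT) /=.
  (* As [gap 0 = 0], the first site is vacant only if [Y1 = Y2 = 0]. *)
  have := @occupiedS (Y1^~ w) (Y2^~ w) 0; rewrite /occupied gap0 eqxx /= => ->.
  by case: (Y1 1%N w); case: (Y2 1%N w).
move=> [h1 h2] p; rewrite inE => /predU1P [->|/mapP [x]] /=.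
  have := @occupiedS (Y1^~ w) (Y2^~ w) 0; rewrite /occupied gap0 eqxx /= => ->.
  by have /andP [/negbTE -> /negbTE ->] := h1 1%N isT isT.
rewrite mem_iota => /andP [x0 xk] -> /=.
by apply: h2 => //; lia.
Qed.

End psi_plus.

(** * Jumps through countably many coordinates *)

Lemma ae_countable (R : realType) d (T : measurableType d) (P : probability T R)
    (I : countType) (Q : I -> T -> Prop) :
  (forall i, {ae P, forall w, Q i w}) -> {ae P, forall w, forall i, Q i w}.
Proof.
move=> h; pose Q' n w := if @unpickle I n is Some i then Q i w else True.
have h' n : {ae P, forall w, Q' n w}.
  rewrite /Q'; case: (unpickle n) => [i|]; first exact: h.
  by apply: filterE.
have : {ae P, forall w, forall n, Q' n w} by apply/ae_foralln.
apply: filterS => w hw i; have := hw (pickle i).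
by rewrite /Q' pickleK.
Qed.

Section jumps.
Variable R : realType.

Definition path_index : Type := (R * int * bool) + (R * int).

(* Coordinates [(X t, eta t y, eta t (y + 1))] of the fixed frame. *)
Definition bond_state : Type := (int * bool * bool)%type.

Definition in_state (t : R) (y : int) (u : bond_state) : set (set path_index) :=
  [set s | [/\ s (inr (t, u.1.1)), s (inl (t, y - u.1.1, u.1.2)) &
               s (inl (t, y + 1 - u.1.1, u.2))]].

(** A jump from [u] to [v] seen at rational times only, hence an event of the coordinate
    sigma-algebra. On a cadlag path it forces such a jump in [(q, r]], and every jump leaves this
    trace on small enough intervals. *)
Definition jump_set (q r : rat) (y : int) (u v : bond_state) : set (set path_index) :=
  [set s | [/\ in_state (ratr q) y u s, in_state (ratr r) y v s &
    forall p : rat, q < p -> p < r ->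
      in_state (ratr p) y u s \/ in_state (ratr p) y v s]].

Definition lawful (u v : bond_state) : bool :=
  (`|v.1.1 - u.1.1| <= 1) && ((u.1.2 && ~~ v.1.2) == (~~ u.2 && v.2)).

Definition lawful_at (z : R -> int -> bool) (X : R -> int) (t : R) : Prop :=
  exchange_rule (uncentred z X) t /\ forall k, left_val X t k -> `|X t - k| <= 1.

Definition path_of (z : R -> int -> bool) (X : R -> int) : set path_index :=
  [set i | match i with inl (t, x, v) => z t x = v | inr (t, k) => X t = k end].

Definition state (z : R -> int -> bool) (X : R -> int) (y : int) (t : R) : bond_state :=
  (X t, uncentred z X t y, uncentred z X t (y + 1)).

Lemma in_stateP z X t y u : in_state t y u (path_of z X) <-> state z X y t = u.
Proof.
case: u => [[k b1] b2]; rewrite /in_state /path_of /state /uncentred /=; split.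
  by move=> [-> <- <-].
by move=> [-> <- <-].
Qed.

(** Without a jump from [u] to [v] the path would stay at [u]: at a time with left limit [u] its
    value is that of rational times just after (or of [r]), hence [u] or [v]. *)
Lemma cadlag_jump (V : Type) (f : R -> V) (q r : rat) u v :
  cadlag f -> u <> v -> q < r -> f (ratr q) = u -> f (ratr r) = v ->
  (forall p : rat, q < p -> p < r -> f (ratr p) = u \/ f (ratr p) = v) ->
  exists t, [/\ ratr q < t, t <= ratr r, left_val f t u & f t = v].
Proof.
move=> cf uv qr fq fr huv; apply: contrapT => hno; apply: uv.
have qr' : ratr q <= ratr r :> R by rewrite ler_rat ltW.
rewrite -fr -fq; apply/esym.
apply: (cadlag_const cf (a := ratr q) (b := ratr r)) => // t qt tr; rewrite fq => lt.
have ftv : f t = u \/ f t = v.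
  move: tr; rewrite le_eqVlt => /predU1P [->|tr]; first by right.
  have [/near_rightP [b tb hb] _] := cf t.
  have [p] := @rat_in_itvoo R t (Num.min b (ratr r)) ltac:(by rewrite lt_min tb tr).
  rewrite in_itv /= lt_min => /and3P [p1 p2 p3].
  rewrite -(hb _ p1 p2); apply: huv; rewrite -(ltr_rat R) //.
  exact: lt_trans p1.
by case: ftv => // ft; exfalso; apply: hno; exists t.
Qed.

Lemma cadlag_pair (U V : Type) (f : R -> U) (g : R -> V) :
  cadlag f -> cadlag g -> cadlag (fun t => (f t, g t)).
Proof.
move=> cf cg t; have [hf [u hu]] := cf t; have [hg [v hv]] := cg t; split.
  by apply: filterS2 hf hg => s -> ->.
by exists (u, v); apply: filterS2 hu hv => s -> ->.
Qed.

Section path.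
Variables (z : R -> int -> bool) (X : R -> int).
Hypothesis cz : forall x, cadlag (z^~ x).
Hypothesis cX : cadlag X.

Lemma state_cadlag y : cadlag (state z X y).
Proof.
by apply: cadlag_pair; [apply: cadlag_pair => //|]; exact: uncentred_cadlag.
Qed.

Lemma state_left_val y t k b1 b2 : left_val (state z X y) t (k, b1, b2) <->
  [/\ left_val X t k, left_val ((uncentred z X)^~ y) t b1 &
      left_val ((uncentred z X)^~ (y + 1)) t b2].
Proof.
split; last first.
  move=> [h1 h2 h3].
  have h4 : left_val (fun s => (X s, uncentred z X s y)) t (k, b1).
    exact: (left_val_comp2 (@pair _ _) h1 h2).
  exact: (left_val_comp2 (@pair _ _) h4 h3).
by move=> h; split; apply: filterS h => s; rewrite /state => -[].
Qed.

Lemma lawful_no_jump (q r : rat) y u v : q < r -> ~~ lawful u v ->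
  (forall t, ratr q < t -> t <= ratr r -> lawful_at z X t) ->
  ~ jump_set q r y u v (path_of z X).
Proof.
move=> qr nl hl [/in_stateP hq /in_stateP hr hp].
have uv : u <> v.
  move=> uv; move: nl; rewrite -uv /lawful subrr normr0 /=.
  by case: (u.1.2); case: (u.2).
have [t [qt tr lt ft]] := cadlag_jump (@state_cadlag y) uv qr hq hr
  (fun p qp pr => match hp p qp pr with
    or_introl h => or_introl ((in_stateP _ _ _ _ _).1 h)
  | or_intror h => or_intror ((in_stateP _ _ _ _ _).1 h) end).
move: nl; have [hex hX] := hl t qt tr.
case: u lt {uv hq hp} => [[k b1] b2] /state_left_val [l1 l2 l3].
rewrite -ft /lawful /state /= hX //= => /negP; apply; apply/eqP.
exact: hex.
Qed.

(** The jump at [t] is framed by rationals so close that the state is constant on either side. There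
    are countably many frames, which makes an almost sure statement over all times possible. *)
Lemma jump_of_not_lawful t a b : a < t -> t < b -> ~ lawful_at z X t ->
  exists q r y u v, [/\ a < ratr q, ratr r < b, q < r, ~~ lawful u v &
    jump_set q r y u v (path_of z X)].
Proof.
move=> at_ tb nl.
have [y [k [b1 [b2 [l1 l2 l3 nlaw]]]]] : exists y k b1 b2,
    [/\ left_val X t k, left_val ((uncentred z X)^~ y) t b1,
     left_val ((uncentred z X)^~ (y + 1)) t b2 &
     ~~ lawful (k, b1, b2) (state z X y t)].
  apply: contrapT => hno; apply: nl.
  have [_ [k lk]] := cX t.
  have hl y b1 b2 : left_val ((uncentred z X)^~ y) t b1 ->
      left_val ((uncentred z X)^~ (y + 1)) t b2 -> lawful (k, b1, b2) (state z X y t).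
    by move=> l1 l2; apply/negPn/negP => h; apply: hno; exists y, k, b1, b2.
  split=> [y b1 b2 l1 l2|k' lk'].
    by have := hl y b1 b2 l1 l2; rewrite /lawful /= => /andP [_ /eqP].
  have [_ [b1 l1]] := @uncentred_cadlag _ z X 0 cz cX t.
  have [_ [b2 l2]] := @uncentred_cadlag _ z X (0 + 1) cz cX t.
  by have := hl 0 b1 b2 l1 l2; rewrite /lawful /= (left_val_inj lk' lk) => /andP [].
have /state_left_val /near_leftP [a' a't ha'] : [/\ left_val X t k,
  left_val ((uncentred z X)^~ y) t b1 & left_val ((uncentred z X)^~ (y + 1)) t b2] by [].
have [/near_rightP [b' tb' hb'] _] := @state_cadlag y t.
have [q] := @rat_in_itvoo R (Num.max a a') t ltac:(by rewrite gt_max at_ a't).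
rewrite in_itv /= gt_max => /andP [/andP [q1 q2] q3].
have [r] := @rat_in_itvoo R t (Num.min b b') ltac:(by rewrite lt_min tb tb').
rewrite in_itv /= lt_min => /and3P [r1 r2 r3].
exists q, r, y, (k, b1, b2), (state z X y t); split=> //.
  by rewrite -(ltr_rat R); exact: lt_trans r1.
split; first by apply/in_stateP; exact: ha'.
  by apply/in_stateP; exact: hb'.
move=> p; rewrite -!(ltr_rat R) => qp pr.
case: (ltgtP (ratr p) t) => pt.
- by left; apply/in_stateP; apply: ha' => //; exact: lt_trans qp.
- by right; apply/in_stateP; apply: hb' => //; exact: lt_trans r3.
- by right; apply/in_stateP; rewrite pt.
Qed.

End path.

Lemma in_state_measurable (J : pred path_index) t y u :
  (forall i : path_index, pair_time i = t -> J i) -> <<s coordinates J >> (in_state t y u).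
Proof.
move=> hJ.
have -> : in_state t y u = [set s | s (inr (t, u.1.1))] `&`
    ([set s | s (inl (t, y - u.1.1, u.1.2))] `&` [set s | s (inl (t, y + 1 - u.1.1, u.2))]).
  by apply/seteqP; split=> s [h1]; [move=> h2 h3|move=> [h2 h3]].
have hc i : pair_time i = t -> <<s coordinates J >> [set s | s i].
  by move=> e; apply: sub_gen_smallest; exists i => //; exact: hJ.
by apply: (@measurableI _ (g_sigma_algebraType (coordinates J)));
  [|apply: (@measurableI _ (g_sigma_algebraType (coordinates J)))]; exact: hc.
Qed.

Lemma jump_set_measurable (J : pred path_index) q r y u v : q < r ->
  (forall i : path_index, ratr q <= pair_time i -> pair_time i <= ratr r -> J i) ->
  <<s coordinates J >> (jump_set q r y u v).
Proof.
move=> qr hJ.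
have -> : jump_set q r y u v = in_state (ratr q) y u `&` in_state (ratr r) y v `&`
  \bigcap_(p : rat) (if (q < p) && (p < r) then in_state (ratr p) y u `|` in_state (ratr p) y v
    else setT).
  apply/seteqP; split=> s.
    move=> [h1 h2 h3]; split=> // p _; case: ifP => // /andP [qp pr].
    exact: h3.
  move=> [[h1 h2] h3]; split=> // p qp pr; have := h3 p I.
  by rewrite qp pr.
have mS t w : ratr q <= t -> t <= ratr r -> <<s coordinates J >> (in_state t y w).
  by move=> h1 h2; apply: in_state_measurable => i e; apply: hJ; rewrite e.
apply: (@measurableI _ (g_sigma_algebraType (coordinates J))).
  by apply: (@measurableI _ (g_sigma_algebraType (coordinates J))); apply: mS;
    rewrite // ler_rat ltW.
apply: (@countable_bigcapT_measurable _ (g_sigma_algebraType (coordinates J))) => // p.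
case: ifP => [/andP [qp pr]|_]; last exact: (@measurableT _ (g_sigma_algebraType (coordinates J))).
by apply: (@measurableU _ (g_sigma_algebraType (coordinates J))); apply: mS;
  rewrite ler_rat ltW.
Qed.

End jumps.

(** * Left limits at time 0 *)

Section left_limits.
Context {R : realType} {d : measure_display} {T : measurableType d}.
Variable P : probability T R.

(** Left limits at 0 are read along this sequence, which makes them measurable with respect to
    strictly negative times. *)
Definition before0 (n : nat) : R := - n.+1%:R^-1.

Lemma before0_lt0 n : before0 n < 0.
Proof. by rewrite oppr_lt0 invr_gt0. Qed.

Lemma left_val_before0 (V : Type) (f : R -> V) v : left_val f 0 v ->
  \forall n \near \oo, f (before0 n) = v.
Proof.
move=> /near_leftP [a a0 ha].
have a0' : 0 < - a by rewrite oppr_gt0.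
have := near_infty_natSinv_lt (PosNum a0'); apply: filterS => n /= hn.
by apply: ha; [rewrite /before0 ltrNr|exact: before0_lt0].
Qed.

Lemma left_val_trueP (g : R -> bool) : (exists b, left_val g 0 b) ->
  left_val g 0 true <-> exists N, forall n, (N <= n)%N -> g (before0 n).
Proof.
move=> [b hb]; split=> [h|[N hN]].
  by have [N _ hN] := left_val_before0 h; exists N.
case: b hb => // hb; have [N' _ hN'] := left_val_before0 hb.
have h1 : g (before0 (maxn N N')) by apply: hN; exact: leq_maxl.
have h2 : g (before0 (maxn N N')) = false by apply: hN'; exact: leq_maxr.
by rewrite h2 in h1.
Qed.

Lemma left_limit_measurable (g : T -> R -> bool) :
  (forall w, exists b, left_val (g w) 0 b) ->
  (forall t, t < 0 -> measurable [set w | g w t]) ->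
  measurable [set w | left_val (g w) 0 true].
Proof.
move=> hl mg.
have -> : [set w | left_val (g w) 0 true] =
    \bigcup_N \bigcap_(n in [set n | (N <= n)%N]) [set w | g w (before0 n)].
  apply/seteqP; split=> w /=; first by move=> /(left_val_trueP (hl w)) [N hN]; exists N.
  by move=> [N _ hN]; apply/(left_val_trueP (hl w)); exists N.
apply: bigcup_measurable => N _; apply: bigcap_measurableType => n _.
by apply: mg; exact: before0_lt0.
Qed.

Lemma left_limit_pr (g : T -> R -> bool) :
  (forall w, exists b, left_val (g w) 0 b) ->
  (forall t, t < 0 -> measurable [set w | g w t]) ->
  pr P [set w | g w (before0 n)] @[n --> \oo] --> pr P [set w | left_val (g w) 0 true].
Proof.
move=> hl mg; apply: pr_cvg.
- by move=> n; apply: mg; exact: before0_lt0.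
- exact: left_limit_measurable.
- by move=> w /= hw; exact: left_val_before0 hw.
- move=> w hw; have [[|] hb] := hl w => //.
  by apply: filterS (left_val_before0 hb) => n /= ->.
Qed.

End left_limits.

(** A pair [(n, b)] refers to site [n] of a half-line of the configuration with a second-class
    particle. On the right this site becomes [n + 1] once that particle is expanded; on the left [b]
    tells whether [- n] is a hole, matching the law with parameter [1 - rho]. *)
Definition check (c : int -> bool) (l1 l2 : seq (nat * bool)) : bool :=
  all (fun p => c (p.1%:Z + 1) == p.2) l1 && all (fun p => c (- p.1%:Z) == ~~ p.2) l2.

Lemma check_cat c l1 l1' l2 l2' :
  check c (l1 ++ l1') (l2 ++ l2') = check c l1 l2 && check c l1' l2'.
Proof. by rewrite /check !all_cat andbACA. Qed.

Section processes.
Variable R : realType.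

Lemma all_left_val (I : Type) (f : R -> I -> bool) (c : I -> bool) (s : seq I) t :
  (forall i, left_val (f^~ i) t (c i)) -> left_val (fun u => all (f u) s) t (all c s).
Proof.
move=> h; elim: s => [|i s IH] /=; first exact: filterE.
exact: (left_val_comp2 andb (h i) IH).
Qed.

Lemma check_left_val (z : R -> int -> bool) c l1 l2 t :
  (forall x, left_val (z^~ x) t (c x)) ->
  left_val (fun u => check (z u) l1 l2) t (check c l1 l2).
Proof.
move=> h; apply: (left_val_comp2 andb); apply: all_left_val => p.
  by apply: filterS (h (p.1%:Z + 1)) => u ->.
by apply: filterS (h (- p.1%:Z)) => u ->.
Qed.

Lemma cadlag_left_vals (V : Type) (z : R -> int -> V) t :
  (forall x, cadlag (z^~ x)) -> exists c, forall x, left_val (z^~ x) t (c x).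
Proof.
move=> cz; have /choice [c hc] : forall x, exists v, left_val (z^~ x) t v.
  by move=> x; have [] := cz x t.
by exists c.
Qed.

Section path_measure.
Context {d : measure_display} {T : measurableType d}.
Variables (z : T -> R -> int -> bool) (X : T -> R -> int).
Hypothesis hreg : regular_process z X.

Lemma path_event i : [set w | path_of (z w) (X w) i] = pair_event z X i.
Proof. by case: i => [[[t x] v]|[t k]]. Qed.

Lemma path_measurable i : measurable [set w | path_of (z w) (X w) i].
Proof.
have [mz mX _] := hreg; rewrite path_event.
by case: i => [[[t x] v]|[t k]]; [exact: mz|exact: mX].
Qed.

Lemma path_cylinder l :
  cylinder (fun i => [set w | path_of (z w) (X w) i]) l = cylinder (pair_event z X) l.
Proof. by apply: eq_bigr => i _; exact: path_event. Qed.

Lemma check_cylinder t l1 l2 : [set w | check (z w t) l1 l2] =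
  cylinder (pair_event z X) ([seq inl (t, p.1%:Z + 1, p.2) | p <- l1] ++
    [seq inl (t, - p.1%:Z, ~~ p.2) | p <- l2]).
Proof.
rewrite cylinder_cat !cylinderP; apply/seteqP; split=> w.
  move=> /andP [/allP h1 /allP h2]; split=> i /mapP [p hp ->] /=.
    by apply/eqP; exact: h1.
  by apply/eqP; exact: h2.
move=> [h1 h2]; apply/andP; split; apply/allP => p hp; apply/eqP.
  by apply: (h1 (inl (t, p.1%:Z + 1, p.2))); apply/mapP; exists p.
by apply: (h2 (inl (t, - p.1%:Z, ~~ p.2))); apply/mapP; exists p.
Qed.

Lemma check_measurable t l1 l2 : measurable [set w | check (z w t) l1 l2].
Proof.
rewrite check_cylinder -path_cylinder; apply: measurable_cylinder => i _.
exact: path_measurable.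
Qed.

Lemma check_left_limit l1 l2 w :
  exists b, left_val (fun t => check (z w t) l1 l2) 0 b.
Proof.
have [_ _ cad] := hreg; have [cz _] := cad w.
have [c hc] := cadlag_left_vals 0 cz.
by exists (check c l1 l2); exact: check_left_val.
Qed.

Lemma check_limit_measurable l1 l2 :
  measurable [set w | left_val (fun t => check (z w t) l1 l2) 0 true].
Proof.
apply: (@left_limit_measurable R _ _ (fun w t => check (z w t) l1 l2)).
  by move=> w; exact: check_left_limit.
by move=> t _; exact: check_measurable.
Qed.

End path_measure.

Lemma expand_regular d (T : measurableType d) (z : T -> R -> int -> option bool)
    (X : T -> R -> int) :
  regular_process z X -> regular_process (fun w t => Defs.expand (z w t)) X.
Proof.
move=> [mz mX cad]; split=> //.
  move=> t x v; rewrite /Defs.expand.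
  have mb y : measurable [set w | (z w t y == Some true) = v].
    case: v.
      have -> : [set w | (z w t y == Some true) = true] = [set w | z w t y = Some true].
        by apply/seteqP; split=> w /= /eqP.
      exact: mz.
    have -> : [set w | (z w t y == Some true) = false] = ~` [set w | z w t y = Some true].
      by apply/seteqP; split=> w /=; [move=> /eqP|move=> h; apply/eqP].
    by apply: measurableC; exact: mz.
  have mc b : measurable [set w : T | b = v].
    have [->|bv] := pselect (b = v); first by rewrite (_ : mkset _ = setT) //; apply/seteqP; split.
    by rewrite (_ : mkset _ = set0) //; apply/seteqP; split.
  by case: (ltP x 0) => _ //; case: (x =P 0) => _ //; case: (x =P 1) => _.
move=> w; have [cz cX] := cad w; split=> // x.
exact: expand_cadlag.
Qed.

Lemma Psi_rho_check d (T : measurableType d) (P : probability T R)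
    (c : T -> int -> option bool) rho l1 l2 v1 v2 :
  law_Psi_rho rho P c ->
  all (fun p => (1 <= p.1)%N) l1 -> all (fun p => (1 <= p.1)%N) l2 ->
  (forall a, law_Psi_plus rho P a ->
    fine (P (cylinder (fun i : nat * bool => [set w | a i.1 w = i.2]) l1)) = v1) ->
  (forall a, law_Psi_plus (1 - rho) P a ->
    fine (P (cylinder (fun i : nat * bool => [set w | a i.1 w = i.2]) l2)) = v2) ->
  pr P [set w | check (Defs.expand (c w)) l1 l2] = v1 * v2.
Proof.
move=> [mc cN hr hl hind] hl1 hl2 hv1 hv2.
have mb x (o : option bool) (b : bool) : measurable [set w | (c w x == o) = b].
  case: b.
    rewrite (_ : mkset _ = [set w | c w x = o]) //.
    by apply/seteqP; split=> w /= /eqP.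
  rewrite (_ : mkset _ = ~` [set w | c w x = o]); first exact: measurableC.
  by apply/seteqP; split=> w /=; [move=> /eqP|move=> h; apply/eqP].
have := hind l1 l2 hl1 hl2; have := hv1 _ hr; have := hv2 _ hl; rewrite /=.
set A := cylinder _ l1; set B := cylinder _ l2 => eB eA eAB.
have mA : measurable A by apply: measurable_cylinder => p _; exact: mb.
have mB : measurable B by apply: measurable_cylinder => p _; exact: mb.
have -> : [set w | check (Defs.expand (c w)) l1 l2] = A `&` B.
  have e1 w n : (1 <= n)%N -> Defs.expand (c w) (n%:Z + 1) = (c w n%:Z == Some true).
    by move=> n1; rewrite /Defs.expand !ifF ?addrK //; lia.
  have e2 w n : (1 <= n)%N -> Defs.expand (c w) (- n%:Z) = ~~ (c w (- n%:Z) == Some false).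
    move=> n1; rewrite /Defs.expand ifT; last by lia.
    have : c w (- n%:Z) <> None by move=> /cN; lia.
    by case: (c w _) => [[]|].
  rewrite /A /B !cylinderP; apply/seteqP; split=> w.
    move=> /andP [/allP h1 /allP h2]; split=> p hp /=.
      by have /eqP := h1 p hp; rewrite e1 //; exact: (allP hl1).
    have /eqP := h2 p hp; rewrite e2 ?(allP hl2) //.
    by move=> /(congr1 negb); rewrite !negbK.
  move=> [h1 h2]; apply/andP; split; apply/allP => p hp.
    by rewrite e1 ?(allP hl1) //; apply/eqP; exact: h1.
  by rewrite e2 ?(allP hl2) //; apply/eqP; congr negb; exact: h2.
by rewrite /pr eAB fineM ?fin_num_measure // eA eB.
Qed.

Lemma left_val_ext (f g : R -> bool) t b : left_val f t b -> (forall u, f u = g u) ->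
  left_val g t b.
Proof. by move=> h e; apply: filterS h => u <-. Qed.

(** * Conditioning the past on the jump at time 0 *)

Section psi_jump.
Context {d : measure_display} {T : measurableType d}.
Variables (site : int) (v : bool) (jump : (int -> bool) -> int -> bool) (delta : int).
Variables (rho : R) (P : probability T R) (z : T -> R -> int -> bool) (X : T -> R -> int).
Hypothesis hjump : law_Psi_jump site v jump delta rho P z X.
Variables (e1 e2 : seq (nat * bool)).
Hypothesis he : forall c, (c site == v) = check c e1 e2.

(** Quantified over every realization of the initial law, so that stationarity can be used at each
    time before 0. *)
Definition psi_value l1 l2 x := forall d' (T' : measurableType d') (P' : probability T' R) c,
  law_Psi_rho rho P' c -> pr P' [set w | check (Defs.expand (c w)) l1 l2] = x.

Let past : pred (path_index R) := fun i => pair_time i < 0.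

(** By stationarity a pattern has the same probability at all times [before0 n], and this constant
    is also its probability for the left limit at 0. The conditional law of the past, given on
    cylinders, then extends to all past events as the star law restricted to [E] and divided by
    [u]. *)
Lemma psi_jump_past u : psi_value e1 e2 u ->
  exists d' (T' : measurableType d') (P' : probability T' R) zs Xs,
  stationary_star rho P' zs Xs /\
  let z' w t := Defs.expand (zs w t) in
  let E := [set w | left_val (fun t => check (z' w t) e1 e2) 0 true] in
  [/\ pr P' E = u,
    forall S, <<s coordinates past >> S ->
      pr P [set w | S (path_of (z w) (X w))] =
      u^-1 * pr P' ([set w | S (path_of (z' w) (Xs w))] `&` E) &
    forall l1 l2 x, psi_value (l1 ++ e1) (l2 ++ e2) x ->
      pr P' ([set w | left_val (fun t => check (z' w t) l1 l2) 0 true] `&` E) = x].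
Proof.
move=> hu; have [[d' [T' [P' [zs [Xs [hst hcond]]]]]] [_ hta]] := hjump.
exists d', T', P', zs, Xs; split=> // z' E.
have [[hregs _] hlaw _] := hst.
have hreg' : regular_process z' Xs by exact: expand_regular.
have [hreg _] := hta.
have mE : measurable E by exact: (check_limit_measurable hreg').
have lim l1 l2 x : psi_value l1 l2 x ->
    pr P' [set w | left_val (fun t => check (z' w t) l1 l2) 0 true] = x.
  move=> hx; have := @left_limit_pr R _ _ P' (fun w t => check (z' w t) l1 l2).
  move=> /(_ (check_left_limit hreg' l1 l2)) h.
  have {h} := h (fun t _ => check_measurable hreg' t l1 l2).
  have -> : (fun n => pr P' [set w | check (z' w (before0 n)) l1 l2]) = fun=> x.
    by apply/funext => n; exact: (hx _ _ _ _ (hlaw _)).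
  move=> h; have := cvg_unique _ h (cvg_cst x); exact.
have prEu : pr P' E = u by exact: lim.
split=> //.
  move=> S hS; have PE : fine (P' E) = u by [].
  have EE : E = [set w | left_val (fun t => z' w t site) 0 v].
    have [_ _ cad] := hreg'.
    apply/seteqP; split=> w /= h; have [cz _] := cad w;
      have [c hc] := cadlag_left_vals 0 cz.
      have := left_val_inj (check_left_val e1 e2 hc) h.
      by rewrite -he => /eqP <-; exact: hc.
    have := left_val_inj (hc site) h => hcs.
    have := check_left_val e1 e2 hc; by rewrite -he hcs eqxx.
  (* [P'] restricted to [E] with weight [u^-1]; the second term gets weight 0. *)
  have := @transfer R (path_index R) past _ _ P _ _ (mrestr P' mE) _ _ (mrestr P' mE)
    (fun w => path_of (z w) (X w)) (fun w => path_of (z' w) (Xs w))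
    (fun w => path_of (z' w) (Xs w)) u^-1 0.
  have u0 : 0 <= u^-1 by rewrite invr_ge0 -prEu pr_ge0.
  have finP : (P setT < +oo)%E by rewrite probability_setT ltry.
  move=> /(_ finP u0 (lexx _)).
  move=> /(_ (fun i _ => path_measurable hreg i)).
  move=> /(_ (fun i _ => path_measurable hreg' i)).
  move=> /(_ (fun i _ => path_measurable hreg' i)).
  have mS' := measurable_path (fun i _ => path_measurable hreg' i) hS.
  have mS := measurable_path (fun i _ => path_measurable hreg i) hS.
  have heq l : all past l ->
      P (cylinder (fun i => [set w | path_of (z w) (X w) i]) l) =
      (u^-1%:E * mrestr P' mE (cylinder (fun i => [set w | path_of (z' w) (Xs w) i]) l)
       + 0%:E * mrestr P' mE (cylinder (fun i => [set w | path_of (z' w) (Xs w) i]) l))%E.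
    move=> hl; rewrite mul0e adde0 !path_cylinder hcond // /conditional -EE PE /mrestr.
    rewrite (@prE _ _ _ P' (_ `&` E)); first by rewrite -EFinM mulrC.
    apply: measurableI => //; rewrite -path_cylinder; apply: measurable_cylinder => i _.
    exact: path_measurable.
  move=> /(_ heq S hS); rewrite mul0e adde0 /mrestr => e.
  apply: EFin_inj; rewrite EFinM -(prE P mS) -(prE P' (measurableI _ _ mS' mE)).
  exact: e.
move=> l1 l2 x hx.
rewrite -(lim _ _ _ hx); congr pr; apply/seteqP; split=> w.
  move=> [h1 h2]; apply: (left_val_ext (left_val_comp2 andb h1 h2)) => t.
  by rewrite -check_cat.
move=> h; have [cl hl] := check_left_limit hreg' l1 l2 w.
have [ce hce] := check_left_limit hreg' e1 e2 w.
have hce' := left_val_ext (left_val_comp2 andb hl hce)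
  (fun t => esym (check_cat (z' w t) l1 e1 l2 e2)).
have /esym/andP [hc1 hc2] := left_val_inj h hce'.
by split=> /=; [rewrite hc1 in hl|rewrite hc2 in hce].
Qed.

End psi_jump.

End processes.

Section coordinate_sets.
Variable R : realType.

Lemma coordinate_set (J : pred (path_index R)) i : J i ->
  <<s coordinates J >> [set s | s i].
Proof. by move=> Ji; apply: sub_gen_smallest; exists i. Qed.

Definition check_at (t : R) (l1 l2 : seq (nat * bool)) : set (set (path_index R)) :=
  cylinder (fun i s => s i) ([seq inl (t, p.1%:Z + 1, p.2) | p <- l1] ++
    [seq inl (t, - p.1%:Z, ~~ p.2) | p <- l2]).

Lemma check_atP z X t l1 l2 : check_at t l1 l2 (path_of z X) <-> check (z t) l1 l2.
Proof.
rewrite /check_at cylinder_cat !cylinderP; split.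
  move=> [h1 h2]; apply/andP; split; apply/allP => p hp; apply/eqP.
    by apply: (h1 (inl (t, p.1%:Z + 1, p.2))); apply/mapP; exists p.
  by apply: (h2 (inl (t, - p.1%:Z, ~~ p.2))); apply/mapP; exists p.
move=> /andP [/allP h1 /allP h2]; split=> i /mapP [p hp ->] /=.
  by apply/eqP; exact: h1.
by apply/eqP; exact: h2.
Qed.

Lemma check_at_measurable (J : pred (path_index R)) t l1 l2 :
  (forall i : path_index R, pair_time i = t -> J i) ->
  <<s coordinates J >> (check_at t l1 l2).
Proof.
move=> hJ; apply: (@measurable_cylinder _ _ (g_sigma_algebraType (coordinates J))) => i.
by rewrite mem_cat => /orP [] /mapP [p _ ->]; apply: coordinate_set; exact: hJ.
Qed.

Definition check_limit (l1 l2 : seq (nat * bool)) : set (set (path_index R)) :=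
  \bigcup_N \bigcap_(n in [set n | (N <= n)%N]) check_at (before0 n) l1 l2.

Lemma check_limitP z X l1 l2 : (forall x, cadlag (z^~ x)) ->
  check_limit l1 l2 (path_of z X) <-> left_val (fun t => check (z t) l1 l2) 0 true.
Proof.
move=> cz; have [c hc] := cadlag_left_vals 0 cz.
rewrite left_val_trueP; last by exists (check c l1 l2); exact: check_left_val.
split=> [[N _ hN]|[N hN]].
  by exists N => n Nn; apply/(check_atP _ X); exact: hN.
by exists N => // n Nn; apply/check_atP; exact: hN.
Qed.

Lemma check_limit_in_algebra (J : pred (path_index R)) l1 l2 :
  (forall i : path_index R, pair_time i < 0 -> J i) ->
  <<s coordinates J >> (check_limit l1 l2).
Proof.
move=> hJ; apply: (@bigcup_measurable _ (g_sigma_algebraType (coordinates J))) => N _.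
apply: (@bigcap_measurableType _ (g_sigma_algebraType (coordinates J))) => n _.
by apply: check_at_measurable => i ei; apply: hJ; rewrite ei before0_lt0.
Qed.

End coordinate_sets.

Section psi_jump.
Context {R : realType} {d : measure_display} {T : measurableType d}.
Variables (site : int) (v : bool) (jump : (int -> bool) -> int -> bool) (delta : int).
Variables (rho : R) (P : probability T R) (z : T -> R -> int -> bool) (X : T -> R -> int).
Hypothesis hjump : law_Psi_jump site v jump delta rho P z X.
Variables (e1 e2 : seq (nat * bool)).
Hypothesis he : forall c, (c site == v) = check c e1 e2.
Variable u : R.
Hypothesis hu : psi_value rho e1 e2 u.
Hypothesis u0 : u != 0.

Lemma psi_jump_limit l1 l2 x : psi_value rho (l1 ++ e1) (l2 ++ e2) x ->
  pr P [set w | left_val (fun t => check (z w t) l1 l2) 0 true] = x / u.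
Proof.
move=> hx; have [d' [T' [P' [zs [Xs [hst [hE hS hl]]]]]]] := psi_jump_past hjump he hu.
have [_ [_ [[_ _ cad] _]]] := hjump.
have [[[_ _ cad'] _] _ _] := hst.
have limE (U : Type) (y : U -> R -> int -> bool) (Y : U -> R -> int) :
    (forall w x, cadlag ((y w)^~ x)) ->
    [set w | left_val (fun t => check (y w t) l1 l2) 0 true] =
    [set w | check_limit l1 l2 (path_of (y w) (Y w))].
  move=> cy; apply/funext => w; apply/propext; apply: iff_sym.
  exact: (@check_limitP R (y w) (Y w) l1 l2 (cy w)).
rewrite (limE _ z X); last by move=> w; have [] := cad w.
rewrite hS; last exact: check_limit_in_algebra.
rewrite mulrC; congr (_ / _); rewrite -(hl _ _ _ hx); congr (pr P' (_ `&` _)).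
by rewrite -limE // => w y; apply: expand_cadlag => x'; have [] := cad' w.
Qed.

(** The past under the jump law has no clocks of its own. The trace of an unlawful jump is a past
    event, and the expanded star process gives it probability 0. *)
Lemma psi_jump_past_lawful q r y s s' : q < r -> r < 0 -> ~~ lawful s s' ->
  pr P [set w | jump_set q r y s s' (path_of (z w) (X w))] = 0.
Proof.
move=> qr r0 nl; have [d' [T' [P' [zs [Xs [hst [hE hS hl]]]]]]] := psi_jump_past hjump he hu.
have [[[_ _ cad'] [N [_ hm]]] hlaw _] := hst.
have r0' : ratr r < 0 :> R by rewrite ltrq0.
rewrite hS; last first.
  by apply: jump_set_measurable => // i h1 h2; apply: le_lt_trans h2 _.
have hreg' : regular_process (fun w t => Defs.expand (zs w t)) Xs.
  by have [[hr _] _ _] := hst; exact: expand_regular.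
rewrite (pr_ae0 hm) ?mulr0 //.
  apply: measurableI; last exact: (check_limit_measurable hreg').
  apply: (measurable_path (J := fun i => pair_time i < 0)).
    by move=> i _; exact: path_measurable.
  by apply: jump_set_measurable => // i h1 h2; apply: le_lt_trans h2 _.
move=> w [hj _] hmw; have [cz cX] := cad' w.
apply: (lawful_no_jump _ _ qr nl _ hj) => //.
  by move=> x; exact: expand_cadlag.
move=> t _ _; split.
  apply: star_exchange_rule hmw _ cz cX => t' x.
  by have [_ hN _ _ _] := hlaw t'; exact: hN.
move=> k lk; exact: motion_displacement hmw (ltNyr t) cz cX lk.
Qed.

Lemma psi_jump_future_lawful q r y s s' : q < r -> 0 < q -> ~~ lawful s s' ->
  pr P [set w | jump_set q r y s s' (path_of (z w) (X w))] = 0.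
Proof.
move=> qr q0 nl; have [_ [_ [hreg [N [_ hm]]]]] := hjump.
have [_ _ cad] := hreg.
have q0' : 0 < ratr q :> R by rewrite ltr0q.
rewrite (pr_ae0 hm) //.
  apply: (measurable_path (J := predT)); first by move=> i _; exact: path_measurable.
  exact: jump_set_measurable.
move=> w hj hmw; have [cz cX] := cad w.
apply: (lawful_no_jump _ _ qr nl _ hj) => // t qt _.
have t0 : (0%:E < t%:E)%E by rewrite lte_fin; exact: lt_trans qt.
split; first exact: pair_exchange_rule hmw t0 cz cX.
by move=> k lk; exact: motion_displacement hmw t0 cz cX lk.
Qed.

Hypothesis jump0 : forall c, jump c 0 = false.
Hypothesis jump1 : forall c, jump c 1 = true.

Lemma psi_jump_pair : {ae P, forall w, forall t, 0 <= t -> z w t 0 = false /\ z w t 1 = true}.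
Proof.
have [_ [hz0 [[_ _ cad] [N [_ hm]]]]] := hjump.
apply: filterS2 hz0 hm => w h0 hmw t t0; have [cz cX] := cad w.
have [c hc] := cadlag_left_vals 0 cz; have [_ [k hk]] := cX 0.
have [hz _] := h0 c k hc hk.
by apply: (pair_kept hmw) => //; rewrite hz.
Qed.

(** On the fixed lattice [X 0 + 1] is site [delta + 1] of the frame just before the jump: for a
    right jump site 2, which the conditioning makes a hole, and for a left jump site 0, the hole of
    the pair. *)
Lemma psi_jump_left_vacant : (forall c, c site == v -> c 0 = false -> c (delta + 1) = false) ->
  {ae P, forall w, left_val (fun t => uncentred (z w) (X w) t (X w 0 + 1)) 0 false}.
Proof.
move=> hd; have [_ [hz0 [hreg _]]] := hjump; have [_ _ cad] := hreg.
have hE : {ae P, forall w, left_val (fun t => check (z w t) e1 e2) 0 true}.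
  apply: (@ae_pr1 _ _ _ P [set w | left_val (fun t => check (z w t) e1 e2) 0 true]).
    exact: (check_limit_measurable hreg).
  (* The conditioning pattern repeated twice still has value [u], so its conditional probability is
     [u / u]. *)
  have hee : psi_value rho (e1 ++ e1) (e2 ++ e2) u.
    move=> d' T' P' c hc; rewrite -(hu hc); congr pr; apply/funext => w.
    by rewrite /mkset check_cat andbb.
  have h := psi_jump_limit hee.
  rewrite divff in h; last exact: u0.
  exact: h.
have h00 : {ae P, forall w, forall n, z w (@before0 R n) 0 = false}.
  apply/ae_foralln => n.
  have [d' [T' [P' [zs [Xs [hst [hE' hS hl]]]]]]] := psi_jump_past hjump he hu.
  pose S : set (set (path_index R)) := [set s | s (inl (@before0 R n, 0, false))].
  have mS : <<s coordinates (fun i => pair_time i < 0) >> S.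
    by apply: coordinate_set; exact: before0_lt0.
  apply: (@ae_pr1 _ _ _ P [set w | z w (@before0 R n) 0 = false]).
    by have [mz _ _] := hreg; exact: mz.
  have := hS S mS.
  rewrite (_ : [set w | S (path_of (fun t => Defs.expand (zs w t)) (Xs w))] = setT).
    by rewrite setTI hE' mulVf.
  by apply/seteqP; split.
apply: filterS3 hz0 hE h00 => w h0 hEw h0w.
have [cz cX] := cad w.
have [c hc] := cadlag_left_vals 0 cz; have [_ [k hk]] := cX 0.
have [_ hX] := h0 c k hc hk.
have c0 : c 0 = false.
  have [N _ hN] := left_val_before0 (hc 0).
  by rewrite -(hN N (leqnn N)) h0w.
have cs : c site == v.
  by rewrite he; exact: (left_val_inj (check_left_val e1 e2 hc) hEw).
apply: uncentred_left_val hk _; rewrite hX.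
have -> : k + delta + 1 - k = delta + 1 by lia.
by rewrite -(hd c cs c0); exact: hc.
Qed.

Lemma psi_jump_still (cr er cl el h : R) : 0 <= h -> 0 < cr < 1 -> 0 < cl < 1 ->
  (forall i j, exists l1 l2,
    (forall w c, z w 0 =1 jump c -> queues_ge z i j w <-> check c l1 l2) /\
    psi_value rho (l1 ++ e1) (l2 ++ e2) (u * (tail cr er i * tail cl el j))) ->
  pr P (still X h) = (expR (- h + h * cr) * (1 + er * h * cr)) *
    (expR (- h + h * cl) * (1 + el * h * cl)).
Proof.
move=> h0 hcr hcl hlaw; have [_ [hz0 hta]] := hjump; have [hreg _] := hta.
have [mz _ cad] := hreg.
apply: (still_total hta) => //.
  by apply: filterS psi_jump_pair => w; apply.
move=> i j; have [l1 [l2 [hq hv]]] := hlaw i j.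
have -> : tail cr er i * tail cl el j = u * (tail cr er i * tail cl el j) / u.
  by rewrite [u * _]mulrC mulfK.
rewrite -(psi_jump_limit hv); apply: pr_ae_eq.
- by apply: queues_ge_algebra => //; exact: sigma_algebra_measurable.
- exact: (check_limit_measurable hreg).
apply: filterS hz0 => w h1; have [cz cX] := cad w.
have [c hc] := cadlag_left_vals 0 cz; have [_ [k hk]] := cX 0.
have [hz _] := h1 c k hc hk; rewrite /= (hq w c hz).
have hl := check_left_val l1 l2 hc.
by split=> [e|/(left_val_inj hl)//]; rewrite -e.
Qed.

End psi_jump.

(** * The two jump laws *)

Lemma run_from_ge1 s k : all (fun p : nat * bool => (1 <= p.1)%N) (run_from s k).
Proof. by apply/allP => p /mapP [x]; rewrite mem_iota => /andP [h _] ->; exact: leq_ltn_trans h. Qed.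

Lemma check_runs c s k s' k' : check c (run_from s k) (run_from s' k') <->
  (forall x : int, s%:Z + 1 < x -> x < s%:Z + k%:Z + 2 -> c x = true) /\
  (forall x : int, - s'%:Z - k'%:Z <= x -> x < - s'%:Z -> c x = false).
Proof.
split.
  move=> /andP [/allP h1 /allP h2]; split=> x x1 x2.
    have := h1 ((`|x| - 1)%N, true); rewrite /=.
    have -> : (`|x| - 1)%N%:Z + 1 = x by lia.
    by move=> h; apply/eqP/h/mapP; exists (`|x| - 1)%N; rewrite // mem_iota; lia.
  have := h2 (`|x|%N, true); rewrite /=.
  have -> : - `|x|%N%:Z = x by lia.
  by move=> h; apply/eqP/h/mapP; exists `|x|%N; rewrite // mem_iota; lia.
move=> [h1 h2]; apply/andP; split; apply/allP => p /mapP [x]; rewrite mem_iota => hx -> /=.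
  by apply/eqP/h1; lia.
by apply/eqP/h2; lia.
Qed.

Section cases.
Variables (R : realType) (rho : R).
Hypothesis hrho : 0 < rho < 1.

Lemma psi_value_catC l1 l1' l2 l2' x :
  psi_value rho (l1 ++ l1') (l2 ++ l2') x -> psi_value rho (l1' ++ l1) (l2' ++ l2) x.
Proof.
move=> h d T P c hc; rewrite -(h _ _ _ _ hc); congr pr; apply/funext => w.
by rewrite /mkset !check_cat andbC.
Qed.

Lemma psi_value_right i j : psi_value rho ((1%N, false) :: run_from 1 i) (run_from 0 j)
  ((1 - rho) ^+ 2 * tail rho (1 - rho) i * tail (1 - rho) rho j).
Proof.
move=> d T P c hc; apply: (Psi_rho_check hc) => [||a ha|a ha].
- exact: run_from_ge1.
- exact: run_from_ge1.
- exact: Psi_plus_vacant_run ha i.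
- by have := Psi_plus_run ha j; rewrite subKr.
Qed.

Lemma psi_value_left i j : psi_value rho (run_from 0 i) ((1%N, false) :: run_from 1 j)
  (rho ^+ 2 * tail rho (1 - rho) i * tail (1 - rho) rho j).
Proof.
move=> d T P c hc; rewrite (mulrC (rho ^+ 2)) -mulrA; apply: (Psi_rho_check hc) => [||a ha|a ha].
- exact: run_from_ge1.
- exact: run_from_ge1.
- exact: Psi_plus_run ha i.
- by have := Psi_plus_vacant_run ha j; rewrite subKr.
Qed.

Lemma tail0 (c e : R) : tail c e 0 = 1.
Proof. by rewrite /tail expr0 mul0r addr0 mulr1. Qed.

(** Tail of a run length plus one: with [e = 1 - c] one has [1 + (j - 1) e = c + j e], and the
    factor [c] moves into the power. *)
Lemma tail_pred (c e : R) j : c != 0 -> e = 1 - c -> tail c e j.-1 = tail c (e / c) j.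
Proof.
move=> c0 ->; case: j => [|j]; first by rewrite /= !tail0.
rewrite /tail exprS /= -[j.+1%:R]natr1; by field.
Qed.

Lemma check_hole_right c : (c 2 == false) = check c [:: (1%N, false)] [::].
Proof. by rewrite /check /= !andbT. Qed.

Lemma check_particle_left c : (c (-1) == true) = check c [::] [:: (1%N, false)].
Proof. by rewrite /check /= andbT. Qed.

Let rho0 : 0 < rho. Proof. by case/andP: hrho. Qed.
Let rho1 : rho < 1. Proof. by case/andP: hrho. Qed.
Let sig0 : 0 < 1 - rho. Proof. by rewrite subr_gt0. Qed.
Let sig1 : 1 - rho < 1. Proof. by rewrite gtrBl. Qed.

Lemma value_hole_right : psi_value rho [:: (1%N, false)] [::] ((1 - rho) ^+ 2).
Proof.
have := @psi_value_right 0 0; rewrite !tail0 !mulr1; exact.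
Qed.

Lemma value_particle_left : psi_value rho [::] [:: (1%N, false)] (rho ^+ 2).
Proof.
have := @psi_value_left 0 0; rewrite !tail0 !mulr1; exact.
Qed.

Definition still_value (h b : R) : R :=
  (1 + rho * (1 - rho) * h) * (1 + b * h) * expR (- h).

Section psi1.
Context {d : measure_display} {T : measurableType d}.
Variables (P : probability T R) (z : T -> R -> int -> bool) (X : T -> R -> int).
Hypothesis hz : law_Psi1 rho P z X.

(** The right queue is a run starting behind the vacant site 2, while the old hole of the pair is
    left at site -1 and lengthens the left queue by one, whence [j.-1] and [rho / (1 - rho)]. *)
Lemma Psi1_still h : 0 <= h -> pr P (still X h) = still_value h rho.
Proof.
move=> h0.
rewrite (@psi_jump_still _ _ _ _ _ _ _ _ _ _ _ hz _ _ check_hole_right _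
   value_hole_right _ _ _ rho (1 - rho) (1 - rho) (rho / (1 - rho))) //.
- rewrite /still_value mulrACA -expRD mulrC.
  have -> : - h + h * rho + (- h + h * (1 - rho)) = - h by ring.
  by congr (_ * _ * _); congr (1 + _); [ring|rewrite mulrAC divfK ?gt_eqF].
- by rewrite expf_neq0 // gt_eqF.
- by rewrite sig0 sig1.
move=> i j; exists (run_from 1 i), (run_from 0 j.-1); split.
  move=> w c hc; rewrite check_runs; split=> -[h1 h2]; split=> x x1 x2.
  - have := h1 (x - 1) ltac:(lia) ltac:(lia).
    rewrite hc /jump_right !ifF ?subrK //; lia.
  - have := h2 (x - 1) ltac:(lia) ltac:(lia).
    rewrite hc /jump_right !ifF ?subrK //; lia.
  - by rewrite hc /jump_right !ifF; [apply: h1|..]; lia.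
  - rewrite hc /jump_right; case: ifP => // hx.
    by rewrite ifF; [apply: h2|]; lia.
apply: psi_value_catC; rewrite -(@tail_pred _ rho j) ?subKr ?gt_eqF // mulrA.
exact: psi_value_right.
Qed.

End psi1.

Section psi2.
Context {d : measure_display} {T : measurableType d}.
Variables (P : probability T R) (z : T -> R -> int -> bool) (X : T -> R -> int).
Hypothesis hz : law_Psi2 rho P z X.

(** Mirror image: the left queue starts beyond the particle at site -1, and the old particle of the
    pair lengthens the right queue by one. *)
Lemma Psi2_still h : 0 <= h -> pr P (still X h) = still_value h (1 - rho).
Proof.
move=> h0.
rewrite (@psi_jump_still _ _ _ _ _ _ _ _ _ _ _ hz _ _ check_particle_left _
   value_particle_left _ _ _ rho ((1 - rho) / rho) (1 - rho) rho) //.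
- rewrite /still_value mulrACA -expRD mulrC (mulrC (1 + _ * _ * rho)).
  have -> : - h + h * rho + (- h + h * (1 - rho)) = - h by ring.
  by congr (_ * _ * _); congr (1 + _); [ring|rewrite mulrAC divfK ?gt_eqF].
- by rewrite expf_neq0 // gt_eqF.
- by rewrite sig0 sig1.
move=> i j; exists (run_from 0 i.-1), (run_from 1 j); split.
  move=> w c hc; rewrite check_runs; split=> -[h1 h2]; split=> x x1 x2.
  - have := h1 (x + 1) ltac:(lia) ltac:(lia).
    rewrite hc /jump_left !ifF ?addrK //; lia.
  - have := h2 (x + 1) ltac:(lia) ltac:(lia).
    rewrite hc /jump_left !ifF ?addrK //; lia.
  - rewrite hc /jump_left ifF; last by lia.
    case: ifP => // hx; apply: h1; lia.
  - by rewrite hc /jump_left !ifF; [apply: h2|..]; lia.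
apply: psi_value_catC; rewrite -(@tail_pred rho _ i) ?gt_eqF // mulrA.
exact: psi_value_left.
Qed.

End psi2.

End cases.

(** * Conclusion *)

Section still_coordinates.
Variable R : realType.

(** Stillness as a set of paths, with the common value [k] as witness, so that it can be transferred
    to the two jump laws. *)
Definition still_set (h : R) : set (set (path_index R)) :=
  \bigcup_(k : int) ([set s | s (inr (0, k))] `&` [set s | s (inr (h, k))] `&`
    \bigcap_(q : rat) (if (0 <= ratr q :> R) && (ratr q <= h :> R)
      then [set s | s (inr (ratr q, k))] else setT)).

Lemma still_set_measurable h : <<s coordinates predT >> (still_set h).
Proof.
have hc i : <<s coordinates predT >> [set s : set (path_index R) | s i] by exact: coordinate_set.
apply: (@countable_bigcupT_measurable _ (g_sigma_algebraType (coordinates predT))) => // k.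
apply: (@measurableI _ (g_sigma_algebraType (coordinates predT))).
  by apply: (@measurableI _ (g_sigma_algebraType (coordinates predT))); exact: hc.
apply: (@countable_bigcapT_measurable _ (g_sigma_algebraType (coordinates predT))) => // q.
case: ifP => _; first exact: hc.
exact: (@measurableT _ (g_sigma_algebraType (coordinates predT))).
Qed.

Lemma still_setP z (X : R -> int) h : 0 <= h -> cadlag X ->
  still_set h (path_of z X) <-> forall u, 0 <= u -> u <= h -> X u = X 0.
Proof.
move=> h0 cX; split.
  move=> [k _ [[e0 eh] hq]] u u0; rewrite le_eqVlt => /predU1P [->|uh].
    by rewrite [LHS]eh [RHS]e0.
  have [/near_rightP [b ub hb] _] := cX u.
  have [q] := @rat_in_itvoo R u (Num.min b h) ltac:(by rewrite lt_min ub uh).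
  rewrite in_itv /= lt_min => /and3P [q1 q2 q3].
  have := hq q Logic.I; rewrite ifT; last by rewrite (le_trans u0 (ltW q1)) ltW.
  by rewrite /= hb // => ->; rewrite [RHS]e0.
move=> hX; exists (X 0) => //; split; first by split=> //=; exact: hX.
move=> q _; case: ifP => // /andP [q0 qh] /=; exact: hX.
Qed.

Definition left_vacant_set : set (set (path_index R)) :=
  \bigcup_(k : int) ([set s | s (inr (0, k))] `&`
    \bigcup_N \bigcap_(n in [set n | (N <= n)%N])
      \bigcup_(k' : int) ([set s | s (inr (before0 n, k'))] `&`
        [set s | s (inl (before0 n, k + 1 - k', false))])).

Lemma left_vacant_set_measurable : <<s coordinates predT >> left_vacant_set.
Proof.
have hc i : <<s coordinates predT >> [set s : set (path_index R) | s i] by exact: coordinate_set.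
apply: (@countable_bigcupT_measurable _ (g_sigma_algebraType (coordinates predT))) => // k.
apply: (@measurableI _ (g_sigma_algebraType (coordinates predT))); first exact: hc.
apply: (@bigcup_measurable _ (g_sigma_algebraType (coordinates predT))) => N _.
apply: (@bigcap_measurableType _ (g_sigma_algebraType (coordinates predT))) => n _.
apply: (@countable_bigcupT_measurable _ (g_sigma_algebraType (coordinates predT))) => // k'.
by apply: (@measurableI _ (g_sigma_algebraType (coordinates predT))); exact: hc.
Qed.

Lemma left_vacant_setP z (X : R -> int) : (forall x, cadlag (z^~ x)) -> cadlag X ->
  left_vacant_set (path_of z X) <->
  left_val (fun t => uncentred z X t (X 0 + 1)) 0 false.
Proof.
move=> cz cX.
have [_ [b hb]] := uncentred_cadlag (X 0 + 1) cz cX 0.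
have hl : left_val (fun t => uncentred z X t (X 0 + 1)) 0 false <->
    left_val (fun t => ~~ uncentred z X t (X 0 + 1)) 0 true.
  by rewrite left_val_negb.
rewrite hl left_val_trueP; last by exists (~~ b); rewrite left_val_negb negbK.
split.
  move=> [k _ [e0 [N _ hN]]]; exists N => n Nn.
  have [k' _ [e1 e2]] := hN n Nn; rewrite /= in e0 e1 e2.
  by rewrite /uncentred e0 e1 e2.
move=> [N hN]; exists (X 0) => //; split=> //; exists N => // n Nn.
exists (X (before0 n)) => //; split=> //=.
by apply/negbTE; exact: hN.
Qed.

End still_coordinates.

Section law_Psi_path.
Context {R : realType} {d : measure_display} {T : measurableType d}.
Variables (rho : R) (P : probability T R) (z : T -> R -> int -> bool) (X : T -> R -> int).
Hypothesis hrho : 0 < rho < 1.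
Hypothesis hPsi : law_Psi rho P z X.

Lemma law_Psi_transfer : exists d1 d2 (T1 : measurableType d1) (T2 : measurableType d2)
    (P1 : probability T1 R) (P2 : probability T2 R) z1 X1 z2 X2,
  [/\ law_Psi1 rho P1 z1 X1, law_Psi2 rho P2 z2 X2 &
    forall S, <<s coordinates predT >> S -> pr P [set w | S (path_of (z w) (X w))] =
    (1 - rho) ^+ 2 / ((1 - rho) ^+ 2 + rho ^+ 2) * pr P1 [set w | S (path_of (z1 w) (X1 w))] +
    rho ^+ 2 / ((1 - rho) ^+ 2 + rho ^+ 2) * pr P2 [set w | S (path_of (z2 w) (X2 w))]].
Proof.
have [hreg [d1 [d2 [T1 [T2 [P1 [P2 [z1 [X1 [z2 [X2 [h1 h2 hl]]]]]]]]]]]] := hPsi.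
exists d1, d2, T1, T2, P1, P2, z1, X1, z2, X2; split=> // S hS.
have [_ [_ [hreg1 _]]] := h1; have [_ [_ [hreg2 _]]] := h2.
have mp i := path_measurable hreg i.
have mp1 i := path_measurable hreg1 i.
have mp2 i := path_measurable hreg2 i.
set a1 := _ / _; set a2 := rho ^+ 2 / _.
have a10 : 0 <= a1 by rewrite divr_ge0 ?addr_ge0 ?sqr_ge0.
have a20 : 0 <= a2 by rewrite divr_ge0 ?addr_ge0 ?sqr_ge0.
have finP : (P setT < +oo)%E by rewrite probability_setT ltry.
have heq l : all predT l -> P (cylinder (fun i => [set w | path_of (z w) (X w) i]) l) =
    (a1%:E * P1 (cylinder (fun i => [set w | path_of (z1 w) (X1 w) i]) l) +
     a2%:E * P2 (cylinder (fun i => [set w | path_of (z2 w) (X2 w) i]) l))%E.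
  by move=> _; rewrite !path_cylinder; exact: hl.
have e := @transfer R (path_index R) predT _ _ P _ _ P1 _ _ P2
    (fun w => path_of (z w) (X w)) (fun w => path_of (z1 w) (X1 w))
    (fun w => path_of (z2 w) (X2 w)) a1 a2 finP a10 a20 (fun i _ => mp i)
    (fun i _ => mp1 i) (fun i _ => mp2 i) heq S hS.
have m1 := measurable_path (fun i _ => mp1 i) hS.
have m2 := measurable_path (fun i _ => mp2 i) hS.
have m := measurable_path (fun i _ => mp i) hS.
apply: EFin_inj; rewrite EFinD !EFinM -(prE P m) -(prE P1 m1) -(prE P2 m2).
exact: e.
Qed.

Let w_pos : 0 < (1 - rho) ^+ 2 + rho ^+ 2.
Proof. by have /andP [h _] := hrho; rewrite ltr_wpDl ?sqr_ge0 // exprn_gt0. Qed.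

Lemma law_Psi_still h : 0 <= h -> pr P (still X h) =
  (1 + rho * (1 - rho) * h / ((1 - rho) ^+ 2 + rho ^+ 2))
     * (1 + rho * (1 - rho) * h) * expR (- h).
Proof.
move=> h0; have [d1 [d2 [T1 [T2 [P1 [P2 [z1 [X1 [z2 [X2 [h1 h2 hS]]]]]]]]]]] := law_Psi_transfer.
have [hreg _] := hPsi; have [_ [_ [hreg1 _]]] := h1; have [_ [_ [hreg2 _]]] := h2.
have E d0 (U : measurableType d0) (y : U -> R -> int -> bool) Y : (forall w : U, cadlag (Y w)) ->
    [set w | still_set h (path_of (y w) (Y w))] = still Y h.
  by move=> cY; apply/funext => w; apply/propext; apply: still_setP.
have := hS _ (still_set_measurable h); rewrite !E.
- move=> ->; rewrite (Psi1_still hrho h1 h0) (Psi2_still hrho h2 h0) /still_value.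
  by field; rewrite gt_eqF.
- by have [_ _ cad] := hreg2; move=> w; have [] := cad w.
- by have [_ _ cad] := hreg1; move=> w; have [] := cad w.
- by have [_ _ cad] := hreg; move=> w; have [] := cad w.
Qed.

(** The two weights add up to 1, so probability 1 under both jump laws gives probability 1 under the
    mixture. *)
Lemma law_Psi_ae S : <<s coordinates predT >> S ->
  (forall d' (T' : measurableType d') (P' : probability T' R) z' X',
    law_Psi1 rho P' z' X' \/ law_Psi2 rho P' z' X' ->
    {ae P', forall w, S (path_of (z' w) (X' w))}) ->
  {ae P, forall w, S (path_of (z w) (X w))}.
Proof.
move=> hS h; have [d1 [d2 [T1 [T2 [P1 [P2 [z1 [X1 [z2 [X2 [h1 h2 hP]]]]]]]]]]] := law_Psi_transfer.
have [hreg _] := hPsi; have [_ [_ [hreg1 _]]] := h1; have [_ [_ [hreg2 _]]] := h2.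
have hae1 := h _ _ _ _ _ (or_introl h1).
have hae2 := h _ _ _ _ _ (or_intror h2).
have m1 := measurable_path (fun i _ => path_measurable hreg1 i) hS.
have m2 := measurable_path (fun i _ => path_measurable hreg2 i) hS.
have m := measurable_path (fun i _ => path_measurable hreg i) hS.
apply: (@ae_pr1 _ _ _ P [set w | S (path_of (z w) (X w))]); first exact: m.
rewrite hP // (pr_ae1 hae1) // (pr_ae1 hae2) //.
by field; rewrite gt_eqF.
Qed.

Lemma law_Psi_regular : {ae P, forall w,
  [/\ forall t, 0 <= t -> z w t 0 = false /\ z w t 1 = true,
      left_val (fun t => uncentred (z w) (X w) t (X w 0 + 1)) 0 false,
      forall t, t < 0 -> lawful_at (z w) (X w) t &
      forall t, 0 < t -> lawful_at (z w) (X w) t]}.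
Proof.
have [/andP [rho0 rho1] sig0] : 0 < rho < 1 /\ (1 - rho) ^+ 2 != 0.
  by split=> //; case/andP: hrho => h1 h2; rewrite expf_neq0 // gt_eqF // subr_gt0.
have rho2 : rho ^+ 2 != 0 by rewrite expf_neq0 // gt_eqF.
have [hreg _] := hPsi; have [_ _ cad] := hreg.
have hpair : {ae P, forall w, forall q : rat, 0 <= ratr q :> R ->
    z w (ratr q) 0 = false /\ z w (ratr q) 1 = true}.
  apply: ae_countable => q.
  have [q0|q0] := boolP (0 <= ratr q :> R); last by apply: filterE.
  have mS : <<s coordinates predT >> ([set s : set (path_index R) | s (inl (ratr q, 0, false))] `&`
      [set s : set (path_index R) | s (inl (ratr q, 1, true))]).
    exact: (@measurableI _ (g_sigma_algebraType (coordinates predT)) _ _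
      (coordinate_set (J := predT) (i := inl (ratr q, 0, false)) isT)
      (coordinate_set (J := predT) (i := inl (ratr q, 1, true)) isT)).
  have h := law_Psi_ae mS.
  have hh : {ae P, forall w, ([set s : set (path_index R) | s (inl (ratr q, 0, false))] `&`
      [set s : set (path_index R) | s (inl (ratr q, 1, true))]) (path_of (z w) (X w))}.
    apply: h => d' T' P' z' X' hz.
    have hz' : {ae P', forall w, forall t, 0 <= t -> z' w t 0 = false /\ z' w t 1 = true}.
      by case: hz => hz; exact: (psi_jump_pair hz (fun=> erefl) (fun=> erefl)).
    by apply: filterS hz' => w /(_ _ q0) [].
  by apply: filterS hh => w [].
have hvac : {ae P, forall w, left_vacant_set (path_of (z w) (X w))}.
  apply: law_Psi_ae; first exact: left_vacant_set_measurable.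
  move=> d' T' P' z' X' [hz|hz]; have [_ [_ [[_ _ cad'] _]]] := hz.
    have hh := psi_jump_left_vacant hz check_hole_right (@value_hole_right _ rho) sig0
      (fun c cs _ => eqP cs).
    by apply: filterS hh => w hw; have [cz cX] := cad' w; apply/left_vacant_setP.
  have hh := psi_jump_left_vacant hz check_particle_left (@value_particle_left _ rho) rho2
    (fun c _ c0 => c0).
  by apply: filterS hh => w hw; have [cz cX] := cad' w; apply/left_vacant_setP.
(* Only intervals away from 0 are used: the transition at time 0 is imposed by the construction, not
   by clocks. *)
have hjump : {ae P, forall w, forall i : rat * rat * int * bond_state * bond_state,
    let: (q, r, y, s, s') := i in
    q < r -> (r < 0) || (0 < q) -> ~~ lawful s s' ->
    ~ jump_set q r y s s' (path_of (z w) (X w))}.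
  apply: ae_countable => -[[[[q r] y] s] s'].
  have [qr|qr] := boolP (q < r); last by apply: filterE.
  have [qr0|qr0] := boolP ((r < 0) || (0 < q)); last by apply: filterE.
  have [ls|ls] := boolP (lawful s s'); first by apply: filterE.
  have mJ : <<s coordinates predT >> (jump_set (R := R) q r y s s').
    exact: jump_set_measurable.
  have mJC : <<s coordinates predT >> (~` jump_set (R := R) q r y s s').
    exact: (@measurableC _ (g_sigma_algebraType (coordinates predT))).
  suff h : {ae P, forall w, (~` jump_set q r y s s') (path_of (z w) (X w))}.
    by apply: filterS h.
  apply: (law_Psi_ae mJC) => d' T' P' z' X' hz.
  have hreg' : regular_process z' X' by case: hz => -[_ [_ []]].
  have mJ' := measurable_path (fun i _ => path_measurable hreg' i) mJ.
  apply: (ae_pr0 mJ'); case: hz => hz; case/orP: qr0 => h0.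
  - exact: (psi_jump_past_lawful hz check_hole_right (@value_hole_right _ rho)).
  - exact: (psi_jump_future_lawful hz).
  - exact: (psi_jump_past_lawful hz check_particle_left (@value_particle_left _ rho)).
  - exact: (psi_jump_future_lawful hz).
apply: filterS3 hpair hvac hjump => w hp hv hj; have [cz cX] := cad w; split.
- move=> t t0; have [/near_rightP [b0 tb0 hb0] _] := cz 0 t.
  have [/near_rightP [b1 tb1 hb1] _] := cz 1 t.
  have [q] := @rat_in_itvoo R t (Num.min b0 b1) ltac:(by rewrite lt_min tb0 tb1).
  rewrite in_itv /= lt_min => /and3P [q1 q2 q3].
  have [] := hp q (le_trans t0 (ltW q1)).
  by rewrite hb0 // hb1.
- by apply/left_vacant_setP.
- move=> t t0; apply: contrapT => nl.
  have t1 : t - 1 < t by rewrite gtrBl.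
  have [q [r [y [s [s' [h1 h2 h3 h4 h5]]]]]] := jump_of_not_lawful cz cX t1 t0 nl.
  by apply: (hj (q, r, y, s, s')) h5 => //; rewrite -(ltrq0 R) h2.
- move=> t t0; apply: contrapT => nl.
  have t1 : t < t + 1 by rewrite ltrDl.
  have [q [r [y [s [s' [h1 h2 h3 h4 h5]]]]]] := jump_of_not_lawful cz cX t0 t1 nl.
  by apply: (hj (q, r, y, s, s')) h5 => //; rewrite -(ltr0q R) h1 orbT.
Qed.

End law_Psi_path.

Theorem proposition1p5 (R : realType) (rho : R) (hrho : 0 < rho < 1)
    (d : measure_display) (T : measurableType d) (P : probability T R)
    (xi : int * int -> T -> R) (gamma : T -> set (int * int))
    (hnu : law_nu rho P xi gamma) (h : R) (hh : 0 <= h) :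
  P [set w | h < xi (0, 0) w]
  = ((1 + rho * (1 - rho) * h / ((1 - rho) ^+ 2 + rho ^+ 2))
     * (1 + rho * (1 - rho) * h) * expR (- h))%:E.
Proof.
have [[mxi _] [d' [T' [P' [z [X [xi' [gamma' [hPsi [mxi' _] henv hlaw]]]]]]]]] := hnu.
have mle (d0 : measure_display) (T0 : measurableType d0) (f : T0 -> R) :
    measurable_fun setT f -> measurable [set w | f w <= h].
  by move=> mf; rewrite -[X in measurable X]setTI; apply: measurable_fun_le.
have m := mle _ _ _ (mxi (0, 0)); have m' := mle _ _ _ (mxi' (0, 0)).
have [hreg _] := hPsi; have [_ _ cad] := hreg.
have -> : [set w | h < xi (0, 0) w] = ~` [set w | xi (0, 0) w <= h].
  by apply/seteqP; split=> w /=; rewrite ltNge => /negP.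
have mC := measurableC m; rewrite (prE P mC) prC //; congr EFin.
have -> : pr P [set w | xi (0, 0) w <= h] = pr P' [set w | xi' (0, 0) w <= h].
  have := hlaw [:: inl ((0, 0), h)]; rewrite /cylinder !big_seq1 /= /pr => e.
  by rewrite e.
have mS := still_measurable hreg hh.
rewrite -(prC P' m') -(law_Psi_still hrho hPsi hh).
apply: pr_ae_eq => //; first exact: measurableC.
apply: filterS2 henv (law_Psi_regular hrho hPsi) => w henvw [hp hv hneg hpos].
have [cz cX] := cad w.
have := environment_xi_le h henvw cz cX hp hv
  (fun t t0 => (hneg t t0).1) (fun t t0 => (hpos t t0).1)
  (fun t k t0 => (hpos t t0).2 k) => hxi.
split=> /=.
  move=> hn u u0 uh; apply: contrapT => hne; apply: hn; apply/hxi.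
  by exists u.
by move=> hs /hxi [u [u0 uh]]; apply; exact: hs.
Qed.
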